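(* Let $d\in\mathbb{N}$ and let $\{\mathbf{x}_t\}_{t\ge1}$ be a non-stochastic sequence of vectors $\mathbf{x}_t^\top=(x_{1t},\dots,x_{dt})\in\mathbb{R}^{1\times d}$. For $T\in\mathbb{N}$ let $\mathbf{X}_T\in\mathbb{R}^{T\times d}$ have rows $\mathbf{x}_1^\top,\dots,\mathbf{x}_T^\top$, let $s_{iT}^2=\sum_{t=1}^T x_{it}^2$, let $\mathbf{S}_T=\mathrm{diag}(s_{1T},\dots,s_{dT})$ and $\mathbf{Z}_T=\mathbf{X}_T\mathbf{S}_T^{-1}$. Assume the Grenander conditions: (G1) $\lim_{T\to\infty}s_{iT}^2=\infty$ for each $i\in[d]$; (G2) $\lim_{T\to\infty}x_{iT}^2/s_{iT}^2=0$ for each $i\in[d]$; (G3) for each $i,j\in[d]$ and each integer $k\ge0$, the limit $\rho_{ij}(k)=\lim_{T\to\infty}(s_{iT}s_{jT})^{-1}\sum_{t=1}^{T-k}x_{it}x_{j,t+k}$ exists; set $\rho_{ij}(-k)=\rho_{ji}(k)$ and let $\mathbf{R}(k)$ be the $d\times d$ matrix with entries $\rho_{ij}(k)$; (G4) $\mathbf{R}(0)$ is non-singular. Let $\mathbf{H}(\omega)$, $\omega\in[-\pi,\pi]$, be a Hermitian-matrix-valued function with positive semidefinite increments such that $\mathbf{R}(k)=\int_{-\pi}^{\pi}e^{\iota k\omega}\,\mathrm{d}\mathbf{H}(\omega)$ for all integers $k$ ($\iota=\sqrt{-1}$). Let $\bm\beta\in\mathbb{R}^d$ be non-stochastic and $Y_t=\mathbf{x}_t^\top\bm\beta+U_t$,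 $\mathbf{y}_T=(Y_1,\dots,Y_T)^\top$, $\mathbf{u}_T=(U_1,\dots,U_T)^\top$, where: (M1) $U_t=\sum_{i=-\infty}^{\infty}\theta_iE_{t-i}$, with $\{E_t\}_{t\in\mathbb{Z}}$ an independent sequence with $\mathbb{E}(E_t)=0$, $\mathrm{var}(E_t)=\sigma^2<\infty$, $\sum_{i}|\theta_i|<\infty$, and $\left|\sum_{i=-\infty}^\infty\theta_ie^{-\iota i\omega}\right|>0$ for all $\omega\in[-\pi,\pi]$; (M2) the distribution functions $F_{E_t}$ of $E_t$ satisfy $\lim_{\delta\to\infty}\sup_{t\in\mathbb{Z}}\int_{|e|>\delta}e^2\,\mathrm{d}F_{E_t}(e)=0$. Let $\{V_t\}_{t\in\mathbb{Z}}$ be a stationary process with autocovariances $\eta_i=\mathrm{cov}(V_t,V_{t+i})$ ($\eta_{-i}=\eta_i$) and spectral density $f_v(\omega)=(2\pi)^{-1}\sum_{i=-\infty}^\infty\eta_ie^{-\iota i\omega}$, such that (M3) $f_v$ is real, positive, continuous and even on $[-\pi,\pi]$; (M4) $\sum_{i=1}^\infty i|\eta_i|<\infty$. Let $\bm\Lambda_T$ be the $T\times T$ Toeplitz matrix with $(s,t)$ entry $\eta_{|s-t|}$, let $\bm\Sigma_T=\mathbb{E}(\mathbf{u}_T\mathbf{u}_T^\top)$, let $f_u$ be the spectral density of $\{U_t\}$, and define the estimator $\tilde{\bm\beta}_T(f_v)=(\mathbf{X}_T^\top\bm\Lambda_T^{-1}\mathbf{X}_T)^{-1}\mathbf{X}_T^\top\bm\Lambda_T^{-1}\mathbf{y}_T$.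 Then \[\mathbf{S}_T\big(\tilde{\bm\beta}_T(f_v)-\bm\beta\big)\xrightarrow{\mathcal{L}}\mathrm{N}(\mathbf{0},\mathbf{C}_v)\quad(T\to\infty),\] where \[ \mathbf{C}_v=\lim_{T\to\infty}(\mathbf{Z}_T^\top\bm\Lambda_T^{-1}\mathbf{Z}_T)^{-1}\mathbf{Z}_T^\top\bm\Lambda_T^{-1}\bm\Sigma_T\bm\Lambda_T^{-1}\mathbf{Z}_T(\mathbf{Z}_T^\top\bm\Lambda_T^{-1}\mathbf{Z}_T)^{-1} =2\pi\left[\int_{-\pi}^{\pi}\frac{\mathrm{d}\mathbf{H}(\omega)}{f_v(\omega)}\right]^{-1}\int_{-\pi}^{\pi}\frac{f_u(\omega)}{f_v^2(\omega)}\mathrm{d}\mathbf{H}(\omega)\left[\int_{-\pi}^{\pi}\frac{\mathrm{d}\mathbf{H}(\omega)}{f_v(\omega)}\right]^{-1}.\]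
   Context: $[n]=\{1,\dots,n\}$. $\iota$ is the imaginary unit. $\xrightarrow{\mathcal{L}}$ denotes convergence in law; $\mathrm{N}(\mathbf{0},\mathbf{C})$ is the multivariate normal distribution with mean $\mathbf{0}$ and covariance $\mathbf{C}$. The spectral density of a stationary process with autocovariances $\gamma_i$ is $(2\pi)^{-1}\sum_i\gamma_ie^{-\iota i\omega}$. *)

(* Defs.v *)
From HB Require Import structures.
From mathcomp Require Import all_boot all_order all_algebra.
From mathcomp Require Import all_classical all_reals all_analysis.
From mathcomp Require Import complex.
Import Order.TTheory GRing.Theory Num.Theory numFieldNormedType.Exports.

Set Implicit Arguments.
Unset Strict Implicit.
Unset Printing Implicit Defensive.

Local Open Scope ring_scope.
Local Open Scope complex_scope.
Local Open Scope classical_set_scope.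

Section Defs.
Variable R : realType.

Definition zwin (n k : nat) : int := (k%:Z - n%:Z)%R.

Definition zsum (c : int -> R) (n : nat) : R :=
  \sum_(k < (2 * n).+1) c (zwin n k).

Definition abs_summable_Z (c : int -> R) : Prop :=
  exists M : R, forall n, zsum (fun i => `|c i|) n <= M.

Definition fourier_Z (c : int -> R) (w : R) : R[i] :=
  (limn (zsum (fun i => c i * cos (i%:~R * w)))) +i*
  (- limn (zsum (fun i => c i * sin (i%:~R * w)))).

Definition spec_dens (gamma : int -> R) (w : R) : R[i] :=
  ((2 * pi)^-1)%:C * fourier_Z gamma w.

Definition expi (x : R) : R[i] := cos x +i* sin x.

Definition is_RS (g h : R -> R[i]) (a b : R) (v : R[i]) : Prop :=
  forall eps : R, 0 < eps -> exists2 delta : R, 0 < delta &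
    forall (n : nat) (p tau : nat -> R),
      p 0%N = a -> p n = b ->
      (forall k, (k < n)%N ->
         [/\ p k < p k.+1, p k.+1 - p k < delta & p k <= tau k <= p k.+1]) ->
      `| \sum_(k < n) g (tau k) * (h (p k.+1) - h (p k)) - v | < eps%:C.

Definition is_RSmx (d : nat) (g : R -> R[i]) (H : R -> 'M[R[i]]_d)
    (M : 'M[R[i]]_d) : Prop :=
  forall i j, is_RS g (fun w => H w i j) (- pi) pi (M i j).

Definition cmx (m n : nat) (A : 'M[R]_(m, n)) : 'M[R[i]]_(m, n) :=
  map_mx (fun x => x%:C) A.

Definition conjT (m n : nat) (A : 'M[R[i]]_(m, n)) : 'M[R[i]]_(n, m) :=
  (map_mx conjc A)^T.

Section Design.
Variables (d : nat) (x : nat -> 'I_d -> R). (* x t i = x_{it}, t >= 1 *)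

Definition s2 (i : 'I_d) (T : nat) : R := \sum_(1 <= t < T.+1) x t i ^+ 2.
Definition sT (i : 'I_d) (T : nat) : R := Num.sqrt (s2 i T).

Definition XT (T : nat) : 'M[R]_(T, d) := \matrix_(t < T, i < d) x t.+1 i.
Definition ST (T : nat) : 'M[R]_d := diag_mx (\row_(i < d) sT i T).
Definition ZT (T : nat) : 'M[R]_(T, d) := XT T *m invmx (ST T).

Definition cross (i j : 'I_d) (k T : nat) : R :=
  (sT i T * sT j T)^-1 * \sum_(1 <= t < (T - k).+1) x t i * x (t + k)%N j.

Definition rho (i j : 'I_d) (k : nat) : R := limn (cross i j k).

Definition Rmx (k : int) : 'M[R]_d :=
  \matrix_(i < d, j < d)
    match k with Posz n => rho i j n | Negz n => rho j i n.+1 end.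
End Design.

Definition Lambda (eta : nat -> R) (T : nat) : 'M[R]_T :=
  \matrix_(s < T, t < T) eta (if (s <= t)%N then (t - s)%N else (s - t)%N).

Definition mutually_independent (dd : measure_display) (Om : measurableType dd)
    (P : probability Om R) (I : eqType) (X : I -> Om -> R) : Prop :=
  forall (J : seq I) (B : I -> set R), uniq J ->
    (forall j, measurable (B j)) ->
    P (\bigcap_(j in [set` J]) (X j @^-1` B j)) =
    (\prod_(j <- J) P (X j @^-1` B j))%E.

(* W (a random vector in R^n on (Om', Q)) has the law N(0, C), defined through
   its characteristic function E exp(iota t'W) = exp(-t'Ct/2) *)
Definition has_normal_law (n : nat) (dd : measure_display)
    (Om : measurableType dd) (Q : probability Om R) (W : Om -> 'cV[R]_n)
    (C : 'M[R]_n) : Prop :=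
  (forall i, measurable_fun setT (fun w => W w i 0)) /\
  forall t : 'cV[R]_n,
    ('E_Q[fun w => cos ((t^T *m W w) ord0 ord0)] = (expR (- ((t^T *m C *m t) ord0 ord0) / 2))%:E)%E
    /\ ('E_Q[fun w => sin ((t^T *m W w) ord0 ord0)] = 0)%E.

Definition cvg_law_normal (n : nat) (dd : measure_display)
    (Om : measurableType dd) (P : probability Om R)
    (Wn : nat -> Om -> 'cV[R]_n) (C : 'M[R]_n) : Prop :=
  exists (dd' : measure_display) (Om' : measurableType dd')
         (Q : probability Om' R) (W : Om' -> 'cV[R]_n),
    has_normal_law Q W C /\
    forall g : 'cV[R]_n -> R, continuous g -> (exists M : R, forall v, `|g v| <= M) ->
      (fun N => ('E_P[g \o Wn N])%E) @ \oo --> ('E_Q[g \o W])%E.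

End Defs.

(* Main.v *)
(* For a sequence z_T of vectors with bounded norm and vanishing sup-norm the boundary effects of
   T x T Toeplitz matrices are negligible, so on such vectors products and inverses of Toeplitz
   matrices act like Toeplitz matrices whose symbols are the products and inverses of the symbols;
   (G1) and (G2) say that the columns of Z_T are of this kind, and (G3) evaluates the quadratic
   forms Z_T' K_T Z_T as the integral of the symbol of K_T against dH.  Hence the normalized Gram
   matrices converge, and t' S_T (btilde_T - beta) is a linear form b_T' u_T with small weights b_T
   and convergent variance.  Written as a sum of independent E_j, it satisfies the Lindeberg
   condition by (M2), so its characteristic function converges to that of N(0, t' C_v t).
   Convergence of characteristic functions is turned into convergence in law by approximating
   bounded continuous functions on large boxes by uniformly bounded trigonometric polynomials. *)
Require Import Defs.
From HB Require Import structures.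
From mathcomp Require Import all_boot all_order all_algebra.
From mathcomp Require Import all_classical all_reals all_analysis.
From mathcomp Require Import complex measurable_realfun.
From mathcomp Require Import ring lra zify.
Import Order.TTheory GRing.Theory Num.Theory numFieldNormedType.Exports.
Local Open Scope ring_scope.
Local Open Scope complex_scope.
Local Open Scope classical_set_scope.
Set Implicit Arguments.
Unset Strict Implicit.
Unset Printing Implicit Defensive.

(** * Euclidean norm and inner product of column vectors *)

Section EuclideanNorm.
Variable R : realType.
Implicit Types T : nat.

(** Products and inverses of finite Toeplitz matrices are in general not Toeplitz, and the defect
    does not vanish in operator norm: for products of cosines it fills a few boundary rows with
    entries of fixed size. Closeness is therefore measured only on vectors satisfying [small], and
    the matrices with a symbol form a class closed under sums, products with a bounded factor, and
    operator-norm limits; the inverse enters as such a limit. All symbols are real and even, so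
    shifts occur in symmetric pairs and real cosine matrices suffice. Bounds on finite matrices come
    from a discrete Fourier transform with more frequencies than rows, which avoids integrals over
    the frequency. The process $U$ is an infinite sum. The Lindeberg estimate is proved for each
    truncation, its error bound depends on the truncation only through the variance, and the
    truncation is removed while [T] is fixed. The limit law has to be exhibited as a random vector,
    built here from one-dimensional normal laws and a Cholesky factor. Tightness comes from second
    moments. *)

Definition nsq T (v : 'cV[R]_T) : R := \sum_i v i 0 ^+ 2.
Definition nrm T (v : 'cV[R]_T) : R := Num.sqrt (nsq v).
Definition dot T (u v : 'cV[R]_T) : R := \sum_i u i 0 * v i 0.

Lemma nsq_ge0 T (v : 'cV[R]_T) : 0 <= nsq v.
Proof. by apply: sumr_ge0 => i _; rewrite sqr_ge0. Qed.

Lemma nrm_ge0 T (v : 'cV[R]_T) : 0 <= nrm v.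
Proof. exact: sqrtr_ge0. Qed.

Lemma nrm_sqr T (v : 'cV[R]_T) : nrm v ^+ 2 = nsq v.
Proof. by rewrite sqr_sqrtr // nsq_ge0. Qed.

Lemma dotvv T (v : 'cV[R]_T) : dot v v = nsq v.
Proof. by apply: eq_bigr => i _; rewrite expr2. Qed.

Lemma dotC T (u v : 'cV[R]_T) : dot u v = dot v u.
Proof. by apply: eq_bigr => i _; rewrite mulrC. Qed.

Lemma dotDl T (u v w : 'cV[R]_T) : dot (u + v) w = dot u w + dot v w.
Proof. by rewrite -big_split; apply: eq_bigr => i _; rewrite mxE mulrDl. Qed.

Lemma dotDr T (u v w : 'cV[R]_T) : dot w (u + v) = dot w u + dot w v.
Proof. by rewrite dotC dotDl !(dotC w). Qed.

Lemma dotZl T a (u v : 'cV[R]_T) : dot (a *: u) v = a * dot u v.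
Proof. by rewrite mulr_sumr; apply: eq_bigr => i _; rewrite mxE mulrA. Qed.

Lemma dotZr T a (u v : 'cV[R]_T) : dot v (a *: u) = a * dot v u.
Proof. by rewrite dotC dotZl dotC. Qed.

Lemma dotNl T (u v : 'cV[R]_T) : dot (- u) v = - dot u v.
Proof. by rewrite -scaleN1r dotZl mulN1r. Qed.

Lemma dotNr T (u v : 'cV[R]_T) : dot v (- u) = - dot v u.
Proof. by rewrite dotC dotNl dotC. Qed.

Lemma dotE T (u v : 'cV[R]_T) : (u^T *m v) 0 0 = dot u v.
Proof. by rewrite mxE; apply: eq_bigr => i _; rewrite mxE. Qed.

Lemma dot_mulmx m T (A : 'M[R]_(T, m)) u (v : 'cV[R]_T) :
  dot (A *m u) v = dot u (A^T *m v).
Proof. by rewrite -!dotE trmx_mul mulmxA. Qed.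

Lemma dot_le T (u v : 'cV[R]_T) : `|dot u v| <= nrm u * nrm v.
Proof.
have [v0|v0] := eqVneq (nsq v) 0.
  suff -> : dot u v = 0 by rewrite normr0 mulr_ge0 ?nrm_ge0.
  apply: big1 => i _.
  move/eqP: v0; rewrite psumr_eq0 => [/allP/(_ i (mem_index_enum _)) /=|j _].
    by rewrite sqrf_eq0 => /eqP ->; rewrite mulr0.
  exact: sqr_ge0.
have vp : 0 < nsq v by rewrite lt_def v0 nsq_ge0.
(* This is [nsq v] times the component of [u] orthogonal to [v]; its squared norm is [nsq v] times
   the Cauchy-Schwarz gap. *)
have := nsq_ge0 (nsq v *: u - dot u v *: v).
rewrite -dotvv !(dotDl, dotDr, dotNl, dotNr, dotZl, dotZr) !dotvv (dotC v u) => h.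
have {}h : 0 <= nsq v * (nsq u * nsq v - dot u v ^+ 2).
  by move: h; congr (_ <= _); ring.
rewrite pmulr_rge0// subr_ge0 in h.
by rewrite -sqrtr_sqr /nrm -sqrtrM ?nsq_ge0// ler_wsqrtr.
Qed.

Lemma nrmD T (u v : 'cV[R]_T) : nrm (u + v) <= nrm u + nrm v.
Proof.
rewrite -(ler_pXn2r (n := 2)) ?nnegrE ?addr_ge0 ?nrm_ge0//.
rewrite sqrrD !nrm_sqr -!dotvv dotDl !dotDr (dotC v u).
have := dot_le u v; have := ler_norm (dot u v); lra.
Qed.

Lemma nrmZ T a (u : 'cV[R]_T) : nrm (a *: u) = `|a| * nrm u.
Proof.
rewrite /nrm -dotvv dotZl dotZr dotvv mulrA -expr2 sqrtrM ?sqr_ge0//.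
by rewrite sqrtr_sqr.
Qed.

Lemma nrm0 T : nrm (0 : 'cV[R]_T) = 0.
Proof. by rewrite -(scale0r 0) nrmZ normr0 mul0r. Qed.

Lemma nrm_entry T (v : 'cV[R]_T) i : `|v i 0| <= nrm v.
Proof.
rewrite -sqrtr_sqr ler_wsqrtr// /nsq (bigD1 i)//= lerDl.
by apply: sumr_ge0 => j _; exact: sqr_ge0.
Qed.

Lemma nrm_sum T (I : Type) (r : seq I) (P : pred I) (F : I -> 'cV[R]_T) :
  nrm (\sum_(i <- r | P i) F i) <= \sum_(i <- r | P i) nrm (F i).
Proof.
elim/big_rec2: _ => [|i a b _ h]; first by rewrite nrm0.
by rewrite (le_trans (nrmD _ _))// lerD2l.
Qed.

(* Polarization: on a symmetric matrix a bound on the quadratic form bounds the operator norm. *)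
Lemma opbd_sym T (K : 'M[R]_T) q : K^T = K -> 0 <= q ->
  (forall v, `|dot v (K *m v)| <= q * nsq v) ->
  forall v, nrm (K *m v) <= q * nrm v.
Proof.
move=> Ks q0 Kq v.
have bil u w : dot u (K *m w) <= q * (nsq u + nsq w) / 2.
  have h1 := le_trans (ler_norm _) (Kq (u + w)).
  have h2 := lerNnormlW (Kq (u - w)).
  have sw : dot w (K *m u) = dot u (K *m w) by rewrite dotC dot_mulmx Ks.
  move: h1 h2; rewrite -!dotvv !mulmxDr !mulmxN !(dotDl, dotDr, dotNl, dotNr) sw (dotC w u).
  lra.
have [q1|q1] := eqVneq q 0.
  have := bil (K *m v) v; rewrite q1 !mul0r dotvv => h.
  by rewrite /nrm ler0_sqrtr.
have qp : 0 < q by rewrite lt_def q1.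
rewrite -(ler_pXn2r (n := 2)) ?nnegrE ?mulr_ge0 ?nrm_ge0// exprMn !nrm_sqr.
(* The left side becomes [q * nsq (K *m v)], and half of it on the right is absorbed. *)
have := bil (K *m v) (q *: v).
rewrite -scalemxAr dotZr dotvv -(dotvv (q *: v)) dotZl dotZr dotvv => h.
have : q * nsq (K *m v) <= q * (q ^+ 2 * nsq v) by nra.
by rewrite ler_pM2l.
Qed.
End EuclideanNorm.

(** * Cosine matrices, small vectors and negligible boundary terms *)

Section CosineMatrices.
Variable R : realType.

Definition bmx T (e : 'I_T -> 'I_T -> bool) : 'M[R]_T := \matrix_(s, t) (e s t)%:R.

(** The alternative is settled before [f] is given, so one and the same index serves for the entries
    of a vector and for their squares in [bmx_nrm]. *)
Lemma sum_uniq_ind T (e : 'I_T -> bool) : (forall s s', e s -> e s' -> s = s') ->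
  (exists2 s, e s & forall f : 'I_T -> R, \sum_t (e t)%:R * f t = f s) \/
  (forall s, ~~ e s) /\ forall f : 'I_T -> R, \sum_t (e t)%:R * f t = 0.
Proof.
move=> eu; case: (pickP e) => [s es|e0]; [left; exists s => // f|right; split => [s|f]].
- rewrite (bigD1 s)//= es mul1r big1 ?addr0// => t ts.
  case et: (e t); last by rewrite mul0r.
  by rewrite (eu t s) ?eqxx in ts.
- by rewrite e0.
- by apply: big1 => t _; rewrite e0 mul0r.
Qed.

Lemma bmx_entry T (e : 'I_T -> 'I_T -> bool) (v : 'cV[R]_T) m s :
  (forall s t t', e s t -> e s t' -> t = t') -> 0 <= m -> (forall i, `|v i 0| <= m) ->
  `|(bmx e *m v) s 0| <= m.
Proof.
move=> eu m0 vm; have -> : (bmx e *m v) s 0 = \sum_t (e s t)%:R * v t 0.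
  by rewrite mxE; apply: eq_bigr => t _; rewrite mxE.
by case: (sum_uniq_ind (eu s)) => [[t _ ->]|[_ ->]]; rewrite ?normr0.
Qed.

(** The relation is a partial injection: each row copies at most one entry of [v], and no entry is
    copied twice. *)
Lemma bmx_nrm T (e : 'I_T -> 'I_T -> bool) (v : 'cV[R]_T) :
  (forall s t t', e s t -> e s t' -> t = t') ->
  (forall s s' t, e s t -> e s' t -> s = s') ->
  nrm (bmx e *m v) <= nrm v.
Proof.
move=> er ec; apply: ler_wsqrtr.
have -> : nsq (bmx e *m v) = \sum_t \sum_s (e s t)%:R * v t 0 ^+ 2.
  rewrite exchange_big; apply: eq_bigr => s _.
  have -> : (bmx e *m v) s 0 = \sum_t (e s t)%:R * v t 0.
    by rewrite mxE; apply: eq_bigr => t _; rewrite mxE.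
  by case: (sum_uniq_ind (er s)) => [[t _ h]|[_ h]]; rewrite !h ?expr0n//.
apply: ler_sum => t _.
have ec' : forall s s' : 'I_T, e s t -> e s' t -> s = s' by move=> s s'; exact: ec.
by case: (sum_uniq_ind ec') => [[s _ ->]|[_ ->]]; rewrite ?sqr_ge0.
Qed.

(** The Toeplitz matrix with symbol $\cos(k\omega)=(e^{\iota k\omega}+e^{-\iota k\omega})/2$: half
    the sum of the [k]-step shift and its transpose, which is the identity for [k = 0]. *)
Definition Cmx (k T : nat) : 'M[R]_T :=
  \matrix_(s, t) (((s + k == t)%N%:R + (t + k == s)%N%:R) / 2).

Lemma CmxE k T : Cmx k T = 2^-1 *: (bmx (fun s t => s + k == t)%N + bmx (fun s t => t + k == s)%N).
Proof. by apply/matrixP => s t; rewrite !mxE mulrC. Qed.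

Lemma Cmx_sym k T : (Cmx k T)^T = Cmx k T.
Proof. by apply/matrixP => s t; rewrite !mxE addrC. Qed.

Lemma Cmx0 T : Cmx 0 T = 1%:M.
Proof.
by apply/matrixP => s t; rewrite !mxE !addn0 (eq_sym (t : nat)) -val_eqE/=; case: eqP => _ /=; lra.
Qed.

Lemma Cmx_nrm k T (v : 'cV[R]_T) : nrm (Cmx k T *m v) <= nrm v.
Proof.
rewrite CmxE -scalemxAl nrmZ mulmxDl ger0_norm ?invr_ge0//.
have h1 : nrm (bmx (fun s t : 'I_T => s + k == t)%N *m v) <= nrm v.
  by apply: bmx_nrm => s t t' /eqP h /eqP h'; apply/val_inj => /=; lia.
have h2 : nrm (bmx (fun s t : 'I_T => t + k == s)%N *m v) <= nrm v.
  by apply: bmx_nrm => s t t' /eqP h /eqP h'; apply/val_inj => /=; lia.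
have := nrmD (bmx (fun s t : 'I_T => s + k == t)%N *m v) (bmx (fun s t : 'I_T => t + k == s)%N *m v).
lra.
Qed.

Lemma Cmx_sup k T (v : 'cV[R]_T) m : 0 <= m -> (forall i, `|v i 0| <= m) ->
  forall i, `|(Cmx k T *m v) i 0| <= m.
Proof.
move=> m0 vm i; rewrite CmxE -scalemxAl mulmxDl mxE normrM ger0_norm ?invr_ge0// mxE.
have h1 : `|(bmx (fun s t : 'I_T => s + k == t)%N *m v) i 0| <= m.
  by apply: bmx_entry => // s t t' /eqP h /eqP h'; apply/val_inj => /=; lia.
have h2 : `|(bmx (fun s t : 'I_T => t + k == s)%N *m v) i 0| <= m.
  by apply: bmx_entry => // s t t' /eqP h /eqP h'; apply/val_inj => /=; lia.
have := ler_normD ((bmx (fun s t : 'I_T => s + k == t)%N *m v) i 0) ((bmx (fun s t : 'I_T => t + k == s)%N *m v) i 0).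
lra.
Qed.

Lemma sum_shift T k (s : 'I_T) (f : nat -> R) :
  \sum_(r < T) (s + k == r)%N%:R * f r = (s + k < T)%N%:R * f (s + k)%N.
Proof.
case: ltnP => skT; last first.
  rewrite mul0r big1// => r _; case: eqP => [?|_]; last by rewrite mul0r.
  have := ltn_ord r; lia.
rewrite mul1r (bigD1 (Ordinal skT))//= eqxx mul1r big1 ?addr0// => r.
by rewrite -val_eqE/= eq_sym => /negbTE ->; rewrite mul0r.
Qed.

Lemma sum_unshift T k (s : 'I_T) (f : nat -> R) :
  \sum_(r < T) (r + k == s)%N%:R * f r = (k <= s)%N%:R * f (s - k)%N.
Proof.
case: leqP => skT; last first.
  rewrite mul0r big1// => r _; case: eqP => [?|_]; last by rewrite mul0r.
  lia.
have h : (s - k < T)%N by have := ltn_ord s; lia.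
rewrite mul1r (bigD1 (Ordinal h))//= subnK// eqxx mul1r big1 ?addr0// => r.
rewrite -val_eqE/= => /eqP rs; case: eqP => [?|_]; last by rewrite mul0r.
lia.
Qed.

(* [cos a cos b = (cos (a+b) + cos (a-b)) / 2] fails for the matrices [Cmx] only on boundary rows. *)
Lemma Cmx_mul k l T : (l <= k)%N ->
  Cmx k T *m Cmx l T - 2^-1 *: (Cmx (k + l) T + Cmx (k - l) T) =
  - 4^-1 *: (bmx (fun s t => (T <= s + k) && (s + (k - l) == t))%N
             + bmx (fun s t => (s < k) && (t + (k - l) == s))%N).
Proof.
move=> lk; apply/matrixP => s t; rewrite !mxE.
have -> : \sum_j Cmx k T s j * Cmx l T j t = 4^-1 *
   (\sum_(r < T) (s + k == r)%N%:R * ((r + l == t)%N%:R + (t + l == r)%N%:R) +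
    \sum_(r < T) (r + k == s)%N%:R * ((r + l == t)%N%:R + (t + l == r)%N%:R)).
  rewrite -big_split mulr_sumr; apply: eq_bigr => r _ /=; rewrite !mxE; lra.
rewrite (sum_shift k s (fun r => (r + l == t)%N%:R + (t + l == r)%N%:R)).
rewrite (sum_unshift k s (fun r => (r + l == t)%N%:R + (t + l == r)%N%:R)).
have sT := ltn_ord s; have tT := ltn_ord t.
rewrite (leqNgt T) (ltnNge s k).
have -> : (s + k + l == t)%N = (s + (k + l) == t)%N by rewrite addnA.
have -> : (t + l == s + k)%N = (s + (k - l) == t)%N by apply/eqP/eqP; lia.
(* If [s + k] or [s - k] leaves the range, only the term with step [k - l] is lost; the one with
   step [k + l] leaves the range too and is zero on both sides. *)
case: (ltnP (s + k) T) => h1; case: (leqP k s) => h2 /=.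
- have -> : (s - k + l == t)%N = (t + (k - l) == s)%N by apply/eqP/eqP; lia.
  have -> : (t + l == s - k)%N = (t + (k + l) == s)%N by apply/eqP/eqP; lia.
  by rewrite ?mulr0n; lra.
- have -> : (t + (k + l) == s)%N = false by apply/eqP; lia.
  by rewrite ?mulr0n; lra.
- have -> : (s - k + l == t)%N = (t + (k - l) == s)%N by apply/eqP/eqP; lia.
  have -> : (t + l == s - k)%N = (t + (k + l) == s)%N by apply/eqP/eqP; lia.
  have -> : (s + (k + l) == t)%N = false by apply/eqP; lia.
  by rewrite ?mulr0n; lra.
- have -> : (t + (k + l) == s)%N = false by apply/eqP; lia.
  have -> : (s + (k + l) == t)%N = false by apply/eqP; lia.
  by rewrite ?mulr0n; lra.
Qed.

Lemma sum_ord_lt T k : \sum_(s < T) (s < k)%N%:R <= k%:R :> R.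
Proof.
rewrite -natr_sum ler_nat -(big_mkord xpredT (fun s => (s < k)%N : nat)).
suff -> : (\sum_(0 <= i < T) (i < k))%N = minn T k by exact: geq_minr.
elim: T => [|T IH]; first by rewrite big_nil min0n.
by rewrite big_nat_recr//= IH /minn; case: (ltnP T k) => h; case: (ltnP T.+1 k) => h' /=; lia.
Qed.

Lemma sum_ord_ge T k : \sum_(s < T) (T <= s + k)%N%:R <= k%:R :> R.
Proof.
rewrite (reindex_inj rev_ord_inj)/= (le_trans _ (sum_ord_lt T k))//.
by apply: ler_sum => s _; rewrite ler_nat; have := ltn_ord s; lia.
Qed.

(** Each end contributes at most [k] indices; when the ends overlap an index is counted twice, which
    only enlarges the bound. *)
Lemma nsq_boundary T k (v : 'cV[R]_T) m : (forall i, `|v i 0| <= m) ->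
  (forall i : 'I_T, ~~ ((i < k) || (T <= i + k))%N -> v i 0 = 0) ->
  nsq v <= 2 * k%:R * m ^+ 2.
Proof.
move=> vm vP.
apply: (@le_trans _ _ (\sum_(i < T) ((i < k)%N%:R + (T <= i + k)%N%:R) * m ^+ 2)).
  apply: ler_sum => i _; case: (boolP ((i < k) || (T <= i + k))%N) => [/orP h|/vP ->].
    have m0 : 0 <= m by exact: le_trans (vm i).
    have h2 : v i 0 ^+ 2 <= m ^+ 2 by rewrite -real_normK ?num_real// ler_pXn2r ?nnegrE.
    rewrite (le_trans h2)// ler_peMl ?sqr_ge0//.
    by case: h => ->; rewrite ?lerDl ?lerDr.
  by rewrite expr0n mulr_ge0 ?sqr_ge0// addr_ge0.
rewrite -mulr_suml big_split/= ler_wpM2r ?sqr_ge0//.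
by have := sum_ord_lt T k; have := sum_ord_ge T k; lra.
Qed.

(* Vectors whose boundary effects vanish: bounded in l2, uniformly small entries. *)
Definition small (z : forall T, 'cV[R]_T) : Prop :=
  (exists B : R, \forall T \near \oo, nrm (z T) <= B) /\
  (forall eps : R, 0 < eps -> \forall T \near \oo, forall i, `|z T i 0| <= eps).

Lemma small_ext (y z : forall T, 'cV[R]_T) : (forall T, z T = y T) -> small y -> small z.
Proof. by move=> h; have -> : z = y by apply: functional_extensionality_dep => T; rewrite h. Qed.

Lemma small_bound z : small z -> exists2 B, 0 < B & \forall T \near \oo, nrm (z T) <= B.
Proof.
case=> -[B zB] _; exists (`|B| + 1); first by rewrite ltr_wpDl.
by apply: filterS zB => T /le_trans; apply; rewrite (le_trans (ler_norm _))// lerDl.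
Qed.

Lemma small_add z y : small z -> small y -> small (fun T => z T + y T).
Proof.
move=> [[B zB] zs] [[B' yB] ys]; split.
  exists (B + B'); apply: filterS2 zB yB => T h1 h2.
  by rewrite (le_trans (nrmD _ _))// lerD.
move=> e e0; have e2 : 0 < e / 2 by rewrite divr_gt0.
apply: filterS2 (zs _ e2) (ys _ e2) => T h1 h2 i.
by rewrite mxE (le_trans (ler_normD _ _))// (splitr e) lerD.
Qed.

Lemma small_scale a z : small z -> small (fun T => a *: z T).
Proof.
move=> [[B zB] zs]; split.
  exists (`|a| * B); apply: filterS zB => T h1.
  by rewrite nrmZ ler_wpM2l.
move=> e e0; have e2 : 0 < e / (`|a| + 1) by rewrite divr_gt0// ltr_wpDl.
apply: filterS (zs _ e2) => T h1 i.
rewrite mxE normrM.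
have := h1 i; rewrite ler_pdivlMr ?ltr_wpDl// => h.
by rewrite (le_trans _ h)// mulrC ler_wpM2l// lerDl.
Qed.

Lemma small_Cmx k z : small z -> small (fun T => Cmx k T *m z T).
Proof.
move=> [[B zB] zs]; split.
  by exists B; apply: filterS zB => T; apply: le_trans; exact: Cmx_nrm.
by move=> e e0; apply: filterS (zs _ e0) => T h i; apply: Cmx_sup => //; exact: ltW.
Qed.

(** Even trigonometric polynomials paired with their Toeplitz matrices, so that one induction treats
    both. Products are not a constructor: they return to the class only up to a negligible boundary
    term, see [cosp_mul]. *)
Inductive cosp : (forall T, 'M[R]_T) -> (R -> R) -> Prop :=
| cosp_base k : cosp (Cmx k) (fun w => cos (k%:R * w))
| cosp_add p f q g : cosp p f -> cosp q g ->
    cosp (fun T => p T + q T) (fun w => f w + g w)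
| cosp_scale a p f : cosp p f -> cosp (fun T => a *: p T) (fun w => a * f w).

Lemma cosp_nrm p f : cosp p f -> exists2 B, 0 < B &
  (forall T (v : 'cV[R]_T), nrm (p T *m v) <= B * nrm v) /\ (forall w, `|f w| <= B).
Proof.
elim=> {p f} [k|p f q g _ [B B0 [pB fB]] _ [B' B'0 [qB gB]]|a p f _ [B B0 [pB fB]]].
- exists 1 => //; split => [T v|w]; first by rewrite mul1r Cmx_nrm.
  by rewrite ler_norml cos_geN1 cos_le1.
- exists (B + B'); first exact: addr_gt0.
  split => [T v|w].
    by rewrite mulmxDl (le_trans (nrmD _ _))// mulrDl lerD.
  by rewrite (le_trans (ler_normD _ _))// lerD.
- have aB : `|a| * B < (`|a| + 1) * B by rewrite ltr_pM2r// ltrDl.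
  exists ((`|a| + 1) * B); first by rewrite mulr_gt0// ltr_wpDl.
  split => [T v|w].
    rewrite -scalemxAl nrmZ (le_trans (ler_wpM2l _ (pB T v)))// mulrA.
    by rewrite ler_wpM2r ?nrm_ge0// ltW.
  by rewrite normrM (le_trans _ (ltW aB))// ler_wpM2l.
Qed.

Lemma cosp_small p f z : cosp p f -> small z -> small (fun T => p T *m z T).
Proof.
move=> pf zs; elim: pf => {p f} [k|p f q g _ ps _ qs|a p f _ ps].
- exact: small_Cmx.
- by apply: (small_ext (fun T => mulmxDl _ _ _)); exact: small_add.
- by apply: (small_ext (fun T => esym (scalemxAl _ _ _))); exact: small_scale.
Qed.

Definition negligible (z : forall T, 'cV[R]_T) : Prop :=
  forall eps : R, 0 < eps -> \forall T \near \oo, nrm (z T) <= eps.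

Lemma negligible_ext (y z : forall T, 'cV[R]_T) :
  (forall T, z T = y T) -> negligible y -> negligible z.
Proof. by move=> h; have -> : z = y by apply: functional_extensionality_dep => T; rewrite h. Qed.

Lemma negligible_add z y : negligible z -> negligible y -> negligible (fun T => z T + y T).
Proof.
move=> zs ys e e0; have e2 : 0 < e / 2 by rewrite divr_gt0.
apply: filterS2 (zs _ e2) (ys _ e2) => T h1 h2.
by rewrite (le_trans (nrmD _ _))// (splitr e) lerD.
Qed.

Lemma negligible_scale a z : negligible z -> negligible (fun T => a *: z T).
Proof.
move=> zs e e0; have e2 : 0 < e / (`|a| + 1) by rewrite divr_gt0// ltr_wpDl.
apply: filterS (zs _ e2) => T.
rewrite nrmZ ler_pdivlMr ?ltr_wpDl// => h.
by rewrite (le_trans _ h)// mulrC ler_wpM2l ?nrm_ge0// lerDl.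
Qed.

(** At most [2k] entries of the product can be nonzero, and each is an entry of [z T]; these tend to
    zero uniformly. *)
Lemma bmx_negl k (e : forall T, 'I_T -> 'I_T -> bool) z :
  (forall T s t t', e T s t -> e T s t' -> t = t') ->
  (forall T s t, e T s t -> (s < k) || (T <= s + k))%N ->
  small z -> negligible (fun T => bmx (e T) *m z T).
Proof.
move=> eu eb [_ zs] eps e0.
(* With this size [2k] entries have norm at most [eps]; the [+ 1] keeps the divisor positive for
   [k = 0]. *)
pose m := eps / Num.sqrt (2 * k%:R + 1).
have s0 : 0 < Num.sqrt (2 * k%:R + 1) :> R by rewrite sqrtr_gt0 ltr_wpDl// mulr_ge0.
have m0 : 0 < m by rewrite divr_gt0.
apply: filterS (zs _ m0) => T zm.
rewrite -(ler_pXn2r (n := 2)) ?nnegrE ?nrm_ge0 ?(ltW e0)// nrm_sqr.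
have := @nsq_boundary T k (bmx (e T) *m z T) m.
have -> : 2 * k%:R * m ^+ 2 = (2 * k%:R) / (2 * k%:R + 1) * eps ^+ 2.
  rewrite /m exprMn exprVn sqr_sqrtr; first by rewrite mulrA mulrAC.
  by rewrite addr_ge0// mulr_ge0.
move=> h; apply: le_trans (h _ _) _.
- by move=> i; apply: bmx_entry zm; [exact: eu|exact: ltW].
- move=> i /negP ib; rewrite mxE big1// => t _; rewrite !mxE.
  by case: (boolP (e T i t)) => [/eb //|_]; rewrite mul0r.
- rewrite ler_piMl ?sqr_ge0// ler_pdivrMr ?mul1r ?lerDl//.
Qed.

Lemma Cmx_mul_negl k l z : (l <= k)%N -> small z ->
  negligible (fun T => (Cmx k T *m Cmx l T - 2^-1 *: (Cmx (k + l) T + Cmx (k - l) T)) *m z T) /\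
  negligible (fun T => (Cmx l T *m Cmx k T - 2^-1 *: (Cmx (k + l) T + Cmx (k - l) T)) *m z T).
Proof.
move=> lk zs; split.
  apply: (@negligible_ext (fun T => - 4^-1 *:
    (bmx (fun s t : 'I_T => (T <= s + k) && (s + (k - l) == t))%N *m z T
     + bmx (fun s t : 'I_T => (s < k) && (t + (k - l) == s))%N *m z T))).
    by move=> T; rewrite Cmx_mul// -scalemxAl mulmxDl.
  apply: negligible_scale; apply: negligible_add.
    apply: (@bmx_negl k (fun T (s t : 'I_T) => (T <= s + k) && (s + (k - l) == t))%N) => //.
      by move=> T s t t' /andP[_ /eqP h] /andP[_ /eqP h']; apply/val_inj => /=; lia.
    by move=> T s t /andP[-> _]; rewrite orbT.
  apply: (@bmx_negl k (fun T (s t : 'I_T) => (s < k) && (t + (k - l) == s))%N) => //.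
    by move=> T s t t' /andP[_ /eqP h] /andP[_ /eqP h']; apply/val_inj => /=; lia.
  by move=> T s t /andP[-> _].
(* The reversed product is the transpose of the other one. Its boundary conditions bear on the
   column [t]; the equation between [s] and [t] carries them back to the row [s]. *)
have tr T : Cmx l T *m Cmx k T - 2^-1 *: (Cmx (k + l) T + Cmx (k - l) T) =
    - 4^-1 *: (bmx (fun s t => (T <= t + k) && (t + (k - l) == s))%N
             + bmx (fun s t => (t < k) && (s + (k - l) == t))%N).
  transitivity ((Cmx k T *m Cmx l T - 2^-1 *: (Cmx (k + l) T + Cmx (k - l) T))^T).
    by rewrite [RHS]linearB/= [in RHS]linearZ/= [in RHS]linearD/= trmx_mul !Cmx_sym.
  by rewrite Cmx_mul//; apply/matrixP => s t; rewrite !mxE.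
apply: (@negligible_ext (fun T => - 4^-1 *:
  (bmx (fun s t : 'I_T => (T <= t + k) && (t + (k - l) == s))%N *m z T
   + bmx (fun s t : 'I_T => (t < k) && (s + (k - l) == t))%N *m z T))).
  by move=> T; rewrite tr -scalemxAl mulmxDl.
apply: negligible_scale; apply: negligible_add.
  apply: (@bmx_negl k (fun T (s t : 'I_T) => (T <= t + k) && (t + (k - l) == s))%N) => //.
    by move=> T s t t' /andP[_ /eqP h] /andP[_ /eqP h']; apply/val_inj => /=; lia.
  by move=> T s t /andP[h /eqP h']; apply/orP; right; lia.
apply: (@bmx_negl k (fun T (s t : 'I_T) => (t < k) && (s + (k - l) == t))%N) => //.
  by move=> T s t t' /andP[_ /eqP h] /andP[_ /eqP h']; apply/val_inj => /=; lia.
by move=> T s t /andP[h /eqP h']; apply/orP; left; lia.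
Qed.

(** Bilinearity reduces the claim to two cosines, where the product formula fails on boundary rows
    only. *)
Lemma cosp_mul p f q g : cosp p f -> cosp q g -> exists r, cosp r (fun w => f w * g w) /\
  forall z, small z -> negligible (fun T => (p T *m q T - r T) *m z T).
Proof.
have base k l : exists r, cosp r (fun w => cos (k%:R * w) * cos (l%:R * w)) /\
    forall z, small z -> negligible (fun T => (Cmx k T *m Cmx l T - r T) *m z T).
  have cosf i j : (j <= i)%N ->
    cosp (fun T => 2^-1 *: (Cmx (i + j) T + Cmx (i - j) T))
         (fun w => cos (i%:R * w) * cos (j%:R * w)).
    move=> ji.
    rewrite (_ : (fun w => _) = (fun w => 2^-1 * (cos ((i + j)%:R * w) + cos ((i - j)%:R * w)))).
      by apply: cosp_scale; apply: cosp_add; exact: cosp_base.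
    apply/funext => w; rewrite natrD natrB// !mulrDl mulNr !cosD cosN sinN; lra.
  have [lk|/ltnW kl] := leqP l k.
    exists (fun T => 2^-1 *: (Cmx (k + l) T + Cmx (k - l) T)); split; first exact: cosf.
    by move=> z zs; exact: (Cmx_mul_negl lk zs).1.
  exists (fun T => 2^-1 *: (Cmx (l + k) T + Cmx (l - k) T)); split.
    by under eq_fun do rewrite mulrC; exact: cosf.
  by move=> z zs; exact: (Cmx_mul_negl kl zs).2.
move=> pf qg; elim: pf => {p f} [k|p f p' f' _ [r [rf rn]] _ [r' [rf' rn']]|a p f _ [r [rf rn]]].
- elim: qg => {q g} [l|q g q' g' _ [r [rf rn]] _ [r' [rf' rn']]|a q g _ [r [rf rn]]].
  + exact: base.
  + exists (fun T => r T + r' T); split.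
      by under eq_fun do rewrite mulrDr; exact: cosp_add.
    move=> z zs; apply: (negligible_ext _ (negligible_add (rn _ zs) (rn' _ zs))) => T.
    by rewrite -mulmxDl mulmxDr addrACA opprD.
  + exists (fun T => a *: r T); split.
      by under eq_fun do rewrite mulrCA; exact: cosp_scale.
    move=> z zs; apply: (negligible_ext _ (negligible_scale a (rn _ zs))) => T.
    by rewrite scalemxAl scalerBr scalemxAr.
- exists (fun T => r T + r' T); split.
    by under eq_fun do rewrite mulrDl; exact: cosp_add.
  move=> z zs; apply: (negligible_ext _ (negligible_add (rn _ zs) (rn' _ zs))) => T.
  by rewrite -[RHS]mulmxDl; congr (_ *m _); rewrite mulmxDl addrACA opprD.
- exists (fun T => a *: r T); split.
    by under eq_fun do rewrite -mulrA; exact: cosp_scale.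
  move=> z zs; apply: (negligible_ext _ (negligible_scale a (rn _ zs))) => T.
  by rewrite scalemxAl scalerBr scalemxAl.
Qed.

End CosineMatrices.

(** * Linearity and limits of Riemann-Stieltjes integrals *)

Section RiemannStieltjes.
Variable R : realType.
Implicit Types (g h : R -> R[i]) (a b : R).

Lemma normC_real (x : R) : `|x%:C| = `|x|%:C.
Proof. by rewrite normc_def /= expr0n addr0 sqrtr_sqr. Qed.

Lemma is_RS_add g1 g2 h a b v1 v2 : is_RS g1 h a b v1 -> is_RS g2 h a b v2 ->
  is_RS (fun w => g1 w + g2 w) h a b (v1 + v2).
Proof.
move=> H1 H2 e e0; have e2 : 0 < e / 2 by rewrite divr_gt0.
have [d1 d10 {}H1] := H1 _ e2; have [d2 d20 {}H2] := H2 _ e2.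
exists (Num.min d1 d2); first by rewrite lt_min d10.
move=> n p tau p0 pn H.
have -> : \sum_(k < n) (g1 (tau k) + g2 (tau k)) * (h (p k.+1) - h (p k)) - (v1 + v2) =
  (\sum_(k < n) g1 (tau k) * (h (p k.+1) - h (p k)) - v1) +
  (\sum_(k < n) g2 (tau k) * (h (p k.+1) - h (p k)) - v2).
  rewrite addrACA -opprD -big_split; congr (_ - _).
  by apply: eq_bigr => k _; rewrite mulrDl.
rewrite (splitr e) rmorphD/= (le_lt_trans (ler_normD _ _))// ltrD//.
  by apply: H1 => // k /H [? + ?]; rewrite lt_min => /andP[? ?].
by apply: H2 => // k /H [? + ?]; rewrite lt_min => /andP[? ?].
Qed.

Lemma is_RS_scale g h a b v (c : R[i]) : is_RS g h a b v ->
  is_RS (fun w => c * g w) h a b (c * v).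
Proof.
move=> H1 e e0.
have [M M0 cM] : exists2 M : R, 0 < M & `|c| < M%:C.
  rewrite normc_def; set s := Num.sqrt _; exists (s + 1); last by rewrite ltcR ltrDl.
  by rewrite ltr_wpDl// sqrtr_ge0.
have eM : 0 < e / M by rewrite divr_gt0.
have [d d0 {}H1] := H1 _ eM; exists d => // n p tau p0 pn H.
have := H1 n p tau p0 pn H.
under [X in _ -> `|X - _| < _]eq_bigr do rewrite -mulrA.
rewrite -mulr_sumr -mulrBr normrM => h1.
have M0' : 0 < M%:C by rewrite ltcR.
have -> : e%:C = M%:C * (e / M)%:C by rewrite -rmorphM/= mulrCA divff ?mulr1// gt_eqF.
by rewrite (le_lt_trans (ler_wpM2r _ (ltW cM)))// ltr_pM2l.
Qed.

Lemma partition_range a b n (p tau : nat -> R) : p 0%N = a -> p n = b ->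
  (forall k, (k < n)%N -> p k < p k.+1) ->
  (forall k, (k < n)%N -> p k <= tau k <= p k.+1) ->
  forall k, (k < n)%N -> a <= tau k <= b.
Proof.
move=> p0 pn pS pt k kn; have /andP[h1 h2] := pt _ kn.
have mono i j : (i <= j)%N -> (j <= n)%N -> p i <= p j.
  move=> ij; rewrite -(subnKC ij); elim: (j - i)%N => [|m IH]; first by rewrite addn0.
  by rewrite addnS => h; rewrite (le_trans (IH (ltnW h)))// ltW// pS.
apply/andP; split.
  by rewrite (le_trans _ h1)// -p0 mono// ltnW.
by rewrite (le_trans h2)// -pn mono.
Qed.

(** A uniform change of the integrand alters every Riemann sum by at most that amount times the
    total variation of [h], whatever the partition. *)
Lemma is_RS_lim g h a b v :
  (exists V : R, forall n (p : nat -> R), p 0%N = a -> p n = b ->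
    (forall k, (k < n)%N -> p k < p k.+1) -> \sum_(k < n) `|h (p k.+1) - h (p k)| <= V%:C) ->
  (forall eps : R, 0 < eps -> exists g' v', [/\ is_RS g' h a b v',
    forall w, a <= w <= b -> `|g w - g' w| <= eps%:C & `|v - v'| <= eps%:C]) ->
  is_RS g h a b v.
Proof.
move=> [V HV] Hg e e0.
pose V1 : R := `|V| + 1.
have V10 : 0 < V1 by rewrite ltr_wpDl.
(* Three errors: [e1 * V1] from replacing [g] by [g'], [e1] from the Riemann sum of [g'], and [e1]
   from replacing [v'] by [v]. *)
pose e1 := e / (V1 + 2).
have V20 : 0 < V1 + 2 by rewrite addr_gt0.
have e10 : 0 < e1 by rewrite divr_gt0.
have [g' [v' [Hg' gg' vv']]] := Hg _ e10.
have [d d0 Hd] := Hg' _ e10.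
exists d => // n p tau p0 pn H.
have pS k : (k < n)%N -> p k < p k.+1 by move=> /H[].
have tr k : (k < n)%N -> a <= tau k <= b.
  by apply: (@partition_range a b n p tau p0 pn pS) => i /H[].
have -> : \sum_(k < n) g (tau k) * (h (p k.+1) - h (p k)) - v =
   \sum_(k < n) (g (tau k) - g' (tau k)) * (h (p k.+1) - h (p k)) +
   (\sum_(k < n) g' (tau k) * (h (p k.+1) - h (p k)) - v') - (v - v').
  under [X in _ = X + _ - _]eq_bigr do rewrite mulrBl.
  by rewrite sumrB; ring.
have h1 : `|\sum_(k < n) (g (tau k) - g' (tau k)) * (h (p k.+1) - h (p k))| <= (e1 * V1)%:C.
  rewrite (le_trans (ler_norm_sum _ _ _))// rmorphM/=.
  apply: (@le_trans _ _ (e1%:C * \sum_(k < n) `|h (p k.+1) - h (p k)|)).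
    rewrite mulr_sumr ler_sum// => k _; rewrite normrM ler_wpM2r//.
    by apply: gg'; exact: tr.
  rewrite ler_wpM2l ?ler0c ?(ltW e10)// (le_trans (HV _ _ p0 pn pS))// lecR /V1.
  by rewrite (le_trans (ler_norm _))// lerDl.
have h2 := Hd n p tau p0 pn H.
have -> : e%:C = (e1 * V1)%:C + e1%:C + e1%:C.
  rewrite -!rmorphD/= -addrA -{2 3}(mulr1 e1) -!mulrDr /e1.
  by rewrite divfK// gt_eqF.
rewrite (le_lt_trans (ler_normB _ _))// ltr_leD// (le_lt_trans (ler_normD _ _))//.
by rewrite ler_ltD.
Qed.

(** The Cauchy criterion with a centre that may vary with [eps]; the centres will be limits
    belonging to approximating symbols or partial sums. *)
Lemma seq_near_cvg (u : nat -> R) :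
  (forall eps, 0 < eps -> exists a, \forall T \near \oo, `|u T - a| <= eps) -> cvgn u.
Proof.
move=> H; apply/cauchy_cvgP; apply: cauchy_exP => e e0.
have e2 : 0 < e / 2 by rewrite divr_gt0.
have [a ua] := H _ e2; exists a.
apply: filterS ua => T h; rewrite /ball/= distrC (le_lt_trans h)//.
by rewrite ltr_pdivrMr// ltr_pMr// ltr1n.
Qed.

Lemma limn_dist (u : nat -> R) v a eps : u @ \oo --> v ->
  (\forall T \near \oo, `|u T - a| <= eps) -> `|v - a| <= eps.
Proof.
move=> uv ua.
have h : (fun T => `|u T - a|) @ \oo --> `|v - a|.
  by apply: cvg_norm; apply: cvgB => //; exact: cvg_cst.
exact: cvgr_to_le h ua.
Qed.

End RiemannStieltjes.

(** * Calculus of asymptotic symbols *)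

Section SymbolCalculus.
Variable R : realType.
Implicit Types (K L : forall T, 'M[R]_T) (phi psi : R -> R).

Definition opbd K (C : R) : Prop := forall T (v : 'cV[R]_T), nrm (K T *m v) <= C * nrm v.

(* [K T] behaves on small vectors like a Toeplitz matrix with symbol [phi]. *)
Definition has_symbol K phi : Prop := forall eps : R, 0 < eps -> exists p f,
  [/\ cosp p f, forall w, - pi <= w <= pi -> `|f w - phi w| <= eps &
   forall z B, 0 < B -> small z -> (\forall T \near \oo, nrm (z T) <= B) ->
     \forall T \near \oo, nrm ((K T - p T) *m z T) <= eps * B].

Lemma cosp_has_symbol p f : cosp p f -> has_symbol p f.
Proof.
move=> pf e e0; exists p, f; split => // [w _|z B B0 _ _].
  by rewrite subrr normr0 ltW.
by apply: nearW => T; rewrite subrr mul0mx nrm0 mulr_ge0// ltW.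
Qed.

Lemma has_symbol_ext K L phi psi : (forall T, K T = L T) ->
  (forall w, - pi <= w <= pi -> phi w = psi w) -> has_symbol K phi -> has_symbol L psi.
Proof.
move=> KL pp H e e0; have [p [f [pf fp pz]]] := H _ e0; exists p, f; split => //.
  by move=> w h; rewrite -pp// fp.
move=> z B B0 zs zB; apply: filterS (pz z B B0 zs zB) => T.
by rewrite KL.
Qed.

Lemma has_symbol_add K L phi psi : has_symbol K phi -> has_symbol L psi ->
  has_symbol (fun T => K T + L T) (fun w => phi w + psi w).
Proof.
move=> HK HL e e0; have e2 : 0 < e / 2 by rewrite divr_gt0.
have [p [f [pf fp pz]]] := HK _ e2; have [q [g [qg gp qz]]] := HL _ e2.
exists (fun T => p T + q T), (fun w => f w + g w); split; first exact: cosp_add.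
  move=> w h; rewrite opprD addrACA (le_trans (ler_normD _ _))// (splitr e) lerD//.
    exact: fp.
  exact: gp.
move=> z B B0 zs zB.
apply: filterS2 (pz z B B0 zs zB) (qz z B B0 zs zB) => T h1 h2.
rewrite opprD addrACA mulmxDl (le_trans (nrmD _ _))// (splitr e) mulrDl lerD//.
Qed.

Lemma has_symbol_scale a K phi : has_symbol K phi ->
  has_symbol (fun T => a *: K T) (fun w => a * phi w).
Proof.
move=> HK e e0; have a1 : 0 < `|a| + 1 by rewrite ltr_wpDl.
have e2 : 0 < e / (`|a| + 1) by rewrite divr_gt0.
have ea : `|a| * (e / (`|a| + 1)) <= e.
  by rewrite mulrCA ler_piMr ?(ltW e0)// ler_pdivrMr// mul1r lerDl.
have [p [f [pf fp pz]]] := HK _ e2.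
exists (fun T => a *: p T), (fun w => a * f w); split; first exact: cosp_scale.
  move=> w h; rewrite -mulrBr normrM (le_trans _ ea)// ler_wpM2l// fp//.
move=> z B B0 zs zB.
apply: filterS (pz z B B0 zs zB) => T h1.
rewrite -scalerBr -scalemxAl nrmZ (le_trans (ler_wpM2l (normr_ge0 a) h1))// mulrA.
by rewrite ler_wpM2r// ltW.
Qed.

(** With approximants [p], [q] and [r] standing for [p q], the error [K L - r] splits into
    [K (L - q)], which needs [K] bounded, [(K - p) q], applied to the small vectors [q T *m z T],
    and the boundary term [p q - r]. *)
Lemma has_symbol_mul K L phi psi C F : 0 < C -> 0 < F -> opbd K C ->
  (forall w, - pi <= w <= pi -> `|phi w| <= F) ->
  has_symbol K phi -> has_symbol L psi ->
  has_symbol (fun T => K T *m L T) (fun w => phi w * psi w).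
Proof.
move=> C0 F0 KC phF HK HL e e0.
have CF0 : 0 < C + F by rewrite addr_gt0.
(* The divisor covers both uses of the error of [q]: multiplied by [C] for the matrices and by [F]
   for the symbols. *)
pose e1 := e / 4 / (C + F).
have e10 : 0 < e1 by rewrite !divr_gt0.
have [q [g [qg gp qz]]] := HL _ e10.
have [Bq Bq0 [qB gB]] := cosp_nrm qg.
(* This can be fixed only after [q], whose bound multiplies the error of [p]. *)
pose e2 := e / 4 / Bq.
have e20 : 0 < e2 by rewrite !divr_gt0.
have [p [f [pf fp pz]]] := HK _ e20.
have [r [rf rz]] := cosp_mul pf qg.
have e1CF : e1 * (C + F) = e / 4 by rewrite divfK// gt_eqF.
have e2B : e2 * Bq = e / 4 by rewrite divfK// gt_eqF.
exists r, (fun w => f w * g w); split => //.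
  move=> w h.
  have -> : f w * g w - phi w * psi w = (f w - phi w) * g w + phi w * (g w - psi w) by ring.
  rewrite (le_trans (ler_normD _ _))// !normrM.
  have h1 : `|f w - phi w| * `|g w| <= e2 * Bq by apply: ler_pM => //; exact: fp.
  have h2 : `|phi w| * `|g w - psi w| <= F * e1.
    by apply: ler_pM => //; [exact: phF|exact: gp].
  nra.
move=> z B B0 zs zB.
have eB : 0 < e / 4 * B by rewrite mulr_gt0// divr_gt0.
have qzs := cosp_small qg zs.
have qzB : \forall T \near \oo, nrm (q T *m z T) <= Bq * B.
  apply: filterS zB => T h; rewrite (le_trans (qB _ _))// ler_wpM2l//.
  exact: ltW.
apply: filterS3 (qz z B B0 zs zB) (pz _ _ (mulr_gt0 Bq0 B0) qzs qzB) (rz _ zs _ eB) => T h1 h2 h3.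
have -> : (K T *m L T - r T) *m z T = K T *m ((L T - q T) *m z T) +
   (K T - p T) *m (q T *m z T) + (p T *m q T - r T) *m z T.
  rewrite !mulmxA -!mulmxDl; congr (_ *m _).
  rewrite mulmxBr mulmxBl !addrA; congr (_ - _).
  by rewrite subrK subrK.
rewrite (le_trans (nrmD _ _))//.
have h4 := nrmD (K T *m ((L T - q T) *m z T)) ((K T - p T) *m (q T *m z T)).
have h5 := KC T ((L T - q T) *m z T).
have h6 : C * nrm ((L T - q T) *m z T) <= C * (e1 * B) by rewrite ler_wpM2l// ltW.
have h7 : C * (e1 * B) <= e / 4 * B.
  rewrite mulrA ler_wpM2r ?(ltW B0)// -e1CF mulrC ler_wpM2l ?(ltW e10)// lerDl.
  exact: ltW.
have h8 : e2 * (Bq * B) = e / 4 * B by rewrite mulrA e2B.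
lra.
Qed.

(** Operator-norm approximation is stronger than closeness on small vectors. Infinite cosine series
    and the Neumann series enter the class through this closure. *)
Lemma has_symbol_lim K phi :
  (forall eps : R, 0 < eps -> exists L psi, [/\ has_symbol L psi,
    forall w, - pi <= w <= pi -> `|psi w - phi w| <= eps &
    opbd (fun T => K T - L T) eps]) -> has_symbol K phi.
Proof.
move=> H e e0; have e2 : 0 < e / 2 by rewrite divr_gt0.
have [L [psi [HL pp KL]]] := H _ e2; have [q [g [qg gp qz]]] := HL _ e2.
exists q, g; split => //.
  move=> w h; rewrite -(subrK (psi w) (g w)) -addrA (le_trans (ler_normD _ _))// (splitr e) lerD//.
    exact: gp.
  exact: pp.
move=> z B B0 zs zB.
apply: filterS2 (qz z B B0 zs zB) zB => T h1 h2.
rewrite -(subrK (L T) (K T)) -addrA mulmxDl (le_trans (nrmD _ _))// (splitr e) mulrDl lerD//.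
by rewrite (le_trans (KL _ _))// ler_wpM2l// ltW.
Qed.

(** An error in Euclidean norm also bounds each entry, so uniform smallness is inherited from the
    polynomial approximant. *)
Lemma has_symbol_small K phi z : has_symbol K phi -> small z -> small (fun T => K T *m z T).
Proof.
move=> HK zs; have [B B0 zB] := small_bound zs.
split.
  have [p [f [pf fp pz]]] := HK 1 ltr01.
  have [Bp Bp0 [pB _]] := cosp_nrm pf.
  exists (1 * B + Bp * B); apply: filterS2 (pz z B B0 zs zB) zB => T h1 h2.
  rewrite -(subrK (p T) (K T)) mulmxDl (le_trans (nrmD _ _))// lerD//.
  by rewrite (le_trans (pB _ _))// ler_wpM2l// ltW.
move=> e e0; have eB : 0 < e / 2 / B by rewrite !divr_gt0.
have e2 : 0 < e / 2 by rewrite divr_gt0.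
have [p [f [pf fp pz]]] := HK _ eB.
have [_ ps] := cosp_small pf zs.
apply: filterS2 (pz z B B0 zs zB) (ps _ e2) => T h1 h2 i.
rewrite -(subrK (p T) (K T)) mulmxDl mxE (le_trans (ler_normD _ _))// (splitr e) lerD//.
by rewrite (le_trans (nrm_entry _ _))// (le_trans h1)// divfK// gt_eqF.
Qed.

(** For a cosine polynomial the limit and the integral are the same finite combination of the [c k].
    Approximation then yields both a Cauchy criterion for the forms and a uniform approximation of
    the integrand, hence a common value. *)
Lemma has_symbol_form K phi (h : R -> R[i]) (z y : forall T, 'cV[R]_T) (c : nat -> R) :
  small z -> small y ->
  (forall k, (fun T => dot (z T) (Cmx R k T *m y T)) @ \oo --> c k) ->
  (forall k : nat, is_RS (fun w => (cos (k%:R * w))%:C) h (- pi) pi (c k)%:C) ->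
  (exists V : R, forall n (p : nat -> R), p 0%N = - pi -> p n = pi ->
    (forall k, (k < n)%N -> p k < p k.+1) -> \sum_(k < n) `|h (p k.+1) - h (p k)| <= V%:C) ->
  has_symbol K phi ->
  exists v : R, (fun T => dot (z T) (K T *m y T)) @ \oo --> v /\
    is_RS (fun w => (phi w)%:C) h (- pi) pi v%:C.
Proof.
move=> zs ys zc hc hV HK.
have cospP p f : cosp p f -> exists v : R, (fun T => dot (z T) (p T *m y T)) @ \oo --> v /\
    is_RS (fun w => (f w)%:C) h (- pi) pi v%:C.
  elim=> {p f} [k|p f q g _ [v [v1 v2]] _ [u [u1 u2]]|a p f _ [v [v1 v2]]].
  - by exists (c k).
  - exists (v + u); split.
      under eq_fun do rewrite mulmxDl dotDr.
      exact: cvgD.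
    rewrite rmorphD/=; under eq_fun do rewrite rmorphD/=; exact: (is_RS_add v2 u2).
  - exists (a * v); split.
      under eq_fun do rewrite -scalemxAl dotZr.
      exact: cvgZr.
    rewrite rmorphM/=; under eq_fun do rewrite rmorphM/=; exact: (is_RS_scale a%:C v2).
have [Bz Bz0 zB] := small_bound zs; have [By By0 yB] := small_bound ys.
have key e : 0 < e -> exists (f : R -> R) (v : R), [/\ is_RS (fun w => (f w)%:C) h (- pi) pi v%:C,
    forall w, - pi <= w <= pi -> `|f w - phi w| <= e &
    \forall T \near \oo, `|dot (z T) (K T *m y T) - v| <= e].
  (* The first bound is for the symbols, the second for the matrices, whose error Cauchy-Schwarz
     multiplies by [Bz * By]. *)
  move=> e0; pose e1 := Num.min e (e / 2 / (Bz * By)).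
  have e10 : 0 < e1 by rewrite lt_min e0 !divr_gt0// mulr_gt0.
  have e2 : 0 < e / 2 by rewrite divr_gt0.
  have [p [f [pf fp pz]]] := HK _ e10.
  have [v [v1 v2]] := cospP _ _ pf.
  exists f, v; split => //.
    by move=> w /fp /le_trans; apply; rewrite ge_min lexx.
  move/cvgrPdist_le: v1 => /(_ _ e2) v1.
  apply: filterS3 zB (pz _ _ By0 ys yB) v1 => T h1 h2 h3.
  rewrite -(subrK (p T) (K T)) mulmxDl dotDr -addrA (le_trans (ler_normD _ _))// (splitr e).
  rewrite lerD//; last by rewrite distrC.
  rewrite (le_trans (dot_le _ _))// (@le_trans _ _ (Bz * (e1 * By)))//.
    by rewrite ler_pM ?nrm_ge0.
  rewrite mulrCA (@le_trans _ _ (e / 2 / (Bz * By) * (Bz * By)))//.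
    apply: ler_wpM2r; first by rewrite mulr_ge0// ltW.
    by rewrite /e1 ge_min lexx orbT.
  by rewrite divfK// gt_eqF// mulr_gt0.
have [v uv] : exists v : R, (fun T => dot (z T) (K T *m y T)) @ \oo --> v.
  exists (limn (fun T => dot (z T) (K T *m y T))); apply: seq_near_cvg => e e0.
  by have [f [v [_ _ ?]]] := key _ e0; exists v.
exists v; split => //; apply: is_RS_lim => // e e0.
have [f [v' [v'1 v'2 v'3]]] := key _ e0.
exists (fun w => (f w)%:C), v'%:C; split => //.
  by move=> w /v'2; rewrite -rmorphB/= normC_real lecR distrC.
by rewrite -rmorphB/= normC_real lecR; exact: limn_dist uv v'3.
Qed.

End SymbolCalculus.

(** * Orthogonality at Fourier frequencies and the periodogram *)

Section TrigonometricSums.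
Variable R : realType.

(** Equally spaced frequencies, started at $-\pi$ so that bounds on a symbol over $[-\pi,\pi]$ apply
    to them. *)
Definition fpt (N j : nat) : R := - pi + j%:R * (2 * pi / N%:R).

Lemma fpt_range N j : (j < N)%N -> - pi <= fpt N j <= pi.
Proof.
move=> jN; have N0 : 0 < N%:R :> R by rewrite ltr0n; lia.
have pi0 : 0 <= pi :> R by exact: pi_ge0.
have h : 0 <= 2 * pi / N%:R :> R by rewrite divr_ge0 ?mulr_ge0// ltW.
rewrite /fpt lerDl mulr_ge0//=.
rewrite addrC lerBlDr mulrA ler_pdivrMr//.
have : j%:R <= N%:R :> R by rewrite ler_nat ltnW.
nra.
Qed.

Lemma sin_2pin (x : R) (m : nat) : sin (x + 2 * m%:R * pi) = sin x.
Proof.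
rewrite -(periodicn (@sinD2pi R) m x); congr (sin (x + _)).
by rewrite -mulr_natr -(mulr_natr pi 2); ring.
Qed.

(** Multiplied by twice the sine of half the step, the cosines become differences that telescope
    over a whole number of periods; [0 < m < N] makes that sine nonzero. *)
Lemma sum_cos_fpt (N m : nat) : (0 < m < N)%N -> \sum_(j < N) cos (m%:R * fpt N j) = 0.
Proof.
move=> /andP[m0 mN]; have N0 : (0 < N)%N by lia.
have NR : 0 < N%:R :> R by rewrite ltr0n.
pose t : R := m%:R * pi / N%:R.
have st : sin t != 0.
  rewrite gt_eqF// sin_gt0_pi// /t divr_gt0 ?mulr_gt0 ?pi_gt0 ?ltr0n//=.
  by rewrite ltr_pdivrMr// mulrC ltr_pM2l ?pi_gt0// ltr_nat.
pose F (j : nat) : R := sin (- (m%:R * pi) + (2 * j%:R - 1) * t).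
have tele j : 2 * sin t * cos (m%:R * fpt N j) = F j.+1 - F j.
  have e1 : F j.+1 = sin (m%:R * fpt N j + t).
    by congr sin; rewrite /fpt /t -natr1; field; rewrite gt_eqF.
  have e2 : F j = sin (m%:R * fpt N j - t).
    by congr sin; rewrite /fpt /t; field; rewrite gt_eqF.
  by rewrite e1 e2 !sinD cosN sinN; ring.
have : 2 * sin t * \sum_(j < N) cos (m%:R * fpt N j) = 0.
  rewrite mulr_sumr; under eq_bigr do rewrite tele.
  rewrite -(big_mkord xpredT (fun j => F j.+1 - F j)) telescope_sumr//.
  suff -> : F N = F 0%N by rewrite subrr.
  rewrite /F; have -> : - (m%:R * pi) + (2 * N%:R - 1) * t =
    (- (m%:R * pi) + (2 * 0 - 1) * t) + 2 * m%:R * pi.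
    by rewrite /t; field; rewrite gt_eqF.
  exact: sin_2pin.
by move/eqP; rewrite !mulf_eq0 pnatr_eq0/= (negbTE st)/= => /eqP.
Qed.

Lemma sum_cosz_fpt (N : nat) (m : int) : (`|m| < N)%N ->
  \sum_(j < N) cos (m%:~R * fpt N j) = N%:R * (m == 0)%:R.
Proof.
move=> mN; have -> : \sum_(j < N) cos (m%:~R * fpt N j) = \sum_(j < N) cos (`|m|%:R * fpt N j).
  apply: eq_bigr => j _; case: m mN => n _ //=.
  by rewrite NegzE rmorphN/= mulNr cosN.
have [->|m0] := eqVneq m 0.
  under eq_bigr do rewrite absz0 mul0r cos0.
  by rewrite sumr_const card_ord mulr1.
rewrite mulr0; have := @sum_cos_fpt N `|m|%N.
rewrite mN andbT absz_gt0 m0 => /(_ isT) {2}<-.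
by apply: eq_bigr => j _; rewrite natr_absz.
Qed.

(** The squared modulus of the Fourier transform of [v], in real form and without a normalizing
    factor. *)
Definition periodogram T (v : 'cV[R]_T) (w : R) : R :=
  (\sum_s v s 0 * cos (s%:R * w)) ^+ 2 + (\sum_s v s 0 * sin (s%:R * w)) ^+ 2.

Lemma periodogram_ge0 T (v : 'cV[R]_T) w : 0 <= periodogram v w.
Proof. by rewrite addr_ge0 ?sqr_ge0. Qed.

(* Quadratic forms of Toeplitz matrices are averages of the symbol against the periodogram
   at N Fourier frequencies, which gives operator bounds from bounds on the symbol. *)
Lemma dot_Cmx_dft N T k (v : 'cV[R]_T) : (T + k <= N)%N ->
  dot v (Cmx R k T *m v) = N%:R^-1 * \sum_(j < N) cos (k%:R * fpt N j) * periodogram v (fpt N j).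
Proof.
move=> TkN; have [T0|T0] := posnP T.
  have e0 (f : 'I_T -> R) : \sum_s f s = 0.
    by rewrite big1// => -[s sT]; exfalso; move: sT; rewrite T0.
  rewrite /dot e0 big1 ?mulr0// => j _.
  by rewrite /periodogram !e0 expr0n addr0 mulr0.
have NR : 0 < N%:R :> R by rewrite ltr0n; lia.
have perE w : periodogram v w = \sum_s \sum_t v s 0 * v t 0 * cos ((s%:R - t%:R) * w).
  rewrite /periodogram !expr2 !mulr_suml -big_split/=; apply: eq_bigr => s _.
  rewrite !mulr_sumr -big_split/=; apply: eq_bigr => t _.
  by rewrite mulrBl cosB; ring.
under [in RHS]eq_bigr do rewrite perE mulr_sumr.
rewrite exchange_big/= mulr_sumr; apply: eq_bigr => s _.
under [in RHS]eq_bigr do rewrite mulr_sumr.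
rewrite exchange_big/= mulr_sumr mxE mulr_sumr; apply: eq_bigr => t _.
have -> : \sum_(j < N) cos (k%:R * fpt N j) * (v s 0 * v t 0 * cos ((s%:R - t%:R) * fpt N j)) =
   v s 0 * v t 0 / 2 * (\sum_(j < N) cos ((k%:Z + s%:Z - t%:Z)%:~R * fpt N j) +
     \sum_(j < N) cos ((k%:Z - s%:Z + t%:Z)%:~R * fpt N j)).
  rewrite -big_split mulr_sumr; apply: eq_bigr => j _ /=.
  rewrite !(rmorphD, rmorphN)/=.
  have -> : (k%:R + s%:R - t%:R) * fpt N j = k%:R * fpt N j + (s%:R - t%:R) * fpt N j by ring.
  have -> : (k%:R - s%:R + t%:R) * fpt N j = k%:R * fpt N j - (s%:R - t%:R) * fpt N j by ring.
  by rewrite !cosD cosN sinN; field.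
have sT := ltn_ord s; have tT := ltn_ord t.
(* No aliasing: [T + k <= N] keeps both integer frequencies below [N] in absolute value, so only the
   frequency zero survives. *)
rewrite !sum_cosz_fpt; [|lia|lia].
rewrite mxE.
have -> : (s + k == t)%N = (k%:Z + s%:Z - t%:Z == 0) by apply/eqP/eqP; lia.
have -> : (t + k == s)%N = (k%:Z - s%:Z + t%:Z == 0) by apply/eqP/eqP; lia.
by field; rewrite gt_eqF.
Qed.

End TrigonometricSums.

(** * Toeplitz matrices with summable coefficients *)

Section Toeplitz.
Variables (R : realType) (e : nat -> R).
Hypothesis e_sum : exists M : R, forall n, \sum_(k < n) `|e k| <= M.

Lemma abs_tail (eps : R) : 0 < eps ->
  \forall N \near \oo, forall n, (N <= n)%N -> \sum_(N <= k < n) `|e k| <= eps.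
Proof.
move=> eps0; have [M HM] := e_sum.
have mono : {homo series (fun k => `|e k|) : n m / (n <= m)%N >-> n <= m}.
  by apply: nondecreasing_series => n _ _.
have cv : cvgn (series (fun k => `|e k|)).
  apply: nondecreasing_is_cvgn => //.
  by exists M => _ [n _ <-]; rewrite /series/= big_mkord.
move/cvgrPdist_le: (cv) => /(_ _ eps0); apply: filterS => N hN n Nn.
rewrite -(sub_series_geq _ Nn)//.
have h := nondecreasing_cvgn_le mono cv n.
have := ler_norm (limn (series (fun k => `|e k|)) - series (fun k => `|e k|) N).
by move: hN h; lra.
Qed.

(** The multiplicity of a lag in an even two-sided sum, where [k] and [- k] share one
    coefficient. *)
Definition ctwo (k : nat) : R := if k is 0%N then 1 else 2.

Lemma ctwo_le k : 0 <= ctwo k <= 2.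
Proof. by case: k => [|k] /=; apply/andP; split; lra. Qed.

Definition lam_n (n : nat) (w : R) : R := \sum_(k < n) ctwo k * e k * cos (k%:R * w).

Lemma zsumS (c : int -> R) n : zsum c n.+1 = zsum c n + (c n.+1%:Z + c (- n.+1%:Z)).
Proof.
rewrite /zsum mulnS addSn addSn big_ord_recl big_ord_recr/=.
have -> : zwin n.+1 0 = - n.+1%:Z by rewrite /zwin; lia.
have -> : zwin n.+1 (bump 0 (2 * n).+1) = n.+1%:Z by rewrite /zwin /bump/=; lia.
rewrite [LHS]addrC -[LHS]addrA; congr (_ + _); apply: eq_bigr => i _.
congr c; change (Posz (1 + i) - n.+1%:Z = i%:Z - n%:Z); lia.
Qed.

Lemma zsum0 (c : int -> R) : zsum c 0 = c 0.
Proof. by rewrite /zsum muln0 big_ord1; congr c. Qed.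

Lemma zsum_even n w : zsum (fun i : int => e (absz i) * cos (i%:~R * w)) n = lam_n n.+1 w.
Proof.
elim: n => [|n IH]; first by rewrite zsum0 /lam_n big_ord1/= mul1r.
rewrite zsumS IH abszN rmorphN mulNr cosN /lam_n [in RHS]big_ord_recr/=; congr (_ + _).
by rewrite /=; ring.
Qed.

Lemma zsum_even_sin n w : zsum (fun i : int => e (absz i) * sin (i%:~R * w)) n = 0.
Proof.
elim: n => [|n IH]; first by rewrite zsum0 mul0r sin0 mulr0.
by rewrite zsumS IH add0r abszN rmorphN/= mulNr sinN mulrN subrr.
Qed.

(** The symbol of [Lambda e], which is $2\pi$ times the spectral density with autocovariances
    [e]. *)
Definition lam (w : R) : R := limn (zsum (fun i : int => e (absz i) * cos (i%:~R * w))).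

Lemma fourier_even w : fourier_Z (fun i : int => e (absz i)) w = (lam w)%:C.
Proof.
rewrite /fourier_Z; congr (_ +i* _).
rewrite (_ : zsum _ = fun=> 0) ?lim_cst ?oppr0//.
by apply/funext => n; exact: zsum_even_sin.
Qed.

Lemma lam_n_tail N n w : (N <= n)%N ->
  `|lam_n n w - lam_n N w| <= 2 * \sum_(N <= k < n) `|e k|.
Proof.
move=> Nn; rewrite /lam_n -!(big_mkord xpredT (fun k => ctwo k * e k * cos (k%:R * w))).
rewrite (big_cat_nat (n := N))//= addrAC subrr add0r.
rewrite (le_trans (ler_norm_sum _ _ _))// mulr_sumr ler_sum// => k _.
rewrite !normrM -mulrA ler_pM//.
  by have /andP[h1 h2] := ctwo_le k; rewrite ger0_norm.
by rewrite ler_piMr// ler_norml cos_geN1 cos_le1.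
Qed.

Lemma lam_near eps : 0 < eps ->
  \forall N \near \oo, forall w, `|lam w - lam_n N w| <= eps.
Proof.
move=> e0; have e2 : 0 < eps / 2 by rewrite divr_gt0.
have cv w : cvgn (zsum (fun i : int => e (absz i) * cos (i%:~R * w))).
  apply: seq_near_cvg => d d0; have d2 : 0 < d / 2 by rewrite divr_gt0.
  have [N _ HN] := abs_tail d2; exists (lam_n N w).
  exists N => // n /= Nn; rewrite zsum_even.
  have Nn1 : (N <= n.+1)%N by exact: leqW.
  rewrite (le_trans (lam_n_tail _ Nn1))//.
  have := HN N (leqnn N) _ Nn1; lra.
apply: filterS (abs_tail e2) => N HN w; apply: (limn_dist (cv w)).
exists N => // n /= Nn; rewrite zsum_even.
have Nn1 : (N <= n.+1)%N by exact: leqW.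
rewrite (le_trans (lam_n_tail _ Nn1))//.
have := HN _ Nn1; lra.
Qed.

(** The entry [(s, t)] receives only the lag $|s-t|$, and the factor 2 of [ctwo] cancels the one
    half in [Cmx]. Any [n >= T] is allowed because larger lags do not fit into the matrix. *)
Lemma Lambda_Cmx T n : (T <= n)%N -> Lambda e T = \sum_(k < n) (ctwo k * e k) *: Cmx R k T.
Proof.
move=> Tn; apply/matrixP => s t; rewrite mxE summxE.
have sT := ltn_ord s; have tT := ltn_ord t.
set d := if _ then _ else _.
have dn : (d < n)%N by rewrite /d; case: ifP; lia.
rewrite (bigD1 (Ordinal dn))//= big1 ?addr0.
  rewrite !mxE/= /d.
  have [st|ts] := leqP s t.
    rewrite subnKC// eqxx.
    have [E|E] := eqVneq (s : nat) t.
      by rewrite E subnn addn0 eqxx/=; field.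
    have : (t - s)%N != 0%N by apply/eqP; move/eqP: E; lia.
    have -> : (t + (t - s) == s)%N = false by apply/eqP; move/eqP: E; lia.
    by case: (t - s)%N => //= m _; field.
  rewrite subnKC ?(ltnW ts)// eqxx.
  have -> : (s + (s - t) == t)%N = false by apply/eqP; lia.
  have : (s - t)%N != 0%N by apply/eqP; lia.
  by case: (s - t)%N => //= m _; field.
move=> k; rewrite -val_eqE/= => /eqP kd; rewrite !mxE.
have -> : (s + k == t)%N = false by apply/eqP; move: kd; rewrite /d; case: ifP; lia.
have -> : (t + k == s)%N = false by apply/eqP; move: kd; rewrite /d; case: ifP; lia.
by rewrite addr0 mul0r mulr0.
Qed.

Lemma nrm_sum_Cmx T (v : 'cV[R]_T) m n :
  nrm (\sum_(m <= k < n) (ctwo k * e k) *: Cmx R k T *m v) <= 2 * (\sum_(m <= k < n) `|e k|) * nrm v.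
Proof.
rewrite (le_trans (nrm_sum _ _ _))// mulr_sumr mulr_suml ler_sum// => k _.
rewrite -scalemxAl nrmZ normrM ler_pM ?mulr_ge0 ?nrm_ge0 ?Cmx_nrm//.
by rewrite ler_wpM2r//; have /andP[h1 h2] := ctwo_le k; rewrite ger0_norm.
Qed.

Lemma Lambda_mul T n (v : 'cV[R]_T) : (T <= n)%N ->
  Lambda e T *m v = \sum_(0 <= k < n) (ctwo k * e k) *: Cmx R k T *m v.
Proof. by move=> Tn; rewrite (Lambda_Cmx Tn) mulmx_suml big_mkord. Qed.

Lemma Lambda_opbd : exists2 C, 0 < C & opbd (Lambda e) C.
Proof.
have [M HM] := e_sum; exists (2 * `|M| + 1); first by rewrite ltr_wpDl// mulr_ge0.
move=> T v; rewrite (Lambda_mul v (leqnn T)) (le_trans (nrm_sum_Cmx _ _ _))//.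
rewrite ler_wpM2r ?nrm_ge0// ler_wpDr// ler_wpM2l//.
by rewrite big_mkord (le_trans (HM T))// ler_norm.
Qed.

Lemma lam_bound : exists2 F, 0 < F & forall w, `|lam w| <= F.
Proof.
have [M HM] := e_sum; have [N _ HN] := lam_near ltr01.
exists (1 + 2 * `|M| + 1); first by rewrite ltr_wpDl// addr_ge0// mulr_ge0.
move=> w; have h1 := HN N (leqnn N) w; have h2 := @lam_n_tail 0 N w (leq0n N).
rewrite /lam_n big_ord0 subr0 big_mkord in h2.
have h3 := HM N; have h4 := ler_norm M.
have := ler_normD (lam w - lam_n N w) (lam_n N w); rewrite subrK /lam_n; lra.
Qed.

Lemma cosp_lam_n n : cosp (fun T => \sum_(k < n.+1) (ctwo k * e k) *: Cmx R k T) (lam_n n.+1).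
Proof.
rewrite /lam_n; elim: n => [|n IH].
  rewrite (_ : (fun T => _) = (fun T => (ctwo 0 * e 0) *: Cmx R 0 T)); last first.
    by apply: functional_extensionality_dep => T; rewrite big_ord1.
  rewrite (_ : (fun w => _) = (fun w => (ctwo 0 * e 0) * cos (0%:R * w))); last first.
    by apply: funext => T; rewrite big_ord1.
  by apply: cosp_scale; exact: cosp_base.
rewrite (_ : (fun T => _) = (fun T => \sum_(k < n.+1) (ctwo k * e k) *: Cmx R k T +
   (ctwo n.+1 * e n.+1) *: Cmx R n.+1 T)); last first.
  by apply: functional_extensionality_dep => T; rewrite big_ord_recr.
rewrite (_ : (fun w => _) = (fun w => \sum_(k < n.+1) ctwo k * e k * cos (k%:R * w) +
   (ctwo n.+1 * e n.+1) * cos (n.+1%:R * w))); last first.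
  by apply: funext => T; rewrite big_ord_recr.
by apply: cosp_add => //; apply: cosp_scale; exact: cosp_base.
Qed.

Lemma Lambda_symbol : has_symbol (Lambda e) lam.
Proof.
apply: has_symbol_lim => eps e0; have e2 : 0 < eps / 2 by rewrite divr_gt0.
have [N1 _ HN1] := abs_tail e2; have [N2 _ HN2] := lam_near e0.
pose N := (maxn N1 N2).+1.
exists (fun T => \sum_(k < N) (ctwo k * e k) *: Cmx R k T), (lam_n N); split.
- exact/cosp_has_symbol/cosp_lam_n.
- by move=> w _; rewrite distrC; apply: HN2; rewrite /N /=; lia.
(* A common upper index makes the difference a tail sum, even when [T] is smaller than [N]. *)
- move=> T v; pose n := maxn T N.
  have Nn : (N <= n)%N by exact: leq_maxr.
  rewrite mulmxBl (Lambda_mul v (leq_maxl T N)) -/n (big_cat_nat (n := N))//=.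
  rewrite mulmx_suml -(big_mkord xpredT (fun k => (ctwo k * e k) *: Cmx R k T *m v)) addrAC subrr add0r.
  rewrite (le_trans (nrm_sum_Cmx _ _ _))// ler_wpM2r ?nrm_ge0//.
  have N1N : (N1 <= N)%N by rewrite /N; lia.
  by have := HN1 N N1N n Nn; lra.
Qed.

Lemma Lambda_sym T : (Lambda e T)^T = Lambda e T.
Proof.
apply/matrixP => s t; rewrite !mxE; congr e.
by case: (leqP s t); case: (leqP t s); lia.
Qed.

(** The form is approximated by an average of [lam_n] against the nonnegative periodogram, and the
    lag 0 turns the same average without [lam_n] into [nsq v]. The slack [eps] pays for [lam_n]
    being only close to [lam]. *)
Lemma Lambda_lower c : (forall w, - pi <= w <= pi -> c <= lam w) ->
  forall T (v : 'cV[R]_T), c * nsq v <= dot v (Lambda e T *m v).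
Proof.
move=> cl T v; apply/ler_addgt0Pr => eps e0.
pose d := eps / (nsq v + 1).
have v1 : 0 < nsq v + 1 by rewrite ltr_wpDl// nsq_ge0.
have d0 : 0 < d by rewrite divr_gt0.
have [N1 _ HN1] := lam_near d0.
pose n := maxn N1 T; pose N := (T + n)%N.
have lamd w : - pi <= w <= pi -> c - d <= lam_n n w.
  move=> h; have := cl _ h; have N1n : (N1 <= n)%N by exact: leq_maxl.
  have := le_trans (ler_norm _) (HN1 n N1n w); lra.
have Nge0 : 0 <= N%:R^-1 :> R by rewrite invr_ge0.
have h1 : (c - d) * nsq v <= dot v (Lambda e T *m v).
  rewrite -dotvv -{2}(mul1mx v) -Cmx0 (@dot_Cmx_dft R N); last by rewrite /N; lia.
  rewrite (Lambda_mul v (leq_maxr N1 T)) -/n big_mkord.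
  have -> : dot v (\sum_(k < n) (ctwo k * e k) *: Cmx R k T *m v) =
     N%:R^-1 * \sum_(j < N) lam_n n (fpt R N j) * periodogram v (fpt R N j).
    have -> : dot v (\sum_(k < n) (ctwo k * e k) *: Cmx R k T *m v) =
        \sum_(k < n) (ctwo k * e k) * dot v (Cmx R k T *m v).
      elim/big_rec2: _ => [|k a b _ <-].
        by rewrite /dot big1// => i _; rewrite mxE mulr0.
      by rewrite dotDr -scalemxAl dotZr.
    under [in RHS]eq_bigr do rewrite /lam_n mulr_suml.
    rewrite exchange_big mulr_sumr; apply: eq_bigr => k _ /=.
    rewrite (@dot_Cmx_dft R N); last by rewrite /N; have := ltn_ord k; lia.
    rewrite mulrCA; congr (_ * _); rewrite mulr_sumr; apply: eq_bigr => j _.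
    by rewrite mulrA.
  rewrite mulrCA ler_wpM2l// mulr_sumr ler_sum// => j _.
  rewrite mul0r cos0 mul1r ler_wpM2r ?periodogram_ge0// lamd//.
  exact: fpt_range.
have h2 : d * nsq v <= eps.
  rewrite /d mulrAC ler_pdivrMr// ler_wpM2l ?(ltW e0)// lerDl//.
move: h1 h2; lra.
Qed.

End Toeplitz.

(** * Entrywise limits of matrices and kernels of semidefinite forms *)

Section MatrixLimits.
Variable R : realType.

Lemma cvg_sumR (I : Type) (r : seq I) (P : pred I) (f : I -> nat -> R) (l : I -> R) :
  (forall i, P i -> f i @ \oo --> l i) ->
  (fun T => \sum_(i <- r | P i) f i T) @ \oo --> \sum_(i <- r | P i) l i.
Proof.
move=> fl; elim: r => [|i r IH].
  by rewrite big_nil; under eq_fun do rewrite big_nil; exact: cvg_cst.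
rewrite big_cons; under eq_fun do rewrite big_cons.
by case: ifP => Pi //; apply: cvgD => //; exact: fl.
Qed.

Lemma cvg_prodR (I : Type) (r : seq I) (P : pred I) (f : I -> nat -> R) (l : I -> R) :
  (forall i, P i -> f i @ \oo --> l i) ->
  (fun T => \prod_(i <- r | P i) f i T) @ \oo --> \prod_(i <- r | P i) l i.
Proof.
move=> fl; elim: r => [|i r IH].
  by rewrite big_nil; under eq_fun do rewrite big_nil; exact: cvg_cst.
rewrite big_cons; under eq_fun do rewrite big_cons.
by case: ifP => Pi //; apply: cvgM => //; exact: fl.
Qed.

Definition mcvg m n (A : nat -> 'M[R]_(m, n)) (L : 'M[R]_(m, n)) : Prop :=
  forall i j, (fun T => A T i j) @ \oo --> L i j.

Lemma mcvg_cst m n (L : 'M[R]_(m, n)) : mcvg (fun=> L) L.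
Proof. by move=> i j; exact: cvg_cst. Qed.

Lemma mcvg_mul m n p (A : nat -> 'M[R]_(m, n)) (B : nat -> 'M[R]_(n, p)) L M :
  mcvg A L -> mcvg B M -> mcvg (fun T => A T *m B T) (L *m M).
Proof.
move=> AL BM i j; rewrite mxE; under eq_fun do rewrite mxE.
by apply: cvg_sumR => k _; apply: cvgM; [exact: AL|exact: BM].
Qed.

Lemma mcvg_form n (A : nat -> 'M[R]_n) L (t : 'cV[R]_n) : mcvg A L ->
  (fun T => dot t (A T *m t)) @ \oo --> dot t (L *m t).
Proof.
move=> AL; have := mcvg_mul (mcvg_mul (@mcvg_cst _ _ t^T) AL) (@mcvg_cst _ _ t).
move=> /(_ 0 0); rewrite -mulmxA dotE.
by under eq_fun do rewrite -mulmxA dotE.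
Qed.

Lemma cvg_det n (A : nat -> 'M[R]_n) L : mcvg A L -> (fun T => \det (A T)) @ \oo --> \det L.
Proof.
move=> AL; rewrite /determinant; apply: cvg_sumR => s _.
by apply: cvgM; [exact: cvg_cst|apply: cvg_prodR => i _; exact: AL].
Qed.

Lemma mcvg_unit n (A : nat -> 'M[R]_n) L : mcvg A L -> L \in unitmx ->
  \forall T \near \oo, A T \in unitmx.
Proof.
move=> AL; rewrite unitmxE unitfE => L0; have := cvg_det AL.
move=> /cvgrPdist_lt /(_ `|\det L|); rewrite normr_gt0 => /(_ L0).
apply: filterS => T h; rewrite unitmxE unitfE; apply/eqP => d0.
by move: h; rewrite d0 subr0 ltxx.
Qed.

(** By Cramer's rule the entries are quotients of polynomials. [invmx] follows that rule only at
    invertible matrices, hence the restriction to large [T]. *)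
Lemma mcvg_inv n (A : nat -> 'M[R]_n) L : mcvg A L -> L \in unitmx ->
  mcvg (fun T => invmx (A T)) (invmx L).
Proof.
move=> AL Lu i j.
have Au := mcvg_unit AL Lu.
have h : (fun T => (\det (A T))^-1 * (\adj (A T)) i j) @ \oo --> (\det L)^-1 * (\adj L) i j.
  apply: cvgM.
    by apply: cvgV; [move: Lu; rewrite unitmxE unitfE|exact: cvg_det].
  rewrite mxE; under eq_fun do rewrite mxE; rewrite /cofactor.
  apply: cvgM; first exact: cvg_cst.
  apply: cvg_det => k l; rewrite !mxE; under eq_fun do rewrite !mxE; exact: AL.
rewrite /(invmx L) Lu mxE.
apply: cvg_trans h; apply: near_eq_cvg; apply: filterS Au => T AT.
by rewrite /invmx AT [RHS]mxE.
Qed.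

Lemma unitmx_ker n (A : 'M[R]_n) : (forall v : 'cV[R]_n, A *m v = 0 -> v = 0) -> A \in unitmx.
Proof.
move=> H; rewrite -unitmx_tr -row_free_unit; apply: inj_row_free => v vA.
apply: trmx_inj; rewrite trmx0; apply: H.
by apply: trmx_inj; rewrite trmx_mul trmxK vA trmx0.
Qed.

Lemma nsq_eq0 n (v : 'cV[R]_n) : nsq v = 0 -> v = 0.
Proof.
move=> v0; apply/matrixP => i j; rewrite ord1 mxE.
move/eqP: v0; rewrite psumr_eq0 => [/allP/(_ i (mem_index_enum _)) /=|k _].
  by rewrite sqrf_eq0 => /eqP.
exact: sqr_ge0.
Qed.

(** If [S *m u] were nonzero, moving from [u] against it would make the form negative: the
    first-order decrease exceeds the second-order term for a short step. *)
Lemma psd_ker n (S : 'M[R]_n) u : S^T = S -> (forall v, 0 <= dot v (S *m v)) ->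
  dot u (S *m u) = 0 -> S *m u = 0.
Proof.
move=> Ss S0 u0; apply: nsq_eq0; apply/eqP/negPn/negP => n0.
set w := S *m u.
have np : 0 < nsq w by rewrite lt_def n0 nsq_ge0.
pose m := dot w (S *m w); have m0 : 0 <= m by exact: S0.
have m1 : 0 < m + 1 by rewrite ltr_wpDl.
(* With this step length the second-order term [s ^+ 2 * m] is at most half of the decrease
   [2 * s * nsq w]. *)
pose s := nsq w / (m + 1).
have s0 : 0 < s by rewrite divr_gt0.
have := S0 (u - s *: w).
rewrite mulmxBr -scalemxAr !(dotDl, dotDr, dotNl, dotNr, dotZl, dotZr) u0.
rewrite -/w -/m.
have -> : dot u (S *m w) = nsq w by rewrite -dotvv /w dot_mulmx Ss.
rewrite dotvv.
have sm : s * m <= nsq w.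
  by rewrite /s mulrAC ler_pdivrMr// ler_wpM2l ?(ltW np)// lerDl.
nra.
Qed.

End MatrixLimits.

(** * The symbol of the inverse of a Toeplitz matrix *)

Section InverseSymbol.
Variables (R : realType) (e : nat -> R).
Hypothesis e_sum : exists M : R, forall n, \sum_(k < n) `|e k| <= M.
Variable c : R.
Hypothesis c0 : 0 < c.
Hypothesis c_le : forall w, - pi <= w <= pi -> c <= lam e w.

Lemma Lambda_coercive T (v : 'cV[R]_T) : c * nrm v <= nrm (Lambda e T *m v).
Proof.
have h := Lambda_lower e_sum c_le v.
have h2 := le_trans (ler_norm _) (dot_le v (Lambda e T *m v)).
have h3 : nrm v * (c * nrm v) <= nrm v * nrm (Lambda e T *m v).
  by rewrite mulrCA -expr2 nrm_sqr (le_trans h).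
have [v0|v0] := eqVneq (nrm v) 0; first by rewrite v0 mulr0 nrm_ge0.
by rewrite ler_pM2l// lt_def v0 nrm_ge0 in h3.
Qed.

Lemma Lambda_unit T : Lambda e T \in unitmx.
Proof.
apply: unitmx_ker => v v0; apply: nsq_eq0.
have := Lambda_coercive v; rewrite v0 nrm0 pmulr_rle0// => h.
have -> : nsq v = nrm v ^+ 2 by rewrite nrm_sqr.
by apply/eqP; rewrite sqrf_eq0 eq_le h nrm_ge0.
Qed.

Lemma Lambda_inv_opbd : opbd (fun T => invmx (Lambda e T)) c^-1.
Proof.
move=> T v; have := Lambda_coercive (invmx (Lambda e T) *m v).
by rewrite mulmxA mulmxV ?Lambda_unit// mul1mx ler_pdivlMl.
Qed.

Lemma Lambda_inv_sym T : (invmx (Lambda e T))^T = invmx (Lambda e T).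
Proof. by rewrite trmx_inv Lambda_sym. Qed.

(** Writing [v] as [Lambda e T *m w], the form equals that of [Lambda e T] at [w], hence is at least
    [c * nsq w], and [nrm v <= C * nrm w]. *)
Lemma Lambda_inv_lower : exists2 k, 0 < k &
  forall T (v : 'cV[R]_T), k * nsq v <= dot v (invmx (Lambda e T) *m v).
Proof.
have [C C0 LC] := Lambda_opbd e_sum.
exists (c / C ^+ 2); first by rewrite divr_gt0// exprn_gt0.
move=> T v; set w := invmx _ *m v.
have vw : v = Lambda e T *m w by rewrite mulmxA mulmxV ?Lambda_unit// mul1mx.
rewrite {2}vw dotC; apply: le_trans (Lambda_lower e_sum c_le w).
rewrite -mulrA ler_wpM2l ?(ltW c0)// ler_pdivrMl ?exprn_gt0//.
rewrite -!nrm_sqr -exprMn ler_pXn2r ?nnegrE ?mulr_ge0 ?nrm_ge0 ?(ltW C0)//.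
by rewrite vw.
Qed.

Lemma id_symbol : has_symbol (fun T => 1%:M : 'M[R]_T) (fun=> 1).
Proof.
apply: has_symbol_ext (cosp_has_symbol (cosp_base R 0)).
  by move=> T; rewrite Cmx0.
by move=> w _; rewrite mul0r cos0.
Qed.

(* Neumann series for [invmx (Lambda e T)] around a multiple of the identity. *)
Lemma Lambda_inv_symbol : has_symbol (fun T => invmx (Lambda e T)) (fun w => (lam e w)^-1).
Proof.
have [C C0 LC] := Lambda_opbd e_sum; have [F F0 lF] := lam_bound e_sum.
(* This makes [a * C] and [a * F] at most 1 and [a * c] less than 1. Both the form of
   [1 - a * Lambda] and the function [1 - a * lam] then lie between 0 and [q = 1 - a * c], which is
   below 1. *)
pose a := (C + F + c)^-1.
have den0 : 0 < C + F + c by rewrite !addr_gt0.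
have a0 : 0 < a by rewrite invr_gt0.
have aM : a * (C + F + c) = 1 by rewrite mulVf// gt_eqF.
have aC : a * C <= 1 by rewrite -aM ler_wpM2l ?(ltW a0)// -addrA lerDl addr_ge0 ?ltW.
have aF : a * F <= 1 by rewrite -aM ler_wpM2l ?(ltW a0)// addrAC lerDr addr_ge0 ?ltW.
have ac : a * c < 1 by rewrite -aM ltr_pM2l// ltrDr addr_gt0.
have ac0 : 0 < a * c by rewrite mulr_gt0.
pose q := 1 - a * c.
have q0 : 0 < q by rewrite subr_gt0.
have q1 : q < 1 by rewrite /q; lra.
pose N T : 'M[R]_T := 1%:M - a *: Lambda e T.
pose h w := 1 - a * lam e w.
have NS : has_symbol N h.
  apply: has_symbol_ext (has_symbol_add id_symbol (has_symbol_scale (- a) (Lambda_symbol e_sum))).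
    by move=> T; rewrite scaleNr.
  by move=> w _; rewrite mulNr.
have hq w : - pi <= w <= pi -> `|h w| <= q.
  move=> wr; have := c_le wr; have := le_trans (ler_norm _) (lF w) => h1 h2.
  have h3 : a * c <= a * lam e w by rewrite ler_wpM2l// ltW.
  have h4 : a * lam e w <= a * F by rewrite ler_wpM2l// ltW.
  by rewrite ger0_norm /h /q; lra.
have NB : opbd N q.
  move=> T; apply: opbd_sym.
  - by rewrite linearB/= trmx1 linearZ/= Lambda_sym.
  - exact: ltW.
  - move=> v; rewrite mulmxBl mul1mx -scalemxAl dotDr dotNr dotZr dotvv.
    have h1 := Lambda_lower e_sum c_le v.
    have h2 : dot v (Lambda e T *m v) <= C * nsq v.
      rewrite (le_trans (ler_norm _))// (le_trans (dot_le _ _))// -nrm_sqr expr2 mulrCA.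
      by rewrite ler_wpM2l ?nrm_ge0.
    have h3 : a * (c * nsq v) <= a * dot v (Lambda e T *m v) by rewrite ler_wpM2l// ltW.
    have h4 : a * dot v (Lambda e T *m v) <= a * (C * nsq v) by rewrite ler_wpM2l// ltW.
    have h5 := nsq_ge0 v.
    have h6 : a * (C * nsq v) <= nsq v by rewrite mulrA ler_piMl.
    by rewrite ger0_norm /q; lra.
pose Np k T : 'M[R]_T := iter k (mulmx (N T)) 1%:M.
have NpS k : has_symbol (Np k) (fun w => h w ^+ k).
  elim: k => [|k IH]; first exact: id_symbol.
  apply: has_symbol_ext (has_symbol_mul q0 q0 NB hq NS IH) => // w _.
  by rewrite exprS.
have NpB k : opbd (Np k) (q ^+ k).
  elim: k => [|k IH] T v; first by rewrite /= mul1mx mul1r.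
  have -> : Np k.+1 T *m v = N T *m (Np k T *m v) by rewrite mulmxA.
  by rewrite exprS -mulrA (le_trans (NB _ _))// ler_wpM2l ?(ltW q0).
pose S k T : 'M[R]_T := a *: \sum_(i < k) Np i T.
have SS k : has_symbol (S k) (fun w => a * \sum_(i < k) h w ^+ i).
  apply: has_symbol_scale; elim: k => [|k IH].
    apply: has_symbol_ext (has_symbol_scale 0 id_symbol) => [T|w _].
      by rewrite scale0r big_ord0.
    by rewrite mul0r big_ord0.
  apply: has_symbol_ext (has_symbol_add IH (NpS k)) => [T|w _].
    by rewrite big_ord_recr.
  by rewrite big_ord_recr.
have LS k T : Lambda e T *m S k T = 1%:M - Np k T.
  rewrite /S -scalemxAr scalemxAl.
  have -> : a *: Lambda e T = 1%:M - N T by rewrite /N opprB addrC subrK.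
  elim: k => [|k IH]; first by rewrite big_ord0 mulmx0 subrr.
  rewrite big_ord_recr/= mulmxDr IH mulmxBl mul1mx /=.
  by rewrite addrA subrK.
(* The remainder of the Neumann series is exact, so it decays like [q ^+ k / c]. *)
have invS k T : invmx (Lambda e T) - S k T = invmx (Lambda e T) *m Np k T.
  have -> : S k T = invmx (Lambda e T) *m (Lambda e T *m S k T).
    by rewrite mulmxA mulVmx ?Lambda_unit// mul1mx.
  by rewrite LS mulmxBr mulmx1 opprB addrC subrK.
apply: has_symbol_lim => eps e0.
have cq : (fun k => c^-1 * q ^+ k) @ \oo --> c^-1 * 0.
  apply: cvgM; [exact: cvg_cst|apply: cvg_expr].
  by rewrite ger0_norm// ltW.
rewrite mulr0 in cq; move/cvgrPdist_le: cq => /(_ _ e0) [k _ /(_ k (leqnn k))].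
rewrite sub0r normrN ger0_norm ?mulr_ge0 ?exprn_ge0 ?invr_ge0 ?(ltW c0) ?(ltW q0)// => hk.
exists (S k), (fun w => a * \sum_(i < k) h w ^+ i); split => //.
- move=> w wr; have lw := lt_le_trans c0 (c_le wr).
  have -> : a * (\sum_(i < k) h w ^+ i) - (lam e w)^-1 = - ((lam e w)^-1 * h w ^+ k).
    have E : (1 - h w) * (\sum_(i < k) h w ^+ i) = 1 - h w ^+ k.
      by rewrite -[LHS]opprK -mulNr opprB -subrX1 opprB.
    have E2 : 1 - h w = a * lam e w by rewrite /h; ring.
    rewrite E2 in E.
    have E3 : a * (\sum_(i < k) h w ^+ i) = (lam e w)^-1 * (1 - h w ^+ k).
      by rewrite -E; field; rewrite gt_eqF.
    by rewrite E3; ring.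
  rewrite normrN normrM normrX (le_trans _ hk)// ler_pM ?exprn_ge0//.
    by rewrite ger0_norm ?invr_ge0 ?(ltW lw)// lef_pV2// c_le.
  by rewrite lerXn2r ?nnegrE ?(ltW q0)// hq.
- move=> T v; rewrite invS -mulmxA (le_trans (Lambda_inv_opbd _))//.
  rewrite (le_trans _ (ler_wpM2r (nrm_ge0 _) hk))// -mulrA ler_wpM2l ?invr_ge0 ?(ltW c0)//.
  exact: NpB.
Qed.

End InverseSymbol.

(** * Bounded variation of the entries of the spectral distribution *)

Section HermitianIncrements.
Variables (R : realType) (d : nat) (H : R -> 'M[R[i]]_d).
Hypothesis H_herm : forall w, - pi <= w <= pi -> conjT (H w) = H w.
Hypothesis H_psd : forall w1 w2, - pi <= w1 -> w1 <= w2 -> w2 <= pi ->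
  forall z : 'cV[R[i]]_d, 0 <= (conjT z *m (H w2 - H w1) *m z) ord0 ord0.

Lemma delta_form (D : 'M[R[i]]_d) i j : (delta_mx (0 : 'I_1) i *m D *m delta_mx j (0 : 'I_1)) 0 0 = D i j.
Proof. by rewrite -rowE -colE !mxE. Qed.

(** Testing the form at $e_i+ue_j$ with $u=\pm1,\pm\iota$ bounds twice the real and twice the
    imaginary part of [D i j] by the sum of the two diagonal entries. *)
Lemma psd_entry (D : 'M[R[i]]_d) i j : conjT D = D ->
  (forall z : 'cV[R[i]]_d, 0 <= (conjT z *m D *m z) ord0 ord0) ->
  `|D i j| <= D i i + D j j.
Proof.
move=> Dh Dp.
have quad (u : R[i]) : 0 <= D i i + u * D i j + conjc u * D j i + conjc u * u * D j j.
  have := Dp (delta_mx i 0 + u *: delta_mx j 0).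
  have -> : conjT (delta_mx i 0 + u *: delta_mx j 0 : 'cV[R[i]]_d) =
      delta_mx 0 i + conjc u *: delta_mx 0 j.
    apply/matrixP => k l; rewrite !mxE rmorphD rmorphM/= !conjc_nat.
    by rewrite (andbC (_ == i)) (andbC (_ == j)).
  rewrite !(mulmxDl, mulmxDr) -?scalemxAl -?scalemxAr -?scalemxAl.
  have addE (A B : 'M[R[i]]_1) : (A + B) 0 0 = A 0 0 + B 0 0 by rewrite mxE.
  have scE c (A : 'M[R[i]]_1) : (c *: A) 0 0 = c * A 0 0 by rewrite mxE.
  rewrite !(addE, scE) !delta_form.
  by congr (0 <= _); ring.
have Dji : D j i = conjc (D i j) by rewrite -{1}Dh !mxE.
have Dii k : complex.Im (D k k) = 0.
  have : D k k = conjc (D k k) by rewrite -{1}Dh !mxE.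
  case: (D k k) => a b [] /= E; lra.
rewrite [`|_|]normc_def; have := quad 1; have := quad (-1); have := quad 'i; have := quad (- 'i); rewrite Dji.
have := Dii i; have := Dii j.
case: (D i i) => a1 a2 /=; case: (D j j) => b1 b2 /=; case: (D i j) => x y /= -> ->.
rewrite !lecE/= => /andP[_ h1] /andP[_ h2] /andP[_ h3] /andP[_ h4].
rewrite addr0 eqxx/=.
have ab : 0 <= a1 + b1 by lra.
rewrite -(ger0_norm ab) -sqrtr_sqr ler_wsqrtr//; nra.
Qed.

(** Increments of diagonal entries are nonnegative and telescope; by [psd_entry] they dominate the
    increments of the other entries. *)
Lemma increments_tv i j : exists V : R, forall n (p : nat -> R), p 0%N = - pi -> p n = pi ->
    (forall k, (k < n)%N -> p k < p k.+1) ->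
    \sum_(k < n) `|H (p k.+1) i j - H (p k) i j| <= V%:C.
Proof.
have hr w : - pi <= w <= pi -> conjT (H w) = H w by exact: H_herm.
have pip : - pi <= pi :> R by have := pi_ge0 R; lra.
pose W := (H pi i i - H (- pi) i i) + (H pi j j - H (- pi) j j).
exists (complex.Re W) => n p p0 pn pS.
have mono k l : (k <= l)%N -> (l <= n)%N -> p k <= p l.
  move=> kl; rewrite -(subnKC kl); elim: (l - k)%N => [|m IH]; first by rewrite addn0.
  by rewrite addnS => h; rewrite (le_trans (IH (ltnW h)))// ltW// pS.
have range k : (k <= n)%N -> - pi <= p k <= pi.
  by move=> kn; rewrite -{1}p0 -pn !mono.
have W0 : 0 <= W.
  have h k : 0 <= H pi k k - H (- pi) k k.
    have := @H_psd (- pi) pi (lexx _) pip (lexx _) (delta_mx k 0).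
    have -> : conjT (delta_mx k 0 : 'cV[R[i]]_d) = delta_mx 0 k.
      by apply/matrixP => a b; rewrite !mxE conjc_nat andbC.
    by rewrite delta_form !mxE.
  by rewrite addr_ge0.
have -> : (complex.Re W)%:C = W.
  by move: W0; case: W => a b; rewrite lecE/= => /andP[/eqP -> _].
apply: (@le_trans _ _ (\sum_(k < n) ((H (p k.+1) i i - H (p k) i i) + (H (p k.+1) j j - H (p k) j j)))).
  apply: ler_sum => k _; have kn := ltn_ord k.
  have /andP[r1 r2] := range k (ltnW kn); have /andP[r3 r4] := range k.+1 kn.
  have := @psd_entry (H (p k.+1) - H (p k)) i j.
  rewrite !mxE; apply.
    have E1 := hr _ (range k (ltnW kn)); have E2 := hr _ (range k.+1 kn).
    apply/matrixP => a b; rewrite !mxE rmorphB/=.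
    by rewrite -[in RHS]E1 -[in RHS]E2 !mxE.
  by move=> z; apply: H_psd => //; rewrite ltW// pS.
rewrite big_split/= -!(big_mkord xpredT (fun k => H (p k.+1) _ _ - H (p k) _ _)).
by rewrite !telescope_sumr// p0 pn.
Qed.

End HermitianIncrements.

(** * The normalized design matrix under the Grenander conditions *)

Section Design.
Variables (R : realType) (d : nat) (x : nat -> 'I_d -> R).
Hypothesis G1 : forall i, s2 x i @ \oo --> +oo.
Hypothesis G2 : forall i, (fun T => x T i ^+ 2 / s2 x i T) @ \oo --> 0.
Hypothesis G3 : forall i j k, cvgn (cross x i j k).

Lemma s2E i T : s2 x i T = \sum_(t < T) x t.+1 i ^+ 2.
Proof. by rewrite /s2 big_add1/= big_mkord. Qed.

Lemma s2_mono i m n : (m <= n)%N -> s2 x i m <= s2 x i n.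
Proof.
move=> mn; rewrite /s2 [leRHS](big_cat_nat (n := m.+1))//= lerDl.
by apply: sumr_ge0 => t _; exact: sqr_ge0.
Qed.

Lemma x_le_s2 i t : (0 < t)%N -> x t i ^+ 2 <= s2 x i t.
Proof.
case: t => // t _; rewrite /s2 big_nat_recr//= lerDr.
by apply: sumr_ge0 => u _; exact: sqr_ge0.
Qed.

(** A column of the design may vanish at the beginning, which makes [ST] singular; [ZT] has its
    intended entries only once all scales are positive. *)
Definition sT_pos (T : nat) : Prop := forall i, 0 < sT x i T.

Lemma sT_pos_near : \forall T \near \oo, sT_pos T.
Proof.
apply: filter_forall => i; have /cvgryPge/(_ 1) := G1 i.
by apply: filterS => T h; rewrite sqrtr_gt0 (lt_le_trans ltr01).
Qed.

Lemma ST_unit T : sT_pos T -> ST x T \in unitmx.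
Proof.
move=> sp; rewrite unitmxE unitfE det_diag; apply/prodf_neq0 => i _.
by rewrite mxE gt_eqF.
Qed.

Lemma ZTE T t i : sT_pos T -> ZT x T t i = x t.+1 i / sT x i T.
Proof.
move=> sp; have := mulmxKV (ST_unit sp) (XT x T).
rewrite -/(ZT x T) /ST mul_mx_diag => /matrixP/(_ t i); rewrite !mxE => <-.
by rewrite mulfK// gt_eqF.
Qed.

Lemma dot_Cmx_form T k (u v : 'cV[R]_T) (f g : nat -> R) :
  (forall t : 'I_T, u t 0 = f t) -> (forall t : 'I_T, v t 0 = g t) ->
  dot u (Cmx R k T *m v) = (\sum_(s < T) (s + k < T)%N%:R * (f s * g (s + k)%N) +
    \sum_(s < T) (s + k < T)%N%:R * (g s * f (s + k)%N)) / 2.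
Proof.
move=> uf vg.
have -> : dot u (Cmx R k T *m v) =
   \sum_(s < T) f s * (\sum_(t < T) (s + k == t)%N%:R * g t) / 2 +
   \sum_(s < T) f s * (\sum_(t < T) (t + k == s)%N%:R * g t) / 2.
  rewrite -big_split; apply: eq_bigr => s _ /=.
  rewrite uf -!mulrA -mulrDr; congr (_ * _).
  rewrite mxE !mulr_suml -big_split; apply: eq_bigr => t _ /=.
  by rewrite vg mxE; ring.
rewrite mulrDl; congr (_ + _).
  by rewrite mulr_suml; apply: eq_bigr => s _; rewrite (sum_shift k s g); ring.
under eq_bigr do rewrite mulr_sumr mulr_suml.
rewrite exchange_big/= mulr_suml; apply: eq_bigr => t _.
transitivity (g t / 2 * \sum_(s < T) (t + k == s)%N%:R * f s).
  by rewrite mulr_sumr; apply: eq_bigr => s _; ring.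
by rewrite (sum_shift k t f); ring.
Qed.

Definition zcol i T : 'cV[R]_T := col i (ZT x T).

Lemma zcolE i T t : sT_pos T -> zcol i T t 0 = x t.+1 i / sT x i T.
Proof. by move=> sp; rewrite mxE ZTE. Qed.

(** The columns have norm 1 for large [T]. Early entries are small because the denominator grows
    ([G1]), late ones because each is small relative to its own partial sum ([G2]), which is at most
    the denominator. *)
Lemma zcol_small i : small (zcol i).
Proof.
split.
  exists 1; apply: filterS sT_pos_near => T sp.
  rewrite -(expr1n R 2) -(ler_pXn2r (n := 2)) ?nnegrE ?nrm_ge0// nrm_sqr /nsq.
  under eq_bigr do rewrite zcolE// expr_div_n.
  rewrite -mulr_suml -s2E expr1n expr1n ler_pdivrMr ?exprn_gt0// mul1r sqr_sqrtr//.
  by rewrite s2E sumr_ge0// => t _; exact: sqr_ge0.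
move=> eps e0; have e2 : 0 < eps ^+ 2 by rewrite exprn_gt0.
have /cvgrPdist_le/(_ _ e2) [N1 _ HN1] := G2 i.
pose N := maxn N1 1.
have /cvgryPge/(_ (s2 x i N / eps ^+ 2)) HN2 := G1 i.
apply: filterS2 HN2 sT_pos_near => T HT sp t.
have sp2 : 0 < s2 x i T by have := sp i; rewrite sqrtr_gt0.
rewrite zcolE//.
rewrite -(ler_pXn2r (n := 2)) ?nnegrE ?(ltW e0)// real_normK ?num_real// expr_div_n.
rewrite sqr_sqrtr ?(ltW sp2)// ler_pdivrMr//.
rewrite ler_pdivrMr// in HT.
(* The row [t] carries the time [t.+1]. Up to time [N] the square is at most [s2 x i N]; beyond it
   [G2] applies. *)
have [tN|Nt] := leqP t.+1 N.
  rewrite mulrC (le_trans _ HT)// (le_trans (x_le_s2 _ _))//.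
  exact: s2_mono.
have N1t : (N1 <= t.+1)%N by have := leq_maxl N1 1; rewrite -/N; lia.
(* For a zero sum of squares the ratio in [G2] is 0 by convention and says nothing, but then the
   regressor itself is 0. *)
have [s0|s0] := eqVneq (s2 x i t.+1) 0.
  by rewrite (le_trans (x_le_s2 _ _))// s0 mulr_ge0// ?(ltW e2) ?(ltW sp2).
have s0' : 0 < s2 x i t.+1.
  rewrite lt_def s0 s2E sumr_ge0// => u _; exact: sqr_ge0.
have := HN1 _ N1t; rewrite /= sub0r normrN ger0_norm; last first.
  by rewrite divr_ge0 ?sqr_ge0// ltW.
rewrite ler_pdivrMr// => h; rewrite (le_trans h)// ler_wpM2l ?(ltW e2)//.
exact: s2_mono.
Qed.

Lemma sum_narrow (T k : nat) (F : nat -> R) :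
  \sum_(s < T) (s + k < T)%N%:R * F s = \sum_(s < T - k) F s.
Proof.
rewrite -(big_mkord xpredT (fun s => (s + k < T)%N%:R * F s)) -(big_mkord xpredT F).
rewrite (big_cat_nat (n := (T - k)%N)) ?leq_subr//= [X in _ + X]big1_seq ?addr0.
  by apply: eq_big_nat => s /andP[_ h]; rewrite (_ : (s + k < T)%N) ?mul1r//; lia.
move=> s; rewrite mem_index_iota => /andP[_ /andP[h _]].
by rewrite (_ : (s + k < T)%N = false) ?mul0r//; lia.
Qed.

Lemma dot_zcol_Cmx i j k T : sT_pos T ->
  dot (zcol i T) (Cmx R k T *m zcol j T) = (cross x i j k T + cross x j i k T) / 2.
Proof.
move=> sp.
have crossE a b : cross x a b k T =
    \sum_(s < T) (s + k < T)%N%:R * ((x s.+1 a / sT x a T) * (x (s + k).+1 b / sT x b T)).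
  rewrite (sum_narrow T k (fun s => (x s.+1 a / sT x a T) * (x (s + k).+1 b / sT x b T))).
  rewrite /cross big_add1/= big_mkord mulr_sumr; apply: eq_bigr => s _.
  by rewrite addSn; field; rewrite !gt_eqF.
rewrite !crossE; apply: (@dot_Cmx_form T k _ _ (fun t => x t.+1 i / sT x i T)
  (fun t => x t.+1 j / sT x j T)) => t; exact: zcolE.
Qed.

Lemma dot_zcol_cvg i j k :
  (fun T => dot (zcol i T) (Cmx R k T *m zcol j T)) @ \oo --> (rho x i j k + rho x j i k) / 2.
Proof.
have h : (fun T => (cross x i j k T + cross x j i k T) / 2) @ \oo --> (rho x i j k + rho x j i k) / 2.
  by apply: cvgM; [apply: cvgD; exact: G3|exact: cvg_cst].
apply: cvg_trans h; apply: near_eq_cvg; apply: filterS sT_pos_near => T sp.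
by rewrite dot_zcol_Cmx.
Qed.

Lemma rho_sym0 i j : rho x i j 0 = rho x j i 0.
Proof.
congr (limn _); apply/funext => T; rewrite /cross mulrC [RHS]mulrC; congr (_ * _).
  by apply: eq_bigr => t _; rewrite addn0 mulrC.
by rewrite mulrC.
Qed.

Lemma ZT_form T (K : 'M[R]_T) i j : ((ZT x T)^T *m K *m ZT x T) i j = dot (zcol i T) (K *m zcol j T).
Proof.
rewrite -dotE /zcol -mulmxA !mxE; apply: eq_bigr => s _; rewrite !mxE; congr (_ * _).
by apply: eq_bigr => t _; rewrite !mxE.
Qed.

Variable H : R -> 'M[R[i]]_d.
Hypothesis H_herm : forall w, - pi <= w <= pi -> conjT (H w) = H w.
Hypothesis H_psd : forall w1 w2, - pi <= w1 -> w1 <= w2 -> w2 <= pi ->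
  forall z : 'cV[R[i]]_d, 0 <= (conjT z *m (H w2 - H w1) *m z) ord0 ord0.
Hypothesis H_R : forall k : int, is_RSmx (fun w => expi (k%:~R * w)) H (cmx (Rmx x k)).

(** Averaging the integrals at [k] and [- k] cancels the sines, and [Rmx] at [- k] is the transpose
    of [Rmx] at [k]; for [k = 0] this is [rho_sym0]. *)
Lemma cos_RS i j (k : nat) : is_RS (fun w => (cos (k%:R * w))%:C) (fun w => H w i j) (- pi) pi
  ((rho x i j k + rho x j i k) / 2)%:C.
Proof.
have h := is_RS_scale (2^-1)%:C (is_RS_add (H_R k%:Z i j) (H_R (- k%:Z) i j)).
have -> : ((rho x i j k + rho x j i k) / 2)%:C =
    (2^-1)%:C * (cmx (Rmx x k) i j + cmx (Rmx x (- k%:Z)) i j).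
  rewrite !mxE -rmorphD -rmorphM mulrC; congr (_ * (_ + _))%:C.
  by case: k {h} => [|k] //; rewrite oppr0 rho_sym0.
have E : (fun w : R => (2^-1)%:C * (expi (k%:Z%:~R * w) + expi ((- k%:Z)%:~R * w))) =
   (fun w : R => (cos (k%:R * w))%:C).
  apply/funext => w; rewrite rmorphN mulNr /expi cosN sinN.
  apply/eqP; rewrite eq_complex/=; apply/andP; split; apply/eqP.
    by rewrite mul0r subr0; field.
  by rewrite mul0r addr0 subrr mulr0.
by rewrite -E.
Qed.

Lemma design_symbol_limit K phi : has_symbol K phi ->
  exists L : 'M[R]_d, mcvg (fun T => (ZT x T)^T *m K T *m ZT x T) L /\
    is_RSmx (fun w => (phi w)%:C) H (cmx L).
Proof.
move=> HK.
have h i j : exists v : R, (fun T => dot (zcol i T) (K T *m zcol j T)) @ \oo --> v /\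
    is_RS (fun w => (phi w)%:C) (fun w => H w i j) (- pi) pi v%:C.
  apply: (has_symbol_form (zcol_small i) (zcol_small j) _ _ _ HK).
  - by move=> k; exact: dot_zcol_cvg.
  - by move=> k; exact: cos_RS.
  - exact: increments_tv.
have [F HF] := @choice _ _ (fun (ij : 'I_d * 'I_d) v => _ /\ _) (fun ij => h ij.1 ij.2).
exists (\matrix_(i, j) F (i, j)); split => i j.
  rewrite mxE; under eq_fun do rewrite ZT_form; exact: (HF (i, j)).1.
by rewrite !mxE; exact: (HF (i, j)).2.
Qed.

Hypothesis G4 : Rmx x 0 \in unitmx.

(** $\mathbf{R}(0)$ is the limit of $\mathbf{Z}_T^\top\mathbf{Z}_T$, so the form of [L] dominates a
    positive multiple of its form. A vector killed by [L] is thus killed by $\mathbf{R}(0)$, which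
    is invertible. *)
Lemma gram_limit_unit K L : mcvg (fun T => (ZT x T)^T *m K T *m ZT x T) L ->
  (forall T, (K T)^T = K T) -> (exists2 k, 0 < k & forall T v, k * nsq v <= dot v (K T *m v)) ->
  L \in unitmx.
Proof.
move=> KL Ks [k k0 Kk].
have ZZ : mcvg (fun T => (ZT x T)^T *m 1%:M *m ZT x T) (Rmx x 0).
  move=> i j; rewrite mxE; have := @dot_zcol_cvg i j 0.
  rewrite -(rho_sym0 i j) (_ : (_ + _) / 2 = rho x i j 0); last by field.
  by under eq_fun do rewrite Cmx0 -ZT_form.
have ZK (T : nat) (A : 'M[R]_T) u : dot u ((ZT x T)^T *m A *m ZT x T *m u) = dot (ZT x T *m u) (A *m (ZT x T *m u)).
  by rewrite (dot_mulmx (ZT x T)) !mulmxA.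
have R0 (u : 'cV[R]_d) : 0 <= dot u (Rmx x 0 *m u).
  apply: (cvgr_to_ge (@mcvg_form _ _ _ _ u ZZ)); apply: nearW => T.
  by rewrite ZK mul1mx dotvv nsq_ge0.
have LR (u : 'cV[R]_d) : k * dot u (Rmx x 0 *m u) <= dot u (L *m u).
  have c1 : (fun T => k * dot u ((ZT x T)^T *m 1%:M *m ZT x T *m u)) @ \oo -->
      k * dot u (Rmx x 0 *m u) by apply: cvgZr; exact: (@mcvg_form _ _ _ _ u ZZ).
  apply: (ler_cvg_to c1 (@mcvg_form _ _ _ _ u KL)); apply: nearW => T.
  by rewrite !ZK mul1mx dotvv; exact: Kk.
have Rs : (Rmx x 0)^T = Rmx x 0 by apply/matrixP => i j; rewrite !mxE; exact: rho_sym0.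
apply: unitmx_ker => u Lu.
have u0 : dot u (Rmx x 0 *m u) = 0.
  apply/eqP; rewrite eq_le R0 andbT; have := LR u.
  by rewrite Lu -(dotE u 0) mulmx0 mxE pmulr_rle0.
have := psd_ker Rs R0 u0 => /(congr1 (mulmx (invmx (Rmx x 0)))).
by rewrite mulmxA mulVmx// mul1mx mulmx0.
Qed.

End Design.

(** * Taylor bounds for sine, cosine and exponential *)

Section TrigInequalities.
Variable R : realType.
Implicit Types x y : R.

Lemma sin_norm_le x : `|sin x| <= `|x|.
Proof.
wlog x0 : x / 0 <= x.
  move=> h; have [/h //|/ltW xn] := leP 0 x.
  by rewrite -normrN -sinN -[leRHS]normrN; apply: h; rewrite oppr_ge0.
have [c _] := @MVT_segment R sin cos 0 x x0 (fun t _ => is_derive_sin t)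
  (continuous_subspaceT (@continuous_sin R)).
rewrite sin0 !subr0 => ->; rewrite normrM ler_piMl//.
by rewrite ler_norml cos_geN1 cos_le1.
Qed.

Lemma cosE_half x : cos x = 1 - 2 * sin (x / 2) ^+ 2.
Proof.
have {1}-> : x = x / 2 + x / 2 by field.
rewrite cosD; have := cos2Dsin2 (x / 2); rewrite !expr2; lra.
Qed.

Lemma one_sub_cos x : 0 <= 1 - cos x <= x ^+ 2 / 2.
Proof.
rewrite cosE_half opprB addrC subrK mulr_ge0 ?sqr_ge0//=.
have : sin (x / 2) ^+ 2 <= (x / 2) ^+ 2.
  rewrite -real_normK ?num_real// -[leRHS]real_normK ?num_real//.
  by rewrite ler_pXn2r ?nnegrE// sin_norm_le.
by rewrite !expr2; lra.
Qed.

(** Cubic near the origin and quadratic elsewhere: the cubic bound will serve bounded values of the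
    summands, the quadratic one their tails. The cubic bound comes from the mean value theorem and
    [one_sub_cos]. *)
Lemma sin_sub_id x : `|sin x - x| <= x ^+ 2 * Num.min 1 `|x|.
Proof.
have cub : `|sin x - x| <= `|x| * (x ^+ 2 / 2).
  wlog x0 : x / 0 <= x.
    move=> h; have [/h //|/ltW xn] := leP 0 x.
    have := h (- x); rewrite oppr_ge0 => /(_ xn).
    by rewrite sinN opprK sqrrN (normrN x) -(normrN (- sin x + x)) opprD opprK.
  have [c /itvP cx] := @MVT_segment R sin cos 0 x x0 (fun t _ => is_derive_sin t)
    (continuous_subspaceT (@continuous_sin R)).
  rewrite sin0 !subr0 => ->.
  have -> : cos c * x - x = - (x * (1 - cos c)) by ring.
  rewrite normrN normrM ler_wpM2l//.
  have /andP[h1 h2] := one_sub_cos c.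
  rewrite ger0_norm// (le_trans h2)// ler_wpM2r ?invr_ge0//.
  by rewrite ler_pXn2r ?nnegrE ?cx.
have lin : `|sin x - x| <= 2 * `|x|.
  by rewrite (le_trans (ler_normB _ _))//; have := sin_norm_le x; lra.
have x2 : x ^+ 2 = `|x| ^+ 2 by rewrite real_normK ?num_real.
rewrite x2 in cub *; have n0 := normr_ge0 x; set n := `|x| in cub lin n0 *.
rewrite /Num.min; case: ltP => h.
  rewrite mulr1; have [n2|n2] := leP n 2; last by rewrite (le_trans lin)// expr2; nra.
  by rewrite (le_trans cub)//; nra.
by rewrite (le_trans cub)//; nra.
Qed.

Lemma cos_sub_quad x : `|cos x - (1 - x ^+ 2 / 2)| <= x ^+ 2 * Num.min 1 `|x|.
Proof.
have -> : cos x - (1 - x ^+ 2 / 2) = x ^+ 2 / 2 - (1 - cos x) by ring.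
have /andP[h1 h2] := one_sub_cos x.
rewrite ger0_norm ?subr_ge0//.
have x2 : x ^+ 2 = `|x| ^+ 2 by rewrite real_normK ?num_real.
rewrite /Num.min; case: ltP => h.
  by rewrite mulr1; have := sqr_ge0 x; lra.
have c1 : 1 - cos x = 2 * sin (x / 2) ^+ 2 by rewrite cosE_half; ring.
rewrite c1; set s := sin (x / 2).
(* The difference of squares reduces the cosine bound to the sine bound at [x / 2]. *)
have -> : x ^+ 2 / 2 - 2 * s ^+ 2 = 2 * ((x / 2 - s) * (x / 2 + s)) by field.
have h3 : `|x / 2 - s| <= (x / 2) ^+ 2.
  rewrite distrC (le_trans (sin_sub_id _))// ler_piMr ?sqr_ge0// ge_min lexx//.
have h4 : `|x / 2 + s| <= `|x|.
  rewrite (le_trans (ler_normD _ _))//; have := sin_norm_le (x / 2).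
  have -> : `|x / 2| = `|x| / 2 by rewrite normrM (@ger0_norm _ (2^-1)) ?invr_ge0.
  by rewrite -/s; lra.
have h5 := ler_pM (normr_ge0 _) (normr_ge0 _) h3 h4.
rewrite -normrM in h5; have h6 := ler_norm ((x / 2 - s) * (x / 2 + s)).
have := mulr_ge0 (sqr_ge0 x) (normr_ge0 x).
move: h5; rewrite expr_div_n => h5; lra.
Qed.

Lemma expN_sub_lin (u : R) : 0 <= u -> `|expR (- u) - (1 - u)| <= u ^+ 2.
Proof.
move=> u0; have h1 := expR_ge1Dx (- u).
rewrite ger0_norm; last by rewrite subr_ge0.
have h2 := expR_ge1Dx u; have u1 : 0 < 1 + u by rewrite ltr_wpDr.
have : expR (- u) <= (1 + u)^-1 by rewrite expRN lef_pV2// posrE expR_gt0.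
have : (1 + u)^-1 <= 1 - u + u ^+ 2.
  rewrite -[leLHS]mul1r ler_pdivrMr// -subr_ge0.
  have -> : (1 - u + u ^+ 2) * (1 + u) - 1 = u ^+ 3 by ring.
  exact: exprn_ge0.
lra.
Qed.

End TrigInequalities.

(** * Real-valued expectation and dominated convergence *)

Section RealExpectation.
Context (d : measure_display) (Om : measurableType d) (R : realType) (P : probability Om R).
Implicit Types X Y : Om -> R.

Definition Ex X : R := \int[P]_w X w.
Definition L1 X : Prop := P.-integrable setT (EFin \o X).

Lemma L1_meas X : L1 X -> measurable_fun setT X.
Proof. by move=> /measurable_int /measurable_EFinP. Qed.

Lemma L1_le X Y : measurable_fun setT X -> (forall w, `|X w| <= Y w) -> L1 Y -> L1 X.
Proof.
move=> mX XY iY; apply: le_integrable iY => //; first exact/measurable_EFinP.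
by move=> w _ /=; rewrite lee_fin (le_trans (XY w))// ler_norm.
Qed.

Lemma L1_bounded X C : measurable_fun setT X -> (forall w, `|X w| <= C) -> L1 X.
Proof.
move=> mX XC; apply: (@L1_le _ (cst C)) => //.
exact: finite_measure_integrable_cst.
Qed.

Lemma L1_cst c : L1 (fun=> c).
Proof. exact: finite_measure_integrable_cst. Qed.

Lemma L1D X Y : L1 X -> L1 Y -> L1 (fun w => X w + Y w).
Proof. by move=> iX iY; exact: (integrableD measurableT iX iY). Qed.

Lemma L1Z a X : L1 X -> L1 (fun w => a * X w).
Proof. by move=> iX; exact: (integrableZl measurableT a iX). Qed.

Lemma L1N X : L1 X -> L1 (fun w => - X w).
Proof. by move=> /(L1Z (-1)); under eq_fun do rewrite mulN1r. Qed.

Lemma L1_sum (I : Type) (s : seq I) (F : I -> Om -> R) :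
  (forall i, L1 (F i)) -> L1 (fun w => \sum_(i <- s) F i w).
Proof.
move=> iF; elim: s => [|i s IH].
  by under eq_fun do rewrite big_nil; exact: L1_cst.
by under eq_fun do rewrite big_cons; exact: L1D.
Qed.

Lemma Ex_cst c : Ex (fun=> c) = c.
Proof.
rewrite /Ex Rintegral_cst// -[RHS]mulr1; congr (_ * _).
transitivity (fine (1%E : \bar R)) => //; congr fine; exact: probability_setT.
Qed.

Lemma ExD X Y : L1 X -> L1 Y -> Ex (fun w => X w + Y w) = Ex X + Ex Y.
Proof. by move=> iX iY; exact: RintegralD. Qed.

Lemma ExZ a X : L1 X -> Ex (fun w => a * X w) = a * Ex X.
Proof. by move=> iX; exact: RintegralZl. Qed.

Lemma ExN X : L1 X -> Ex (fun w => - X w) = - Ex X.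
Proof. by move=> iX; rewrite -[RHS]mulN1r -ExZ//; under [in RHS]eq_fun do rewrite mulN1r. Qed.

Lemma ExB X Y : L1 X -> L1 Y -> Ex (fun w => X w - Y w) = Ex X - Ex Y.
Proof. by move=> iX iY; rewrite ExD ?ExN//; exact: L1N. Qed.

Lemma Ex_sum (I : Type) (s : seq I) (F : I -> Om -> R) : (forall i, L1 (F i)) ->
  Ex (fun w => \sum_(i <- s) F i w) = \sum_(i <- s) Ex (F i).
Proof.
move=> iF; elim: s => [|i s IH].
  by rewrite big_nil; under eq_fun do rewrite big_nil; exact: Ex_cst.
rewrite big_cons; under eq_fun do rewrite big_cons.
by rewrite ExD ?IH//; exact: L1_sum.
Qed.

Lemma Ex_le X Y : L1 X -> L1 Y -> (forall w, X w <= Y w) -> Ex X <= Ex Y.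
Proof. by move=> iX iY XY; apply: le_Rintegral. Qed.

Lemma Ex_ge0 X : (forall w, 0 <= X w) -> 0 <= Ex X.
Proof. by move=> X0; apply: Rintegral_ge0. Qed.

Lemma Ex_norm_le X Y : measurable_fun setT X -> L1 Y -> (forall w, `|X w| <= Y w) -> `|Ex X| <= Ex Y.
Proof.
move=> mX iY XY; have iX := L1_le mX XY iY.
rewrite (le_trans (le_normr_Rintegral _ _))//.
by apply: Ex_le => //; apply: L1_le iY; [exact: measurableT_comp|move=> w; rewrite normr_id].
Qed.

Lemma ExE X : L1 X -> ('E_P[X])%E = (Ex X)%:E.
Proof. by move=> iX; rewrite unlock /Ex /Rintegral fineK//; exact: integrable_fin_num. Qed.

Lemma Ex_ext X Y : (forall w, X w = Y w) -> Ex X = Ex Y.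
Proof. by move=> /funext ->. Qed.

Lemma Ex_sqr_le X : L1 X -> L1 (fun w => X w ^+ 2) -> Ex X ^+ 2 <= Ex (fun w => X w ^+ 2).
Proof.
move=> iX iX2; have := Ex_ge0 (fun w => sqr_ge0 (X w - Ex X)).
have -> : Ex (fun w => (X w - Ex X) ^+ 2) = Ex (fun w => X w ^+ 2 + (- (2 * Ex X) * X w + Ex X ^+ 2)).
  by apply: Ex_ext => w; ring.
rewrite ExD//; last by apply: L1D; [exact: L1Z|exact: L1_cst].
rewrite ExD; [|exact: L1Z|exact: L1_cst].
rewrite ExZ// Ex_cst => h; rewrite -subr_ge0 (le_trans h)//.
by rewrite le_eqVlt; apply/orP; left; apply/eqP; ring.
Qed.

(** The dominating function is extended-real because the one for the linear process is a supremum,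
    possibly infinite at some points. *)
Lemma Ex_dominated (X_ : nat -> Om -> R) X (D : Om -> \bar R) :
  (forall n, measurable_fun setT (X_ n)) -> measurable_fun setT X ->
  {ae P, forall w, X_ ^~ w @ \oo --> X w} ->
  P.-integrable setT D -> (forall n w, (`|X_ n w|%:E <= D w)%E) ->
  L1 X /\ (fun n => Ex (X_ n)) @ \oo --> Ex X.
Proof.
move=> mX_ mX XX iD XD.
have [] := @dominated_convergence _ _ _ P setT measurableT (fun n => EFin \o X_ n) (EFin \o X) D.
- by move=> n; exact/measurable_EFinP.
- exact/measurable_EFinP.
- by apply: filterS XX => w h _; apply: cvg_EFin h; exact: nearW.
- exact: iD.
- by apply: nearW => w n _; exact: XD.
move=> iX _ h; split => //.
rewrite /Ex /Rintegral; apply: fine_cvg; rewrite fineK//.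
exact: integrable_fin_num iX.
Qed.

Lemma Ex_bounded_cvg (X_ : nat -> Om -> R) X C :
  (forall n, measurable_fun setT (X_ n)) -> measurable_fun setT X ->
  {ae P, forall w, X_ ^~ w @ \oo --> X w} -> (forall n w, `|X_ n w| <= C) ->
  (fun n => Ex (X_ n)) @ \oo --> Ex X.
Proof.
move=> mX_ mX XX XC.
by have [] := @Ex_dominated X_ X (EFin \o cst C) mX_ mX XX (L1_cst C) (fun n w => XC n w).
Qed.

Lemma Ex_indic (A : set Om) : measurable A -> Ex (\1_A : Om -> R) = fine (P A).
Proof. by move=> mA; rewrite /Ex /Rintegral integral_indic// setIT. Qed.

End RealExpectation.

(** * From independent events to products of functions *)

Section Independence.
Context (dd : measure_display) (Om : measurableType dd) (R : realType) (P : probability Om R).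
Local Notation Ex := (Ex P).
Local Notation L1 := (L1 P).

(** The sum counts the positive integers up to [y], so it is the integer part. *)
Lemma sum_floor (y : R) (n : nat) : 0 <= y -> y <= n%:R ->
  `|y - \sum_(k < n) (k.+1%:R <= y)%R%:R| <= 1.
Proof.
move=> y0 yn.
have key m : let s := \sum_(k < m) (k.+1%:R <= y)%R%:R : R in
    s <= y /\ (y <= s + 1 \/ s = m%:R).
  elim: m => [|m /= [IH1 IH2]]; first by rewrite big_ord0; split => //; right.
  rewrite big_ord_recr/=; set s := \sum_(k < m) _ in IH1 IH2 *.
  case: (leP m.+1%:R y) => h; rewrite -natr1 in h *.
    case: IH2 => [h2|h2].
      have sm : s <= m%:R.
        by rewrite /s -[leRHS]mulr1 mulr_natl -[m in leRHS]card_ord -sumr_const; apply: ler_sum => k _; case: (_ <= y).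
      have E : s = m%:R by lra.
      by rewrite E; split => //; right.
    by rewrite h2; split => //; right.
  rewrite addr0; split => //; left; case: IH2 => // ->.
  exact: ltW.
have [/= h1 h2] := key n; rewrite ger0_norm ?subr_ge0// lerBlDl.
case: h2 => // h2; rewrite h2 (le_trans yn)// lerDl//.
Qed.

Definition bdd_meas (f : R -> R) : Prop := measurable_fun setT f /\ forall y, `|f y| <= 1.

(* If [F] is uncorrelated with all events of [X], it is uncorrelated with all bounded functions of [X]. *)
Lemma uncorrelated_ext (X F : Om -> R) (c : R) :
  measurable_fun setT X -> measurable_fun setT F -> (forall w, `|F w| <= 1) ->
  (forall B, measurable B -> Ex (fun w => \1_(X @^-1` B) w * F w) = fine (P (X @^-1` B)) * c) ->
  forall f, bdd_meas f -> Ex (fun w => f (X w) * F w) = Ex (f \o X) * c.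
Proof.
move=> mX mF F1 H f [mf f1].
have iF : L1 F by exact: L1_bounded mF F1.
have EF : Ex F = c.
  have := H setT measurableT; rewrite preimage_setT.
  have -> : fine (P setT) = 1 by transitivity (fine (1%E : \bar R)) => //; congr fine; exact: probability_setT.
  rewrite mul1r => <-; apply: Ex_ext => w.
  by rewrite indicE in_setT mul1r.
have mfX : measurable_fun setT (f \o X) by exact: measurableT_comp.
have ifX : L1 (f \o X) by apply: L1_bounded mfX _ => w; exact: f1.
have ifXF : L1 (fun w => f (X w) * F w).
  apply: (@L1_bounded _ _ _ _ _ 1); first exact: measurable_funM.
  by move=> w; rewrite normrM mulr_ile1.
have approx (n : nat) : (0 < n)%N ->
    `|Ex (fun w => f (X w) * F w) - Ex (f \o X) * c| <= 2 / n%:R + 2 / n%:R * `|c|.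
  move=> n0; have nR : 0 < n%:R :> R by rewrite ltr0n.
  (* Layers of [f] rescaled to [[0, n]]: the sum of their indicators is an integer part, so [S] is a
     combination of indicators within [2 / n] of [f]. *)
  pose B (k : nat) : set R := [set y | k.+1%:R <= n%:R * ((f y + 1) / 2)].
  have mB k : measurable (B k).
    rewrite -[B k]setTI; apply: measurable_fun_ler => //.
    apply: measurable_funM => //; apply: measurable_funM => //.
    exact: measurable_funD.
  pose S y : R := 2 / n%:R * (\sum_(k < n) \1_(B k) y) - 1.
  have Sf y : `|f y - S y| <= 2 / n%:R.
    pose z := n%:R * ((f y + 1) / 2).
    have := f1 y; rewrite ler_norml => /andP[h1 h2].
    have z0 : 0 <= z by rewrite mulr_ge0 ?(ltW nR)// divr_ge0// -lerBlDr sub0r.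
    have zn : z <= n%:R by rewrite ler_piMr ?(ltW nR)// ler_pdivrMr// mul1r; lra.
    have h3 := sum_floor z0 zn.
    have -> : f y - S y = 2 / n%:R * (z - \sum_(k < n) (k.+1%:R <= z)%R%:R).
      rewrite /S; have -> : \sum_(k < n) \1_(B k) y = \sum_(k < n) (k.+1%:R <= z)%R%:R :> R.
        apply: eq_bigr => k _; rewrite indicE; congr (_%:R); congr nat_of_bool.
        by apply/idP/idP => [/set_mem|h]; last exact/mem_set.
      by rewrite /z; field; rewrite gt_eqF.
    by rewrite normrM ger0_norm ?divr_ge0 ?(ltW nR)// ler_piMr// divr_ge0 ?(ltW nR).
  have mS : measurable_fun setT S.
    apply: measurable_funB => //; apply: measurable_funM => //.
    by apply: measurable_sum => k; exact: measurable_indic.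
  have iI k : L1 (fun w => \1_(X @^-1` B k) w).
    apply: (@L1_bounded _ _ _ _ _ 1).
      by apply: measurable_indic; rewrite -[_ @^-1` _]setTI; exact: mX.
    by move=> w; rewrite indicE; case: (_ \in _); rewrite ?normr1 ?normr0.
  have iIF k : L1 (fun w => \1_(X @^-1` B k) w * F w).
    apply: L1_bounded (_ : forall w, _ <= 1).
      apply: measurable_funM => //.
      by apply: measurable_indic; rewrite -[_ @^-1` _]setTI; exact: mX.
    by move=> w; rewrite normrM mulr_ile1// indicE; case: (_ \in _); rewrite ?normr1 ?normr0.
  have ES : Ex (fun w => S (X w) * F w) = Ex (S \o X) * c.
    have -> : Ex (fun w => S (X w) * F w) =
        Ex (fun w => 2 / n%:R * (\sum_(k < n) \1_(X @^-1` B k) w * F w) - F w).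
      apply: Ex_ext => w; rewrite [LHS]mulrBl mul1r; congr (_ - _); rewrite -[LHS]mulrA mulr_suml; congr (_ * _).
    rewrite ExB//; last by apply: L1Z; exact: L1_sum.
    rewrite ExZ; last exact: L1_sum.
    rewrite Ex_sum// EF.
    have -> : Ex (S \o X) = 2 / n%:R * (\sum_(k < n) fine (P (X @^-1` B k))) - 1.
      have -> : Ex (S \o X) = Ex (fun w => 2 / n%:R * (\sum_(k < n) \1_(X @^-1` B k) w) - 1).
        apply: Ex_ext => w; rewrite /S/=; congr (_ * _ - _).
      rewrite ExB ?Ex_cst; [|by apply: L1Z; exact: L1_sum|exact: L1_cst].
      rewrite ExZ; last exact: L1_sum.
      rewrite Ex_sum//; congr (_ * _ - _); apply: eq_bigr => k _.
      by rewrite Ex_indic// -[_ @^-1` _]setTI; exact: mX.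
    rewrite [RHS]mulrBl mul1r -[X in _ = X - _]mulrA mulr_suml; congr (_ * _ - _).
    by apply: eq_bigr => k _; rewrite H.
  have iSX : L1 (S \o X).
    apply: (@L1_bounded _ _ _ _ _ (1 + 2 / n%:R)); first exact: measurableT_comp.
    move=> w /=; have := ler_normB (f (X w)) (f (X w) - S (X w)).
    by rewrite opprB addrC subrK; have := Sf (X w); have := f1 (X w); lra.
  have iSXF : L1 (fun w => S (X w) * F w).
    apply: (@L1_bounded _ _ _ _ _ (1 + 2 / n%:R)).
      by apply: measurable_funM => //; exact: measurableT_comp.
    move=> w /=; rewrite normrM; have := ler_normB (f (X w)) (f (X w) - S (X w)).
    rewrite opprB addrC subrK => h1; have h2 := Sf (X w); have h3 := f1 (X w); have h4 := F1 w.
    have := normr_ge0 (F w); have := normr_ge0 (S (X w)).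
    by move=> h5 h6; rewrite (le_trans (ler_piMr h5 h4))//; lra.
  have e1 : `|Ex (fun w => f (X w) * F w) - Ex (fun w => S (X w) * F w)| <= 2 / n%:R.
    rewrite -ExB// -[leRHS](Ex_cst P); apply: Ex_norm_le; [|exact: L1_cst|].
      by apply: measurable_funB; [exact: (L1_meas ifXF)|exact: (L1_meas iSXF)].
    move=> w; rewrite -mulrBl normrM -[leRHS]mulr1 ler_pM//.
  have e2 : `|Ex (f \o X) - Ex (S \o X)| <= 2 / n%:R.
    rewrite -ExB// -[leRHS](Ex_cst P); apply: Ex_norm_le; [|exact: L1_cst|].
      by apply: measurable_funB; [exact: (L1_meas ifX)|exact: (L1_meas iSX)].
    by move=> w; exact: Sf.
  have -> : Ex (fun w => f (X w) * F w) - Ex (f \o X) * c =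
    (Ex (fun w => f (X w) * F w) - Ex (fun w => S (X w) * F w)) - (Ex (f \o X) - Ex (S \o X)) * c.
    by rewrite ES; ring.
  by rewrite (le_trans (ler_normB _ _))// lerD// normrM ler_wpM2r.
apply/eqP; rewrite -subr_eq0 -normr_le0; apply/ler_addgt0Pr => eps e0; rewrite add0r.
pose K := 2 + 2 * `|c|.
have K0 : 0 < K by rewrite ltr_wpDr// mulr_ge0.
pose n := (Num.truncn (K / eps)).+1.
have nb : K / eps < n%:R by exact: truncnS_gt.
apply: le_trans (approx n isT) _.
have -> : 2 / n%:R + 2 / n%:R * `|c| = K / n%:R by rewrite /K; field; rewrite gt_eqF.
by rewrite ler_pdivrMr// mulrC -ler_pdivrMr// ltW.
Qed.

Lemma bdd_meas_cos a : bdd_meas (fun y => cos (a * y)).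
Proof.
split; last by move=> y; rewrite ler_norml cos_geN1 cos_le1.
apply: measurableT_comp; last exact: measurable_funM.
by apply: continuous_measurable_fun; exact: continuous_cos.
Qed.

Lemma bdd_meas_sin a : bdd_meas (fun y => sin (a * y)).
Proof.
split; last by move=> y; rewrite ler_norml sin_geN1 sin_le1.
apply: measurableT_comp; last exact: measurable_funM.
by apply: continuous_measurable_fun; exact: continuous_sin.
Qed.

Context (I : eqType) (X : I -> Om -> R).
Hypothesis mX : forall i, measurable_fun setT (X i).
Hypothesis X_indep : mutually_independent P X.

Lemma prod_bdd (J : seq I) (g : I -> R -> R) : (forall i, bdd_meas (g i)) ->
  measurable_fun setT (fun w => \prod_(j <- J) g j (X j w)) /\
  forall w, `|\prod_(j <- J) g j (X j w)| <= 1.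
Proof.
move=> gb; split.
  apply: measurable_prod => i _; have [mg _] := gb i; exact: measurableT_comp.
move=> w; rewrite normr_prod; elim: J => [|j J IH]; first by rewrite big_nil.
by rewrite big_cons mulr_ile1// ?prodr_ge0//; have [_ g1] := gb j.
Qed.

(** Indices are moved one at a time from events to functions: the induction carries functions on
    [J1] and indicators on [J2], and [uncorrelated_ext] turns an arbitrary event of [X j] into
    [g j]. *)
Lemma indep_prod (J : seq I) (g : I -> R -> R) : uniq J -> (forall i, bdd_meas (g i)) ->
  Ex (fun w => \prod_(j <- J) g j (X j w)) = \prod_(j <- J) Ex (g j \o X j).
Proof.
move=> uJ gb.
have ind_bdd (B : I -> set R) : (forall i, measurable (B i)) -> forall i, bdd_meas (\1_(B i) : R -> R).
  move=> mB i; split; first exact: measurable_indic.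
  by move=> y; rewrite indicE; case: (_ \in _); rewrite ?normr1 ?normr0.
suff key (J1 J2 : seq I) (B : I -> set R) : uniq (J1 ++ J2) -> (forall i, measurable (B i)) ->
    Ex (fun w => (\prod_(j <- J1) g j (X j w)) * \prod_(j <- J2) \1_(B j) (X j w)) =
    (\prod_(j <- J1) Ex (g j \o X j)) * \prod_(j <- J2) fine (P (X j @^-1` B j)).
  have := key J [::] (fun=> setT); rewrite cats0 => /(_ uJ (fun=> measurableT)).
  by rewrite big_nil mulr1 => <-; apply: Ex_ext => w; rewrite big_nil mulr1.
elim: J1 J2 B {J uJ} => [|j J1 IH] J2 B uJ mB.
  rewrite big_nil mul1r.
  transitivity (Ex (\1_(\bigcap_(j in [set` J2]) (X j @^-1` B j)))).
    apply: Ex_ext => w; rewrite big_nil mul1r indicE {uJ}.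
    elim: J2 => [|j J2 IH].
      by rewrite big_nil mem_set// => i /=; rewrite inE.
    rewrite big_cons {}IH indicE -natrM mulnb; congr (_%:R); congr nat_of_bool.
    apply/idP/idP => [/andP[/set_mem h1 /set_mem h2]|/set_mem h].
      apply/mem_set => i /=; rewrite inE => /orP[/eqP -> //|iJ]; exact: h2.
    apply/andP; split; apply/mem_set; first by apply: h => /=; rewrite inE eqxx.
    by move=> i /= iJ; apply: h => /=; rewrite inE iJ orbT.
  rewrite Ex_indic; last first.
    by apply: fin_bigcap_measurable => [|i _]; [exact: finite_seq|rewrite -[_ @^-1` _]setTI; exact: mX].
  rewrite X_indep//.
  suff -> : (\prod_(j <- J2) P (X j @^-1` B j))%E = (\prod_(j <- J2) fine (P (X j @^-1` B j)))%:E by [].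
  elim: J2 {uJ} => [|j J2 IH]; first by rewrite !big_nil.
  rewrite !big_cons IH EFinM fineK// fin_num_measure// -[_ @^-1` _]setTI; exact: mX.
have jJ : j \notin J1 ++ J2 by move: uJ => /= /andP[].
have uJ' : uniq (J1 ++ J2) by move: uJ => /= /andP[].
have uJ'' : uniq (J1 ++ j :: J2) by rewrite uniq_catC /= uniq_catC uJ' mem_cat orbC -mem_cat jJ.
pose F w := (\prod_(j <- J1) g j (X j w)) * \prod_(j <- J2) \1_(B j) (X j w) : R.
have [m1 b1] := prod_bdd J1 gb; have [m2 b2] := prod_bdd J2 (ind_bdd B mB).
have mF : measurable_fun setT F by exact: measurable_funM.
have F1 w : `|F w| <= 1 by rewrite normrM mulr_ile1.
pose c := (\prod_(j <- J1) Ex (g j \o X j)) * \prod_(j <- J2) fine (P (X j @^-1` B j)).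
have H A : measurable A -> Ex (fun w => \1_(X j @^-1` A) w * F w) = fine (P (X j @^-1` A)) * c.
  move=> mA; pose B' i := if i == j then A else B i.
  have mB' i : measurable (B' i) by rewrite /B'; case: ifP.
  have := IH (j :: J2) B' uJ'' mB'.
  have E i : i \in J2 -> B' i = B i.
    move=> iJ; rewrite /B'; case: eqP => // ij; move: jJ; rewrite mem_cat -ij iJ orbT//.
  rewrite big_cons {2}/B' eqxx => H1; rewrite /c mulrCA.
  rewrite (_ : \prod_(j0 <- J2) fine (P (X j0 @^-1` B j0)) = \prod_(j0 <- J2) fine (P (X j0 @^-1` B' j0))); last first.
    by apply: eq_big_seq => i iJ; rewrite E.
  rewrite -H1; apply: Ex_ext => w; rewrite big_cons {1}/B' eqxx [RHS]mulrCA /F; congr (_ * (_ * _)).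
  by apply: eq_big_seq => i iJ; rewrite E.
have := uncorrelated_ext (mX j) mF F1 H (gb j).
rewrite big_cons -mulrA -/c => <-; apply: Ex_ext => w.
by rewrite big_cons /F mulrA.
Qed.

(** The product rule is available for functions bounded by 1, so the variables are truncated at
    [n.+1] and rescaled. The truncation is removed by dominated convergence under the sum of the two
    squares. *)
Lemma indep_uncorrelated (i j : I) : i != j ->
  L1 (fun w => X i w ^+ 2) -> L1 (fun w => X j w ^+ 2) ->
  L1 (fun w => X i w * X j w) /\ Ex (fun w => X i w * X j w) = Ex (X i) * Ex (X j).
Proof.
move=> ij i2 j2.
pose tr (n : nat) (y : R) : R := y * \1_[set z : R | `|z| <= n.+1%:R] y.
have mtr n : measurable_fun setT (tr n).
  apply: measurable_funM => //; apply: measurable_indic.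
  rewrite -[[set z | _]]setTI; apply: measurable_fun_ler => //.
have trn n y : `|tr n y| <= n.+1%:R /\ `|tr n y| <= `|y|.
  rewrite /tr indicE; case: (boolP (_ \in _)) => [/set_mem /= h|_].
    by rewrite mulr1.
  by rewrite mulr0 normr0.
have trc y : tr ^~ y @ \oo --> y.
  apply: cvg_near_cst.
  exists (Num.truncn `|y|) => // n /= h; rewrite /tr indicE mem_set ?mulr1//=.
  rewrite ltW// (lt_le_trans (truncnS_gt _))// ler_nat ltnS//.
have key n : Ex (fun w => tr n (X i w) * tr n (X j w)) = Ex (tr n \o X i) * Ex (tr n \o X j).
  pose g y := n.+1%:R^-1 * tr n y.
  have gb : forall k : I, bdd_meas g.
    move=> _; split; first exact: measurable_funM.
    move=> y; rewrite normrM ger0_norm ?invr_ge0// ler_pdivrMl// mulr1.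
    by have [] := trn n y.
  have := @indep_prod [:: i; j] (fun=> g); rewrite /= inE ij => /(_ isT gb).
  have itr k : L1 (tr n \o X k).
    by apply: (@L1_bounded _ _ _ _ _ n.+1%:R) => [|w]; [exact: measurableT_comp|have [] := trn n (X k w)].
  have itr2 : L1 (fun w => tr n (X i w) * tr n (X j w)).
    apply: (@L1_bounded _ _ _ _ _ (n.+1%:R * n.+1%:R)) => [|w].
      by apply: measurable_funM; exact: measurableT_comp.
    by rewrite normrM ler_pM//; have [] := trn n (X i w); have [] := trn n (X j w).
  have Eg k : Ex (g \o X k) = n.+1%:R^-1 * Ex (tr n \o X k) by rewrite -ExZ.
  rewrite !big_cons big_nil mulr1 !Eg.
  have -> : Ex (fun w => \prod_(j0 <- [:: i; j]) g (X j0 w)) =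
      n.+1%:R^-1 ^+ 2 * Ex (fun w => tr n (X i w) * tr n (X j w)).
    by rewrite -ExZ//; apply: Ex_ext => w; rewrite !big_cons big_nil /g; ring.
  move=> h; have n0 : n.+1%:R^-1 ^+ 2 != 0 :> R by rewrite expf_neq0// invr_eq0 pnatr_eq0.
  by apply: (mulfI n0); rewrite h; ring.
have mtX n k : measurable_fun setT (tr n \o X k) by exact: measurableT_comp.
have iXX : L1 (fun w => X i w ^+ 2 + X j w ^+ 2) by exact: L1D.
have amgm (x y : R) : `|x| * `|y| <= x ^+ 2 + y ^+ 2.
  rewrite -(real_normK (num_real x)) -(real_normK (num_real y)).
  have := sqr_ge0 (`|x| - `|y|); have := sqr_ge0 `|x|; have := sqr_ge0 `|y|; rewrite !expr2; nra.
have [h1 h2] : L1 (fun w => X i w * X j w) /\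
    (fun n => Ex (fun w => tr n (X i w) * tr n (X j w))) @ \oo --> Ex (fun w => X i w * X j w).
  apply: (@Ex_dominated _ _ _ _ _ _ _ _ _ _ iXX).
  - by move=> n; apply: measurable_funM; exact: mtX.
  - exact: measurable_funM.
  - by apply: nearW => w; apply: cvgM; exact: trc.
  - move=> n w; rewrite lee_fin normrM (le_trans _ (amgm (X i w) (X j w)))//.
    by rewrite ler_pM//; have [] := trn n (X i w); have [] := trn n (X j w).
have single k : L1 (fun w => X k w ^+ 2) -> (fun n => Ex (tr n \o X k)) @ \oo --> Ex (X k).
  move=> k2; have i1 : L1 (fun w => 1 + X k w ^+ 2) by apply: L1D => //; exact: L1_cst.
  have [] // := @Ex_dominated _ _ _ P (fun n => tr n \o X k) (X k) _ _ _ _ i1.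
  - by apply: nearW => w; exact: trc.
  - move=> n w; rewrite lee_fin /=.
    have [_ h] := trn n (X k w); rewrite (le_trans h)//.
    rewrite -(real_normK (num_real (X k w))).
    have := sqr_ge0 (`|X k w| - 1); have := normr_ge0 (X k w); rewrite !expr2; nra.
split => //.
have h3 : (fun n => Ex (fun w => tr n (X i w) * tr n (X j w))) @ \oo --> Ex (X i) * Ex (X j).
  rewrite (_ : (fun n => _) = (fun n => Ex (tr n \o X i) * Ex (tr n \o X j))).
    by apply: cvgM; exact: single.
  by apply/funext => n; exact: key.
exact: cvg_unique h2 h3.
Qed.

End Independence.

(** * Characteristic functions and a finite Lindeberg estimate *)

Section CharacteristicFunction.
Context (dd : measure_display) (Om : measurableType dd) (R : realType) (P : probability Om R).
Local Notation Ex := (Ex P).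
Local Notation L1 := (L1 P).
Implicit Types Y : Om -> R.

Lemma L1_of_sqr Y : measurable_fun setT Y -> L1 (fun w => Y w ^+ 2) -> L1 Y.
Proof.
move=> mY Y2; apply: (L1_le mY (_ : forall w, _ <= 1 + Y w ^+ 2)); last by apply: L1D => //; exact: L1_cst.
move=> w; rewrite -(real_normK (num_real (Y w))).
have := sqr_ge0 (`|Y w| - 1); have := normr_ge0 (Y w); rewrite !expr2; nra.
Qed.

Lemma measurable_cos Y : measurable_fun setT Y -> measurable_fun setT (fun w => cos (Y w)).
Proof.
move=> mY; apply: measurableT_comp mY.
by apply: continuous_measurable_fun; exact: continuous_cos.
Qed.

Lemma measurable_sin Y : measurable_fun setT Y -> measurable_fun setT (fun w => sin (Y w)).
Proof.
move=> mY; apply: measurableT_comp mY.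
by apply: continuous_measurable_fun; exact: continuous_sin.
Qed.

Lemma cos_norm_le1 (y : R) : `|cos y| <= 1.
Proof. by rewrite ler_norml cos_geN1 cos_le1. Qed.

Lemma sin_norm_le1 (y : R) : `|sin y| <= 1.
Proof. by rewrite ler_norml sin_geN1 sin_le1. Qed.

Lemma L1_cos Y : measurable_fun setT Y -> L1 (fun w => cos (Y w)).
Proof.
by move=> mY; apply: (@L1_bounded _ _ _ _ _ 1 (measurable_cos mY)) => w; exact: cos_norm_le1.
Qed.

Lemma L1_sin Y : measurable_fun setT Y -> L1 (fun w => sin (Y w)).
Proof.
by move=> mY; apply: (@L1_bounded _ _ _ _ _ 1 (measurable_sin mY)) => w; exact: sin_norm_le1.
Qed.

Definition ch Y : R[i] := Ex (fun w => cos (Y w)) +i* Ex (fun w => sin (Y w)).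

(** Jensen's inequality for both parts, together with $\cos^2+\sin^2=1$. *)
Lemma ch_le1 Y : measurable_fun setT Y -> `|ch Y| <= 1.
Proof.
move=> mY; have ic := L1_cos mY; have is_ := L1_sin mY.
have ic2 : L1 (fun w => cos (Y w) ^+ 2).
  apply: (@L1_bounded _ _ _ _ _ 1); first by apply: measurable_funX; exact: measurable_cos.
  by move=> w; rewrite normrX exprn_ile1// cos_norm_le1.
have is2 : L1 (fun w => sin (Y w) ^+ 2).
  apply: (@L1_bounded _ _ _ _ _ 1); first by apply: measurable_funX; exact: measurable_sin.
  by move=> w; rewrite normrX exprn_ile1// sin_norm_le1.
have h1 := Ex_sqr_le ic ic2; have h2 := Ex_sqr_le is_ is2.
have h3 : Ex (fun w => cos (Y w) ^+ 2) + Ex (fun w => sin (Y w) ^+ 2) = 1.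
  by rewrite -ExD// -[RHS](Ex_cst P); apply: Ex_ext => w; rewrite cos2Dsin2.
rewrite normc_def lecE/= eqxx/= -[leRHS]sqrtr1 ler_wsqrtr//; lra.
Qed.

Lemma complex_bound (a b c : R) : `|a| <= c -> `|b| <= c -> `|a +i* b| <= (2 * c)%:C.
Proof.
move=> ac bc; have c0 : 0 <= c by exact: le_trans ac.
rewrite normc_def lecR/= -(ger0_norm (mulr_ge0 (ler0n _ 2) c0)) -sqrtr_sqr ler_wsqrtr//.
rewrite -(real_normK (num_real a)) -(real_normK (num_real b)).
have := normr_ge0 a; have := normr_ge0 b; nra.
Qed.

(** In the Taylor error, values of [Y] up to [delta] contribute [|a| * delta * s] and larger ones
    [t], both times [a ^+ 2]. The factor 2 adds real and imaginary parts, and the last square is the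
    cost of replacing [1 - u] by [expR (- u)]. *)
Lemma ch_term Y (s delta t a : R) : measurable_fun setT Y -> L1 (fun w => Y w ^+ 2) ->
  Ex Y = 0 -> Ex (fun w => Y w ^+ 2) = s -> 0 <= delta ->
  Ex (fun w => Y w ^+ 2 * \1_[set w | delta < `|Y w|] w) <= t ->
  `|ch (fun w => a * Y w) - (expR (- (a ^+ 2 * s / 2)))%:C| <=
    (a ^+ 2 * (2 * (`|a| * delta * s + t)) + (a ^+ 2 * s / 2) ^+ 2)%:C.
Proof.
move=> mY Y2 EY EY2 d0 tl.
have iY := L1_of_sqr mY Y2.
have maY : measurable_fun setT (fun w => a * Y w) by exact: measurable_funM.
have mset : measurable [set w | delta < `|Y w|].
  rewrite -[[set w | _]]setTI; apply: measurable_fun_ltr => //; exact: measurableT_comp.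
have mtail : measurable_fun setT (fun w => Y w ^+ 2 * \1_[set w | delta < `|Y w|] w).
  by apply: measurable_funM; [exact: measurable_funX|exact: measurable_indic].
have itail : L1 (fun w => Y w ^+ 2 * \1_[set w | delta < `|Y w|] w).
  apply: L1_le mtail _ Y2 => w; rewrite normrM ger0_norm ?sqr_ge0// ler_piMr ?sqr_ge0//.
  by rewrite indicE; case: (_ \in _); rewrite ?normr1 ?normr0.
pose D w := a ^+ 2 * (`|a| * delta * Y w ^+ 2 + Y w ^+ 2 * \1_[set w | delta < `|Y w|] w).
have iD : L1 D by apply: L1Z; apply: L1D => //; exact: L1Z.
have ED : Ex D <= a ^+ 2 * (`|a| * delta * s + t).
  rewrite /D ExZ; last by apply: L1D => //; exact: L1Z.
  rewrite ExD//; last exact: L1Z.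
  by rewrite ExZ// EY2 ler_wpM2l ?sqr_ge0// lerD2l.
have minD w : (a * Y w) ^+ 2 * Num.min 1 `|a * Y w| <= D w.
  have -> : (a * Y w) ^+ 2 * Num.min 1 `|a * Y w| = a ^+ 2 * (Y w ^+ 2 * Num.min 1 `|a * Y w|).
    by rewrite exprMn mulrA.
  rewrite /D ler_wpM2l ?sqr_ge0// indicE.
  case: (boolP (w \in _)) => [_|/negP h].
    have k1 : 0 <= `|a| * delta * Y w ^+ 2 by rewrite mulr_ge0 ?sqr_ge0// mulr_ge0.
    have k2 : Y w ^+ 2 * Num.min 1 `|a * Y w| <= Y w ^+ 2.
      by rewrite ler_piMr ?sqr_ge0// ge_min lexx.
    by rewrite mulr1 (le_trans k2)// lerDr.
  have {}h : `|Y w| <= delta.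
    by rewrite leNgt; apply/negP => h'; apply: h; exact/mem_set.
  rewrite mulr0 addr0 mulrC ler_wpM2r ?sqr_ge0// ge_min; apply/orP; right.
  by rewrite normrM ler_wpM2l.
have hc : `|Ex (fun w => cos (a * Y w)) - (1 - a ^+ 2 * s / 2)| <= a ^+ 2 * (`|a| * delta * s + t).
  have -> : Ex (fun w => cos (a * Y w)) - (1 - a ^+ 2 * s / 2) =
      Ex (fun w => cos (a * Y w) - (1 + (- (a ^+ 2 / 2)) * Y w ^+ 2)).
    rewrite ExB; [|exact: L1_cos|by apply: L1D; [exact: L1_cst|exact: L1Z]].
    by rewrite ExD; [rewrite Ex_cst ExZ// EY2; ring|exact: L1_cst|exact: L1Z].
  rewrite (le_trans _ ED)//; apply: Ex_norm_le iD _.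
    apply: measurable_funB; first exact: measurable_cos.
    by apply: measurable_funD => //; apply: measurable_funM => //; exact: measurable_funX.
  move=> w; rewrite (le_trans _ (minD w))//.
  have -> : cos (a * Y w) - (1 + - (a ^+ 2 / 2) * Y w ^+ 2) = cos (a * Y w) - (1 - (a * Y w) ^+ 2 / 2).
    by ring.
  exact: cos_sub_quad.
have hs : `|Ex (fun w => sin (a * Y w))| <= a ^+ 2 * (`|a| * delta * s + t).
  have -> : Ex (fun w => sin (a * Y w)) = Ex (fun w => sin (a * Y w) - a * Y w).
    by rewrite ExB; [rewrite ExZ// EY mulr0 subr0|exact: L1_sin|exact: L1Z].
  rewrite (le_trans _ ED)//; apply: Ex_norm_le iD _.
    by apply: measurable_funB => //; exact: measurable_sin.
  by move=> w; rewrite (le_trans _ (minD w))// sin_sub_id.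
have s0 : 0 <= s by rewrite -EY2; apply: Ex_ge0 => w; exact: sqr_ge0.
have u0 : 0 <= a ^+ 2 * s / 2 by rewrite divr_ge0// mulr_ge0// sqr_ge0.
have -> : ch (fun w => a * Y w) - (expR (- (a ^+ 2 * s / 2)))%:C =
   ((Ex (fun w => cos (a * Y w)) - (1 - a ^+ 2 * s / 2)) +i* Ex (fun w => sin (a * Y w)))
   - (expR (- (a ^+ 2 * s / 2)) - (1 - a ^+ 2 * s / 2))%:C.
  by rewrite /ch; apply/eqP; rewrite eq_complex/=; apply/andP; split; apply/eqP; ring.
rewrite [leRHS]rmorphD (le_trans (ler_normB _ _))// lerD//.
  by rewrite mulrCA; exact: complex_bound.
by rewrite normC_real lecR expN_sub_lin.
Qed.

(** The factors are exchanged one by one; the remaining ones lie in the unit disc. *)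
Lemma prod_sub_le (J : Type) (r : seq J) (z y : J -> R[i]) :
  (forall j, `|z j| <= 1) -> (forall j, `|y j| <= 1) ->
  `|\prod_(j <- r) z j - \prod_(j <- r) y j| <= \sum_(j <- r) `|z j - y j|.
Proof.
move=> z1 y1; elim: r => [|j r IH]; first by rewrite !big_nil subrr normr0.
rewrite !big_cons.
have -> : z j * \prod_(i <- r) z i - y j * \prod_(i <- r) y i =
  (z j - y j) * \prod_(i <- r) z i + y j * (\prod_(i <- r) z i - \prod_(i <- r) y i) by ring.
rewrite (le_trans (ler_normD _ _))// lerD// normrM.
  rewrite ler_piMr// normr_prod; elim: r {IH} => [|i r IH]; first by rewrite big_nil.
  by rewrite big_cons mulr_ile1// prodr_ge0.
by rewrite (le_trans _ IH)// ler_piMl.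
Qed.

Context (I : eqType) (X : I -> Om -> R).
Hypothesis mX : forall i, measurable_fun setT (X i).
Hypothesis X_indep : mutually_independent P X.

Lemma measurable_lin (J : seq I) (a : I -> R) :
  measurable_fun setT (fun w => \sum_(j <- J) a j * X j w).
Proof. by apply: measurable_sum => j; exact: measurable_funM. Qed.

(* The induction carries along bounded factors [g j (X j)] so that independence of cosines and
   sines is used only through products of one-variable functions. *)
Lemma ch_sum (J : seq I) (a : I -> R) : uniq J ->
  ch (fun w => \sum_(j <- J) a j * X j w) = \prod_(j <- J) ch (fun w => a j * X j w).
Proof.
move=> uJ.
suff key (J1 J2 : seq I) (g : I -> R -> R) : uniq (J1 ++ J2) -> (forall i, bdd_meas (g i)) ->
    Ex (fun w => cos (\sum_(j <- J1) a j * X j w) * \prod_(j <- J2) g j (X j w)) +i*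
    Ex (fun w => sin (\sum_(j <- J1) a j * X j w) * \prod_(j <- J2) g j (X j w)) =
    (\prod_(j <- J1) ch (fun w => a j * X j w)) * (\prod_(j <- J2) Ex (g j \o X j))%:C.
  have := key J [::] (fun _ _ => 1); rewrite cats0 => /(_ uJ).
  have b1 : I -> bdd_meas (fun _ : R => 1 : R) by move=> _; split => // y; rewrite normr1.
  move=> /(_ b1); rewrite !big_nil => H0; rewrite -[RHS]mulr1; refine (etrans _ H0).
  by rewrite /ch; congr (_ +i* _); apply: Ex_ext => w; rewrite mulr1.
elim: J1 J2 g {J uJ} => [|j J1 IH] J2 g uJ gb.
  rewrite big_nil mul1r -(indep_prod mX X_indep uJ gb).
  rewrite /real_complex_def; congr (_ +i* _).
    by apply: Ex_ext => w; rewrite big_nil cos0 mul1r.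
  by rewrite -[RHS](Ex_cst P); apply: Ex_ext => w; rewrite big_nil sin0 mul0r.
have jJ : j \notin J1 ++ J2 by move: uJ => /= /andP[].
have uJ' : uniq (J1 ++ J2) by move: uJ => /= /andP[].
have uJ'' : uniq (J1 ++ j :: J2) by rewrite uniq_catC /= uniq_catC uJ' mem_cat orbC -mem_cat jJ.
pose G w : R := \prod_(j <- J2) g j (X j w).
pose S w : R := \sum_(j <- J1) a j * X j w.
have [mG G1] := prod_bdd mX J2 gb; rewrite -/G in mG G1.
have mS : measurable_fun setT S by exact: measurable_lin.
have step f : bdd_meas f ->
    Ex (fun w => cos (S w) * (f (X j w) * G w)) +i* Ex (fun w => sin (S w) * (f (X j w) * G w)) =
    (\prod_(i <- J1) ch (fun w => a i * X i w)) * (Ex (f \o X j) * \prod_(i <- J2) Ex (g i \o X i))%:C.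
  move=> fb; pose g' i := if i == j then f else g i.
  have gb' i : bdd_meas (g' i) by rewrite /g'; case: ifP.
  have E i : i \in J2 -> g' i = g i.
    move=> iJ; rewrite /g'; case: eqP => // ij; move: jJ; rewrite mem_cat -ij iJ orbT//.
  have := IH (j :: J2) g' uJ'' gb'.
  have -> : \prod_(i <- j :: J2) Ex (g' i \o X i) = Ex (f \o X j) * \prod_(i <- J2) Ex (g i \o X i).
    by rewrite big_cons {1}/g' eqxx; congr (_ * _); apply: eq_big_seq => i iJ; rewrite E.
  have EG w : \prod_(i <- j :: J2) g' i (X i w) = f (X j w) * G w.
    rewrite big_cons {1}/g' eqxx; congr (_ * _); apply: eq_big_seq => i iJ; rewrite E//.
  move=> <-; congr (_ +i* _); apply: Ex_ext => w; rewrite EG//.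
have hc := step _ (bdd_meas_cos (a j)); have hs := step _ (bdd_meas_sin (a j)).
have i1 (u v : Om -> R) : measurable_fun setT u -> measurable_fun setT v ->
   (forall w, `|u w| <= 1) -> (forall w, `|v w| <= 1) -> L1 (fun w => u w * (v w * G w)).
  move=> mu mv u1 v1; apply: (@L1_bounded _ _ _ _ _ 1).
    by apply: measurable_funM => //; exact: measurable_funM.
  move=> w; rewrite !normrM; have a3 : `|G w| <= 1 := G1 w.
  by apply: mulr_ile1 => //; rewrite -normrM normrM mulr_ile1.
have maX : measurable_fun setT (fun w => a j * X j w) by exact: measurable_funM.
have icc : L1 (fun w => cos (S w) * (cos (a j * X j w) * G w)).
  by apply: i1 => [||w|w]; [exact: measurable_cos|exact: measurable_cos|exact: cos_norm_le1|exact: cos_norm_le1].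
have iss : L1 (fun w => sin (S w) * (sin (a j * X j w) * G w)).
  by apply: i1 => [||w|w]; [exact: measurable_sin|exact: measurable_sin|exact: sin_norm_le1|exact: sin_norm_le1].
have ics : L1 (fun w => cos (S w) * (sin (a j * X j w) * G w)).
  by apply: i1 => [||w|w]; [exact: measurable_cos|exact: measurable_sin|exact: cos_norm_le1|exact: sin_norm_le1].
have isc : L1 (fun w => sin (S w) * (cos (a j * X j w) * G w)).
  by apply: i1 => [||w|w]; [exact: measurable_sin|exact: measurable_cos|exact: sin_norm_le1|exact: cos_norm_le1].
have -> : Ex (fun w => cos (\sum_(j <- j :: J1) a j * X j w) * \prod_(j <- J2) g j (X j w)) =
    Ex (fun w => cos (S w) * (cos (a j * X j w) * G w)) - Ex (fun w => sin (S w) * (sin (a j * X j w) * G w)).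
  by rewrite -ExB//; apply: Ex_ext => w; rewrite big_cons cosD -/(S w) -/(G w); ring.
have -> : Ex (fun w => sin (\sum_(j <- j :: J1) a j * X j w) * \prod_(j <- J2) g j (X j w)) =
    Ex (fun w => cos (S w) * (sin (a j * X j w) * G w)) + Ex (fun w => sin (S w) * (cos (a j * X j w) * G w)).
  by rewrite -ExD//; apply: Ex_ext => w; rewrite big_cons sinD -/(S w) -/(G w); ring.
set A1 := Ex _ in hc *; set B1 := Ex (fun w => sin (S w) * (cos _ * _)) in hc *.
set A2 := Ex (fun w => cos (S w) * (sin _ * _)) in hs *; set B2 := Ex (fun w => sin (S w) * (sin _ * _)) in hs *.
have -> : (A1 - B2) +i* (A2 + B1) = (A1 +i* B1) + 'i * (A2 +i* B2).
  by apply/eqP; rewrite eq_complex/=; apply/andP; split; apply/eqP; ring.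
rewrite hc hs big_cons.
have -> : ch (fun w => a j * X j w) = (Ex (fun w => cos (a j * X j w)))%:C + 'i * (Ex (fun w => sin (a j * X j w)))%:C.
  by apply/eqP; rewrite eq_complex/=; apply/andP; split; apply/eqP; rewrite ?mul0r ?mul1r; ring.
rewrite !rmorphM/= /comp; ring.
Qed.

(** The Gaussian factor splits over [j] like the characteristic function, and the errors of
    [ch_term], each proportional to [a j ^+ 2], add up to a multiple of [v]. The number of summands
    does not appear in the bound. *)
Lemma lindeberg_finite (J : seq I) (a : I -> R) (s delta l m : R) : uniq J ->
  (forall i, L1 (fun w => X i w ^+ 2)) -> (forall i, Ex (X i) = 0) ->
  (forall i, Ex (fun w => X i w ^+ 2) = s) -> 0 <= delta -> 0 <= l ->
  (forall i, Ex (fun w => X i w ^+ 2 * \1_[set w | delta < `|X i w|] w) <= s * l) ->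
  0 <= m -> (forall j, `|a j| <= m) ->
  forall v, v = s * \sum_(j <- J) a j ^+ 2 ->
  `|ch (fun w => \sum_(j <- J) a j * X j w) - (expR (- (v / 2)))%:C| <=
    (v * (2 * (m * delta + l) + m ^+ 2 * s))%:C.
Proof.
move=> uJ X2 EX EX2 d0 l0 tl m0 am v vE.
have s0 (i : I) : 0 <= s by rewrite -(EX2 i); apply: Ex_ge0 => w; exact: sqr_ge0.
have -> : (expR (- (v / 2)))%:C = \prod_(j <- J) (expR (- (a j ^+ 2 * s / 2)))%:C.
  rewrite -rmorph_prod -expR_sum; congr ((expR _)%:C).
  rewrite vE mulr_sumr mulr_suml -sumrN; apply: eq_bigr => j _; ring.
rewrite ch_sum// (le_trans (prod_sub_le _ _ _))//.
- by move=> j; apply: ch_le1; exact: measurable_funM.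
- move=> j; rewrite normC_real lecR ger0_norm ?expR_ge0// -[leRHS]expR0 ler_expR oppr_le0.
  by rewrite divr_ge0// mulr_ge0 ?sqr_ge0// s0.
apply: (@le_trans _ _ (\sum_(j <- J) (s * a j ^+ 2 * (2 * (m * delta + l) + m ^+ 2 * s))%:C)).
  apply: ler_sum => j _; have sj := s0 j.
  rewrite (le_trans (ch_term _ (mX j) (X2 j) (EX j) (EX2 j) d0 (tl j)))// lecR.
  have h1 : a j ^+ 2 <= m ^+ 2 by rewrite -(real_normK (num_real (a j))) ler_pXn2r ?nnegrE.
  have a0 := sqr_ge0 (a j).
  have -> : s * a j ^+ 2 * (2 * (m * delta + l) + m ^+ 2 * s) =
    a j ^+ 2 * (2 * (m * delta * s + s * l)) + (s * a j ^+ 2) * (m ^+ 2 * s) by ring.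
  rewrite lerD//.
    rewrite ler_wpM2l// ler_wpM2l// lerD2r ler_wpM2r// ler_wpM2r//.
  have -> : (a j ^+ 2 * s / 2) ^+ 2 = (s * a j ^+ 2) * (a j ^+ 2 * s / 4) by field.
  apply: ler_wpM2l; first by rewrite mulr_ge0.
  have h2 := ler_wpM2r sj h1; have h3 := mulr_ge0 a0 sj.
  by rewrite (le_trans _ h2)// ler_pdivrMr// ler_peMr// ler1n.
by rewrite -rmorph_sum lecR vE mulr_sumr mulr_suml.
Qed.

End CharacteristicFunction.

(** * Moments and central limit theorem for the linear process *)

Section LinearProcess.
Context (R : realType) (dd : measure_display) (Om : measurableType dd) (P : probability Om R).
Context (E : int -> {RV P >-> R}) (sigma2 : R) (theta : int -> R) (U : int -> Om -> R).
Hypothesis E_indep : mutually_independent P (fun t => (E t : Om -> R)).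
Hypothesis E_L2 : forall t, (E t : Om -> R) \in Lfun P 2%:E.
Hypothesis E_mean : forall t, ('E_P[E t] = 0)%E.
Hypothesis E_var : forall t, ('V_P[E t] = sigma2%:E)%E.
Hypothesis theta_sum : abs_summable_Z theta.
Hypothesis U_meas : forall t, measurable_fun setT (U t).
Hypothesis U_def : forall t, {ae P, forall w,
  zsum (fun i => theta i * E (t - i) w) @ \oo --> U t w}.
Hypothesis M2 : (fun delta : R => ereal_sup (range (fun t : int =>
  (\int[distribution P (E t)]_(e in [set e : R | (delta < `|e|)%R]) (e ^+ 2)%:E)%E))) @ +oo --> 0%E.
Local Notation Ex := (Ex P).
Local Notation L1 := (L1 P).

Lemma E_sqr_L1 t : L1 (fun w => E t w ^+ 2).
Proof. by have := Lfun2_integrable_sqr (E_L2 t). Qed.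

Lemma E_meas t : measurable_fun setT (E t : Om -> R).
Proof. exact: measurable_funPT. Qed.

Lemma E_L1 t : L1 (E t).
Proof. exact: L1_of_sqr (E_meas t) (E_sqr_L1 t). Qed.

Lemma Ex_E t : Ex (E t) = 0.
Proof. by have := E_mean t; rewrite (ExE (E_L1 t)) => -[]. Qed.

Lemma Ex_E_sqr t : Ex (fun w => E t w ^+ 2) = sigma2.
Proof.
have := E_var t; rewrite (varianceE (E_L2 t)) E_mean expe2 mule0 sube0.
by rewrite (ExE (E_sqr_L1 t)) => -[].
Qed.

Lemma sigma2_ge0 : 0 <= sigma2.
Proof. by rewrite -(Ex_E_sqr 0); apply: Ex_ge0 => w; exact: sqr_ge0. Qed.

Lemma Ex_EE s t : L1 (fun w => E s w * E t w) /\
  Ex (fun w => E s w * E t w) = sigma2 * (s == t)%:R.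
Proof.
have [->|st] := eqVneq s t.
  split; first by have := E_sqr_L1 t; congr L1; apply/funext => w; rewrite expr2.
  by rewrite mulr1 -(Ex_E_sqr t); apply: Ex_ext => w; rewrite expr2.
have [h1 h2] := indep_uncorrelated E_meas E_indep st (E_sqr_L1 s) (E_sqr_L1 t).
by split => //; rewrite h2 !Ex_E !mulr0.
Qed.

(** Uniform integrability in the shape required by [lindeberg_finite]: one truncation level for all
    times and a tail relative to [sigma2]. *)
Lemma E_tail l : 0 < l -> exists2 delta, 0 <= delta & forall t,
  Ex (fun w => E t w ^+ 2 * \1_[set w | delta < `|E t w|] w) <= sigma2 * l.
Proof.
move=> l0.
have mtail delta t : measurable_fun setT (fun w => E t w ^+ 2 * \1_[set w | delta < `|E t w|] w).
  apply: measurable_funM; first by apply: measurable_funX; exact: E_meas.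
  apply: measurable_indic; rewrite -[[set w | _]]setTI; apply: measurable_fun_ltr => //.
  by apply: measurableT_comp => //; exact: E_meas.
have itail delta t : L1 (fun w => E t w ^+ 2 * \1_[set w | delta < `|E t w|] w).
  apply: L1_le (mtail _ _) _ (E_sqr_L1 t) => w.
  rewrite normrM ger0_norm ?sqr_ge0// ler_piMr ?sqr_ge0//.
  by rewrite indicE; case: (_ \in _); rewrite ?normr1 ?normr0.
(* For [sigma2 = 0] the target is 0, which the limit in [M2] cannot supply; the second moments
   vanish instead. *)
have [s0|s0] := eqVneq sigma2 0.
  exists 0 => // t; rewrite s0 mul0r -s0 -(Ex_E_sqr t).
  apply: Ex_le (itail _ _) (E_sqr_L1 t) _ => w.
  by rewrite ler_piMr ?sqr_ge0// indicE; case: (_ \in _).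
have sl : 0 < sigma2 * l by rewrite mulr_gt0// lt_def s0 sigma2_ge0.
have /fine_cvgP [Hfin /cvgrPdist_le /(_ _ sl) Hs] := M2.
have [delta [d0 dfin ds]] : exists delta : R, [/\ 0 <= delta,
    (ereal_sup (range (fun t : int =>
      (\int[distribution P (E t)]_(e in [set e : R | (delta < `|e|)%R]) (e ^+ 2)%:E)%E))) \is a fin_num &
    `|0 - fine (ereal_sup (range (fun t : int =>
      (\int[distribution P (E t)]_(e in [set e : R | (delta < `|e|)%R]) (e ^+ 2)%:E)%E)))| <= sigma2 * l].
  have [N [_ HN]] : \forall delta \near +oo,
      (ereal_sup (range (fun t : int =>
      (\int[distribution P (E t)]_(e in [set e : R | (delta < `|e|)%R]) (e ^+ 2)%:E)%E))) \is a fin_num /\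
    `|0 - fine (ereal_sup (range (fun t : int =>
      (\int[distribution P (E t)]_(e in [set e : R | (delta < `|e|)%R]) (e ^+ 2)%:E)%E)))| <= sigma2 * l.
    by apply: filterS2 Hfin Hs.
  exists (`|N| + 1); have [|h1 h2] := HN (`|N| + 1); last by split.
  by rewrite (le_lt_trans (ler_norm N))// ltrDl.
exists delta => // t.
rewrite -lee_fin -ExE// unlock.
apply: (@le_trans _ _ (\int[distribution P (E t)]_(e in [set e : R | (delta < `|e|)%R]) (e ^+ 2)%:E)%E).
  rewrite [leRHS]integral_mkcond (ge0_integral_distribution (E t)).
  - apply: ge0_le_integral => //.
    + by move=> w _; rewrite lee_fin mulr_ge0 ?sqr_ge0.
    + exact/measurable_EFinP.
    + apply: measurableT_comp; last exact: E_meas.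
      apply/measurable_restrict => //.
        by rewrite -[[set e | _]]setTI; apply: measurable_fun_ltr => //; exact: measurableT_comp.
      by apply: measurable_funTS; apply/measurable_EFinP; exact: measurable_funX.
    + move=> w _ /=; rewrite patchE indicE.
      case: (boolP (E t w \in _)) => h; case: (boolP (w \in _)) => h' //=; rewrite ?mulr1 ?mulr0 ?lee_fin ?sqr_ge0//.
      by case/negP: h; apply/mem_set; move/set_mem: h'.
  - apply/measurable_restrict => //.
      by rewrite -[[set e | _]]setTI; apply: measurable_fun_ltr => //; exact: measurableT_comp.
    by apply: measurable_funTS; apply/measurable_EFinP; exact: measurable_funX.
  - by move=> y; rewrite patchE; case: ifP => // _; rewrite lee_fin sqr_ge0.
apply: (@le_trans _ _ (ereal_sup (range (fun t : int =>
      (\int[distribution P (E t)]_(e in [set e : R | (delta < `|e|)%R]) (e ^+ 2)%:E)%E)))).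
  by apply: ereal_sup_ubound; exists t.
rewrite -(fineK dfin) lee_fin (le_trans (ler_norm _))//.
by move: ds; rewrite sub0r normrN.
Qed.

Lemma theta_bound : exists2 M : R, 0 <= M & forall n, zsum (fun i => `|theta i|) n <= M.
Proof.
have [M HM] := theta_sum; exists M => //.
by rewrite (le_trans _ (HM 0%N))// sumr_ge0.
Qed.

Definition Un (t : int) (n : nat) (w : Om) : R := zsum (fun i => theta i * E (t - i) w) n.

Lemma measurable_Un t n : measurable_fun setT (Un t n).
Proof. by apply: measurable_sum => k; apply: measurable_funM => //; exact: E_meas. Qed.

Definition Dn (t : int) (n : nat) (w : Om) : R := zsum (fun i => `|theta i| * E (t - i) w ^+ 2) n.

(** Cauchy-Schwarz with the weights [|c k|]: the product on the right is a symmetrized double sum,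
    compared term by term through $2|y_ky_l|\le y_k^2+y_l^2$. *)
Lemma weighted_cs (J : Type) (r : seq J) (c y : J -> R) :
  (\sum_(k <- r) c k * y k) ^+ 2 <= (\sum_(k <- r) `|c k|) * (\sum_(k <- r) `|c k| * y k ^+ 2).
Proof.
have h1 : (\sum_(k <- r) c k * y k) ^+ 2 <= (\sum_(k <- r) `|c k| * `|y k|) ^+ 2.
  have nn : 0 <= \sum_(k <- r) `|c k| * `|y k| by apply: sumr_ge0 => k _; exact: mulr_ge0.
  rewrite -real_normK ?num_real// ler_pXn2r ?nnegrE//.
  by rewrite (le_trans (ler_norm_sum _ _ _))//; apply: ler_sum => k _; rewrite normrM.
rewrite (le_trans h1)//.
pose A := \sum_(k <- r) `|c k|; pose B := \sum_(k <- r) `|c k| * y k ^+ 2.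
have -> : A * B = \sum_(k <- r) \sum_(l <- r) `|c k| * `|c l| * ((y k ^+ 2 + y l ^+ 2) / 2).
  have e1 : A * B = \sum_(k <- r) \sum_(l <- r) `|c k| * `|c l| * y l ^+ 2.
    rewrite /A mulr_suml; apply: eq_bigr => k _; rewrite mulr_sumr.
    by apply: eq_bigr => l _; rewrite mulrA.
  have e2 : A * B = \sum_(k <- r) \sum_(l <- r) `|c k| * `|c l| * y k ^+ 2.
    by rewrite e1 exchange_big; apply: eq_bigr => k _; apply: eq_bigr => l _; rewrite (mulrC `|c l|).
  have : A * B = (A * B + A * B) / 2 by field.
  rewrite {2}e1 {2}e2 => ->; rewrite -big_split mulr_suml; apply: eq_bigr => k _ /=.
  by rewrite -big_split mulr_suml; apply: eq_bigr => l _ /=; ring.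
rewrite expr2 mulr_suml ler_sum// => k _; rewrite mulr_sumr ler_sum// => l _.
have -> : `|c k| * `|y k| * (`|c l| * `|y l|) = `|c k| * `|c l| * (`|y k| * `|y l|) by ring.
rewrite ler_wpM2l ?mulr_ge0//.
rewrite -(real_normK (num_real (y k))) -(real_normK (num_real (y l))).
have := sqr_ge0 (`|y k| - `|y l|); rewrite !expr2; lra.
Qed.

(** By [weighted_cs] the truncation [Un] has square at most [M * Dn]. The sums [Dn] increase in [n]
    with means at most [M * sigma2], so their supremum is integrable by monotone convergence. *)
Lemma dominating : exists D : int -> Om -> \bar R, [/\ forall t, P.-integrable setT (D t),
  forall t w, (0 <= D t w)%E & forall t n w, ((Un t n w ^+ 2)%:E <= D t w)%E].
Proof.
have [M M0 HM] := theta_bound.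
pose D t w := ereal_sup (range (fun n => (Dn t n w)%:E)).
have Dn0 t n w : 0 <= Dn t n w by apply: sumr_ge0 => k _; rewrite mulr_ge0 ?sqr_ge0.
have Dmono t w : {homo (fun n => (Dn t n w)%:E) : n m / (n <= m)%N >-> (n <= m)%E}.
  apply/nondecreasing_seqP => n; rewrite lee_fin /Dn zsumS lerDl.
  by rewrite addr_ge0// mulr_ge0 ?sqr_ge0.
have Dcv t w : (fun n => (Dn t n w)%:E) @ \oo --> D t w by exact: ereal_nondecreasing_cvgn.
have D0 t w : (0 <= D t w)%E.
  apply: (@le_trans _ _ (Dn t 0 w)%:E); first by rewrite lee_fin.
  by apply: ereal_sup_ubound; exists 0%N.
have mDn t n : measurable_fun setT (fun w => (Dn t n w)%:E).
  apply/measurable_EFinP; apply: measurable_sum => k; apply: measurable_funM => //.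
  by apply: measurable_funX; exact: E_meas.
have mD t : measurable_fun setT (D t).
  exact: (emeasurable_fun_cvg (fun n w => (Dn t n w)%:E) (D t) (mDn t) (fun w _ => Dcv t w)).
have iDn t n : L1 (Dn t n) by apply: L1_sum => k; apply: L1Z; exact: E_sqr_L1.
have IDn t n : (\int[P]_w (Dn t n w)%:E <= (M * sigma2)%:E)%E.
  have := ExE (iDn t n); rewrite unlock => ->; rewrite lee_fin /Dn /zsum Ex_sum; last first.
    by move=> k; apply: L1Z; exact: E_sqr_L1.
  rewrite (eq_bigr (fun k : 'I_(2 * n).+1 => `|theta (zwin n k)| * sigma2)); last first.
    by move=> k _; rewrite ExZ; [rewrite Ex_E_sqr|exact: E_sqr_L1].
  by rewrite -mulr_suml ler_wpM2r ?sigma2_ge0//; exact: HM.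
have ID t : (\int[P]_w D t w <= (M * sigma2)%:E)%E.
  have := @cvg_monotone_convergence _ _ _ P setT measurableT (fun n w => (Dn t n w)%:E) (mDn t)
    (fun n w _ => Dn0 t n w) (fun w _ => Dmono t w).
  rewrite (_ : (fun w => _) = D t); last first.
    by apply/funext => w; apply/cvg_lim => //; exact: Dcv.
  move=> h; apply: (cvge_to_le h); apply: nearW => n; exact: IDn.
have iD t : P.-integrable setT (D t).
  apply/integrableP; split => //; under eq_integral do rewrite gee0_abs//.
  by rewrite (le_lt_trans (ID t))// ltry.
exists (fun t w => (M%:E * D t w)%E); split => [t|t w|t n w].
- exact: integrableZl.
- by rewrite mule_ge0 ?lee_fin.
- apply: (@le_trans _ _ (M * Dn t n w)%:E).
    rewrite lee_fin (le_trans (weighted_cs _ _ _))//.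
    by rewrite ler_wpM2r//; [exact: Dn0|exact: HM].
  rewrite EFinM lee_wpmul2l ?lee_fin//.
  by apply: ereal_sup_ubound; exists n.
Qed.

Lemma Un_cvg t : {ae P, forall w, (fun n => Un t n w) @ \oo --> U t w}.
Proof. exact: U_def. Qed.

Lemma Ex_UU s t : L1 (fun w => U s w * U t w) /\
  (fun n => Ex (fun w => Un s n w * Un t n w)) @ \oo --> Ex (fun w => U s w * U t w).
Proof.
have [D [iD D0 UD]] := dominating.
apply: (@Ex_dominated _ _ _ _ _ _ (fun w => D s w + D t w)%E).
- by move=> n; apply: measurable_funM; exact: measurable_Un.
- exact: measurable_funM.
- by apply: filterS2 (Un_cvg s) (Un_cvg t) => w h1 h2; exact: cvgM.
- exact: integrableD.
- move=> n w; apply: (@le_trans _ _ ((Un s n w ^+ 2)%:E + (Un t n w ^+ 2)%:E)%E); last exact: leeD.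
  rewrite lee_fin normrM -(real_normK (num_real (Un s n w))) -(real_normK (num_real (Un t n w))).
  have := sqr_ge0 (`|Un s n w| - `|Un t n w|); have := sqr_ge0 `|Un s n w|; have := sqr_ge0 `|Un t n w|.
  by rewrite !expr2; nra.
Qed.

Lemma Ex_U t : L1 (U t) /\ Ex (U t) = 0.
Proof.
have [D [iD D0 UD]] := dominating.
have [h1 h2] : L1 (U t) /\ (fun n => Ex (Un t n)) @ \oo --> Ex (U t).
  apply: (@Ex_dominated _ _ _ _ _ _ (fun w => 1%:E + D t w)%E).
  - by move=> n; exact: measurable_Un.
  - exact: U_meas.
  - exact: Un_cvg.
  - by apply: integrableD => //; exact: L1_cst.
  - move=> n w; apply: (@le_trans _ _ (1%:E + (Un t n w ^+ 2)%:E)%E); last exact: leeD.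
    rewrite lee_fin -(real_normK (num_real (Un t n w))).
    have := sqr_ge0 (`|Un t n w| - 1); have := normr_ge0 (Un t n w); rewrite !expr2; nra.
split => //.
have h3 : (fun n => Ex (Un t n)) = fun=> 0; last by rewrite h3 in h2; apply: cvg_unique h2 (cvg_cst _).
apply/funext => n; rewrite /Un /zsum Ex_sum; last by move=> k; apply: L1Z; exact: E_L1.
by rewrite big1// => k _; rewrite ExZ ?Ex_E ?mulr0//; exact: E_L1.
Qed.

(** The autocovariance at lag [h] of the truncated process: at times [s] and [t], the weights [i]
    and [j] meet the same innovation when [i - j = s - t]. *)
Definition gn (n : nat) (h : int) : R := sigma2 *
  \sum_(k < (2 * n).+1) \sum_(l < (2 * n).+1) theta (zwin n k) * theta (zwin n l) * (zwin n k - zwin n l == h)%:R.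

Lemma Ex_UnUn s t n : Ex (fun w => Un s n w * Un t n w) = gn n (s - t).
Proof.
have iEE a b : L1 (fun w => E a w * E b w) by have [] := Ex_EE a b.
transitivity (Ex (fun w => \sum_(k < (2 * n).+1) \sum_(l < (2 * n).+1)
    theta (zwin n k) * theta (zwin n l) * (E (s - zwin n k) w * E (t - zwin n l) w))).
  apply: Ex_ext => w; rewrite /Un /zsum mulr_suml; apply: eq_bigr => k _.
  by rewrite mulr_sumr; apply: eq_bigr => l _; ring.
rewrite Ex_sum; last by move=> k; apply: L1_sum => l; exact: L1Z.
rewrite /gn mulr_sumr; apply: eq_bigr => k _.
rewrite Ex_sum; last by move=> l; exact: L1Z.
rewrite mulr_sumr; apply: eq_bigr => l _; rewrite ExZ// (Ex_EE _ _).2 mulrCA; congr (_ * (_ * _%:R)).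
by congr nat_of_bool; apply/eqP/eqP; lia.
Qed.

Lemma gn_sym n h : gn n (- h) = gn n h.
Proof.
congr (_ * _); rewrite exchange_big; apply: eq_bigr => k _; apply: eq_bigr => l _.
rewrite (mulrC (theta _)); congr (_ * _%:R); congr nat_of_bool; apply/eqP/eqP; lia.
Qed.

Definition gam (k : nat) : R := Ex (fun w => U 0 w * U k%:Z w).

Lemma gn_cvg (h : int) : (fun n => gn n h) @ \oo --> gam `|h|%N.
Proof.
have [_ H] := Ex_UU 0 `|h|%N%:Z.
have -> : gn ^~ h = (fun n => Ex (fun w => Un 0 n w * Un `|h|%N%:Z n w)); last exact: H.
apply/funext => n; rewrite Ex_UnUn; case: {H} h => k /=; first by rewrite sub0r gn_sym.
by rewrite NegzE sub0r.
Qed.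

(** Each truncation has covariances depending on [s - t] alone, and this passes to the limit. *)
Lemma Ex_UUE s t : Ex (fun w => U s w * U t w) = gam `|s - t|%N.
Proof.
have [_ h] := Ex_UU s t; have h2 := @gn_cvg (s - t).
have E1 : gn ^~ (s - t) = (fun n => Ex (fun w => Un s n w * Un t n w)).
  by apply/funext => n; rewrite Ex_UnUn.
rewrite E1 in h2; exact: cvg_unique h h2.
Qed.

(** A pair of weights contributes to at most one lag, so the absolute covariances of every
    truncation sum to at most [sigma2 * (M * M)]. *)
Lemma gam_sum : exists M : R, forall n, \sum_(k < n) `|gam k| <= M.
Proof.
have [M M0 HM] := theta_bound; exists (sigma2 * (M * M)) => K.
have h : (fun n => \sum_(k < K) `|gn n k%:Z|) @ \oo --> \sum_(k < K) `|gam k|.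
  by apply: cvg_sumR => k _; apply: cvg_norm; exact: (@gn_cvg k%:Z).
apply: (cvgr_to_le h); apply: nearW => n.
have S2 := sigma2_ge0.
apply: (@le_trans _ _ (sigma2 * \sum_(k < K) \sum_(i < (2 * n).+1) \sum_(l < (2 * n).+1)
    `|theta (zwin n i)| * `|theta (zwin n l)| * (zwin n i - zwin n l == k%:Z)%:R)).
  rewrite mulr_sumr; apply: ler_sum => k _; rewrite normrM ger0_norm// ler_wpM2l//.
  rewrite (le_trans (ler_norm_sum _ _ _))//; apply: ler_sum => i _.
  rewrite (le_trans (ler_norm_sum _ _ _))//; apply: ler_sum => l _.
  by rewrite !normrM normr_nat.
rewrite ler_wpM2l// exchange_big/=.
apply: (@le_trans _ _ (\sum_(i < (2 * n).+1) `|theta (zwin n i)| * M)); last first.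
  by rewrite -mulr_suml ler_wpM2r//; exact: HM.
apply: ler_sum => i _; rewrite exchange_big/=.
apply: (@le_trans _ _ (\sum_(l < (2 * n).+1) `|theta (zwin n i)| * `|theta (zwin n l)|)).
  apply: ler_sum => l _; rewrite -mulr_sumr ler_piMr ?mulr_ge0//.
  have eu (k k' : 'I_K) : zwin n i - zwin n l == k%:Z -> zwin n i - zwin n l == k'%:Z -> k = k'.
    by move=> /eqP h1 /eqP h2; apply/val_inj => /=; lia.
  have [[k0 _ /(_ (fun=> 1))]|[_ /(_ (fun=> 1))]] := sum_uniq_ind R eu.
    by under eq_bigr do rewrite mulr1; move=> ->.
  by under eq_bigr do rewrite mulr1; move=> ->.
by rewrite -mulr_sumr ler_wpM2l//; exact: HM.
Qed.

Section LinearForms.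
Variables (T : nat) (beta : 'cV[R]_T).

Definition lform (w : Om) : R := \sum_(s < T) beta s 0 * U s.+1%:Z w.
Definition lform_n (n : nat) (w : Om) : R := \sum_(s < T) beta s 0 * Un s.+1%:Z n w.

Lemma measurable_lform : measurable_fun setT lform.
Proof. by apply: measurable_sum => s; exact: measurable_funM. Qed.

Lemma measurable_lform_n n : measurable_fun setT (lform_n n).
Proof. by apply: measurable_sum => s; apply: measurable_funM => //; exact: measurable_Un. Qed.

Lemma lform_cvg : {ae P, forall w, lform_n ^~ w @ \oo --> lform w}.
Proof.
have h : {ae P, forall w, forall s : 'I_T, (fun n => Un s.+1%:Z n w) @ \oo --> U s.+1%:Z w}.
  by apply: filter_forall => s; exact: Un_cvg.
apply: filterS h => w h; apply: cvg_sumR => s _; apply: cvgM; [exact: cvg_cst|exact: h].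
Qed.

Lemma lform_sqr : L1 (fun w => lform w ^+ 2) /\
  Ex (fun w => lform w ^+ 2) = dot beta (Lambda gam T *m beta).
Proof.
have iUU s t : L1 (fun w => U s w * U t w) by have [] := Ex_UU s t.
have E1 w : lform w ^+ 2 = \sum_(s < T) \sum_(t < T) beta s 0 * beta t 0 * (U s.+1%:Z w * U t.+1%:Z w).
  rewrite expr2 /lform mulr_suml; apply: eq_bigr => s _; rewrite mulr_sumr.
  by apply: eq_bigr => t _; ring.
rewrite (funext E1).
split; first by apply: L1_sum => s; apply: L1_sum => t; exact: L1Z.
rewrite Ex_sum; last by move=> s; apply: L1_sum => t; exact: L1Z.
apply: eq_bigr => s _; rewrite Ex_sum; last by move=> t; exact: L1Z.
rewrite mxE mulr_sumr; apply: eq_bigr => t _; rewrite ExZ// Ex_UUE mxE.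
rewrite -mulrA (mulrC (gam _)); congr (_ * (_ * gam _)).
by case: leqP => h; lia.
Qed.

Lemma lform_n_sqr_cvg : (fun n => Ex (fun w => lform_n n w ^+ 2)) @ \oo -->
  dot beta (Lambda gam T *m beta).
Proof.
have iUU s t n : L1 (fun w => Un s n w * Un t n w).
  have [D [iD D0 UD]] := dominating.
  have iDD : P.-integrable setT (fun w => D s w + D t w)%E by exact: integrableD.
  apply: (le_integrable measurableT _ _ iDD).
    by apply/measurable_EFinP; apply: measurable_funM; exact: measurable_Un.
  move=> w _; rewrite (@gee0_abs _ (D s w + D t w)%E) ?adde_ge0//.
  apply: (@le_trans _ _ ((Un s n w ^+ 2)%:E + (Un t n w ^+ 2)%:E)%E); last exact: leeD.
  rewrite lee_fin normrM -(real_normK (num_real (Un s n w))) -(real_normK (num_real (Un t n w))).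
  have := sqr_ge0 (`|Un s n w| - `|Un t n w|); have := sqr_ge0 `|Un s n w|; have := sqr_ge0 `|Un t n w|.
  by rewrite !expr2; nra.
have E1 n w : lform_n n w ^+ 2 =
    \sum_(s < T) \sum_(t < T) beta s 0 * beta t 0 * (Un s.+1%:Z n w * Un t.+1%:Z n w).
  rewrite expr2 /lform_n mulr_suml; apply: eq_bigr => s _; rewrite mulr_sumr.
  by apply: eq_bigr => t _; ring.
have E2 n : Ex (fun w => lform_n n w ^+ 2) =
    \sum_(s < T) \sum_(t < T) beta s 0 * beta t 0 * Ex (fun w => Un s.+1%:Z n w * Un t.+1%:Z n w).
  rewrite (funext (E1 n)).
  rewrite Ex_sum; last by move=> s; apply: L1_sum => t; exact: L1Z.
  apply: eq_bigr => s _; rewrite Ex_sum; last by move=> t; exact: L1Z.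
  by apply: eq_bigr => t _; rewrite ExZ.
rewrite (funext E2).
have -> : dot beta (Lambda gam T *m beta) =
    \sum_(s < T) \sum_(t < T) beta s 0 * beta t 0 * Ex (fun w => U s.+1%:Z w * U t.+1%:Z w).
  apply: eq_bigr => s _; rewrite mxE mulr_sumr; apply: eq_bigr => t _; rewrite Ex_UUE mxE.
  rewrite -mulrA (mulrC (gam _)); congr (_ * (_ * gam _)).
  by case: leqP => h; lia.
apply: cvg_sumR => s _; apply: cvg_sumR => t _; apply: cvgM; first exact: cvg_cst.
by have [] := Ex_UU s.+1%:Z t.+1%:Z.
Qed.

Lemma sum_delta (J : seq int) (j0 : int) (f : int -> R) : uniq J -> j0 \in J ->
  \sum_(j <- J) (j0 == j)%:R * f j = f j0.
Proof.
move=> uJ jJ; rewrite (bigD1_seq j0)//= eqxx mul1r big1 ?addr0// => j.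
by rewrite eq_sym => /negbTE ->; rewrite mul0r.
Qed.

(** Regrouping by innovations makes [a] a convolution of [beta] with [theta], whose entries are at
    most the largest weight times the sum of the [|theta i|]. *)
Lemma lform_n_lin (M m : R) n : (forall k, zsum (fun i => `|theta i|) k <= M) ->
  0 <= m -> (forall s, `|beta s 0| <= m) ->
  exists (J : seq int) (a : int -> R), [/\ uniq J, forall j, `|a j| <= m * M &
    forall w, lform_n n w = \sum_(j <- J) a j * E j w].
Proof.
move=> HM m0 bm.
(* A window containing every index [s.+1 - zwin n k] that occurs. *)
pose N := (n + T).+1.
pose J := [seq zwin N l | l <- iota 0 (2 * N).+1].
have uJ : uniq J by rewrite map_inj_uniq ?iota_uniq// => a b; rewrite /zwin => h; lia.
have JP (j : int) : (`|j| <= N)%N -> j \in J.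
  move=> jN; apply/mapP; exists `|(j + N%:Z)%R|%N; last by rewrite /zwin; lia.
  by rewrite mem_iota; lia.
pose a j := \sum_(s < T) beta s 0 * \sum_(k < (2 * n).+1) theta (zwin n k) * (s.+1%:Z - zwin n k == j)%:R.
exists J, a; split => // [j|w].
  apply: (@le_trans _ _ (\sum_(k < (2 * n).+1) m * `|theta (zwin n k)|)); last first.
    by rewrite -mulr_sumr ler_wpM2l//; exact: HM.
  apply: (@le_trans _ _ (\sum_(s < T) \sum_(k < (2 * n).+1)
      m * `|theta (zwin n k)| * (s.+1%:Z - zwin n k == j)%:R)).
    rewrite (le_trans (ler_norm_sum _ _ _))//; apply: ler_sum => s _.
    rewrite normrM (le_trans (ler_wpM2r (normr_ge0 _) (bm s)))//.
    under [leRHS]eq_bigr do rewrite -mulrA.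
    rewrite -mulr_sumr ler_wpM2l// (le_trans (ler_norm_sum _ _ _))//; apply: ler_sum => k _.
    by rewrite normrM normr_nat.
  rewrite exchange_big/=; apply: ler_sum => k _; rewrite -mulr_sumr ler_piMr ?mulr_ge0//.
  have eu (s s' : 'I_T) : s.+1%:Z - zwin n k == j -> s'.+1%:Z - zwin n k == j -> s = s'.
    by move=> /eqP h1 /eqP h2; apply/val_inj => /=; lia.
  have [[k0 _ /(_ (fun=> 1))]|[_ /(_ (fun=> 1))]] := sum_uniq_ind R eu.
    by under eq_bigr do rewrite mulr1; move=> ->.
  by under eq_bigr do rewrite mulr1; move=> ->.
rewrite /lform_n /a; under [RHS]eq_bigr do rewrite mulr_suml.
rewrite exchange_big/=; apply: eq_bigr => s _.
under [RHS]eq_bigr do rewrite -mulrA mulr_suml.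
rewrite -mulr_sumr; congr (_ * _); rewrite exchange_big/=; apply: eq_bigr => k _.
under [RHS]eq_bigr do rewrite -mulrA.
rewrite -mulr_sumr (sum_delta (fun j => E j w))//.
by apply: JP; have := ltn_ord s; have := ltn_ord k; rewrite /zwin /N; lia.
Qed.

(** [lindeberg_finite] applies to each truncation with the same constants. As [n] grows the
    variances converge, and so do the cosine and sine means by bounded convergence. *)
Lemma ch_lform (M m delta l : R) : (forall k, zsum (fun i => `|theta i|) k <= M) -> 0 <= M ->
  0 <= m -> (forall s, `|beta s 0| <= m) -> 0 <= delta -> 0 <= l ->
  (forall t, Ex (fun w => E t w ^+ 2 * \1_[set w | delta < `|E t w|] w) <= sigma2 * l) ->
  let v := dot beta (Lambda gam T *m beta) in
  let B := v * (2 * (m * M * delta + l) + (m * M) ^+ 2 * sigma2) in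
  `|Ex (fun w => cos (lform w)) - expR (- (v / 2))| <= B /\
  `|Ex (fun w => sin (lform w))| <= B.
Proof.
move=> HM M0 m0 bm d0 l0 tl v B.
pose vn n := Ex (fun w => lform_n n w ^+ 2).
have fin n : `|Ex (fun w => cos (lform_n n w)) - expR (- (vn n / 2))| <=
      vn n * (2 * (m * M * delta + l) + (m * M) ^+ 2 * sigma2) /\
    `|Ex (fun w => sin (lform_n n w))| <= vn n * (2 * (m * M * delta + l) + (m * M) ^+ 2 * sigma2).
  have [J [a [uJ am aE]]] := lform_n_lin n HM m0 bm.
  have iEE s t : L1 (fun w => E s w * E t w) by have [] := Ex_EE s t.
  have vnE : vn n = sigma2 * \sum_(j <- J) a j ^+ 2.
    transitivity (Ex (fun w => \sum_(i <- J) \sum_(j <- J) a i * a j * (E i w * E j w))).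
      apply: Ex_ext => w; rewrite aE expr2 mulr_suml; apply: eq_bigr => i _.
      by rewrite mulr_sumr; apply: eq_bigr => j _; ring.
    rewrite Ex_sum; last by move=> i; apply: L1_sum => j; exact: L1Z.
    rewrite mulr_sumr; apply: eq_big_seq => i iJ; rewrite Ex_sum; last by move=> j; exact: L1Z.
    rewrite -(sum_delta (fun j => sigma2 * (a i * a j)) uJ iJ); apply: eq_bigr => j _.
    by rewrite ExZ// (Ex_EE i j).2; ring.
  have := lindeberg_finite E_meas E_indep uJ E_sqr_L1 Ex_E Ex_E_sqr d0 l0 tl (mulr_ge0 m0 M0) am vnE.
  have -> : (fun w => \sum_(j <- J) a j * E j w) = lform_n n by apply/funext => w; rewrite aE.
  rewrite normc_def lecR /ch /= oppr0 addr0 => h; split; apply: le_trans h.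
    by rewrite -[leLHS]ger0_norm// -sqrtr_sqr real_normK ?num_real// ler_wsqrtr// lerDl sqr_ge0.
  by rewrite -[leLHS]ger0_norm// -sqrtr_sqr real_normK ?num_real// ler_wsqrtr// lerDr sqr_ge0.
have vcv : vn @ \oo --> v by exact: lform_n_sqr_cvg.
have Bcv : (fun n => vn n * (2 * (m * M * delta + l) + (m * M) ^+ 2 * sigma2)) @ \oo --> B.
  by apply: cvgM => //; exact: cvg_cst.
have ccv : (fun n => Ex (fun w => cos (lform_n n w))) @ \oo --> Ex (fun w => cos (lform w)).
  apply: (@Ex_bounded_cvg _ _ _ _ _ _ 1).
  - by move=> n; apply: measurable_cos; exact: measurable_lform_n.
  - by apply: measurable_cos; exact: measurable_lform.
  - apply: filterS lform_cvg => w h; apply: continuous_cvg h; exact: continuous_cos.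
  - by move=> n w; exact: cos_norm_le1.
have scv : (fun n => Ex (fun w => sin (lform_n n w))) @ \oo --> Ex (fun w => sin (lform w)).
  apply: (@Ex_bounded_cvg _ _ _ _ _ _ 1).
  - by move=> n; apply: measurable_sin; exact: measurable_lform_n.
  - by apply: measurable_sin; exact: measurable_lform.
  - apply: filterS lform_cvg => w h; apply: continuous_cvg h; exact: continuous_sin.
  - by move=> n w; exact: sin_norm_le1.
have ecv : (fun n => expR (- (vn n / 2))) @ \oo --> expR (- (v / 2)).
  have : (fun n => - (vn n / 2)) @ \oo --> - (v / 2).
    by apply: cvgN; apply: cvgM => //; exact: cvg_cst.
  by move=> h; apply: continuous_cvg h; exact: continuous_expR.
split.
  have h : (fun n => `|Ex (fun w => cos (lform_n n w)) - expR (- (vn n / 2))|) @ \oo -->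
      `|Ex (fun w => cos (lform w)) - expR (- (v / 2))| by apply: cvg_norm; exact: cvgB.
  by apply: (ler_cvg_to h Bcv); apply: nearW => n; have [] := fin n.
have h : (fun n => `|Ex (fun w => sin (lform_n n w))|) @ \oo --> `|Ex (fun w => sin (lform w))|.
  exact: cvg_norm.
by apply: (ler_cvg_to h Bcv); apply: nearW => n; have [] := fin n.
Qed.

End LinearForms.

(** The constants are chosen in the order [l], [delta], [m]: the tail level fixes the truncation
    level, and the bound on the weights must beat the latter. *)
Lemma clt_lform (beta : forall T, 'cV[R]_T) (v : R) : small beta ->
  (fun T => dot (beta T) (Lambda gam T *m beta T)) @ \oo --> v ->
  (fun T => Ex (fun w => cos (lform (beta T) w))) @ \oo --> expR (- (v / 2)) /\
  (fun T => Ex (fun w => sin (lform (beta T) w))) @ \oo --> 0.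
Proof.
move=> [_ bs] bv; have [M M0 HM] := theta_bound.
pose V := `|v| + 1; have V0 : 0 < V by rewrite ltr_wpDl.
have key eps : 0 < eps -> \forall T \near \oo,
    `|Ex (fun w => cos (lform (beta T) w)) - expR (- (dot (beta T) (Lambda gam T *m beta T) / 2))| <= eps /\
    `|Ex (fun w => sin (lform (beta T) w))| <= eps.
  move=> e0; pose l := eps / (4 * V).
  have l0 : 0 < l by rewrite divr_gt0// mulr_gt0.
  have [delta d0 tl] := E_tail l0.
  pose K := 2 * M * delta + M ^+ 2 * sigma2.
  have s0 := sigma2_ge0.
  have K0 : 0 <= K by rewrite addr_ge0// !mulr_ge0// sqr_ge0.
  (* [m <= 1] lets the term in [m ^+ 2] be bounded by one in [m]; the other bound leaves [eps / 2]
     for it, and the choice of [l] uses the other half. *)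
  pose m := Num.min 1 (eps / 2 / (V * (K + 1))).
  have K1 : 0 < K + 1 by rewrite ltr_wpDl.
  have m0 : 0 < m by rewrite lt_min ltr01 !divr_gt0// mulr_gt0.
  have m1 : m <= 1 by rewrite ge_min lexx.
  have mK : V * (m * K) <= eps / 2.
    have h : m <= eps / 2 / (V * (K + 1)) by rewrite ge_min lexx orbT.
    rewrite ler_pdivlMr ?mulr_gt0// in h; rewrite (le_trans _ h)// mulrCA ler_wpM2l ?(ltW m0)//.
    by rewrite ler_wpM2l ?(ltW V0)// lerDl.
  move/cvgrPdist_le: bv => /(_ _ ltr01) bv.
  apply: filterS2 (bs _ m0) bv => T bm vT.
  have [h1 h2] := ch_lform HM M0 (ltW m0) bm d0 (ltW l0) tl.
  suff hB : dot (beta T) (Lambda gam T *m beta T) *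
      (2 * (m * M * delta + l) + (m * M) ^+ 2 * sigma2) <= eps.
    by split; [exact: le_trans h1 hB|exact: le_trans h2 hB].
  set vT' := dot _ _ in vT *.
  have vV : vT' <= V.
    have := ler_norm v; have := ler_normB v (v - vT'); rewrite opprB addrC subrK.
    by have := ler_norm vT'; rewrite /V; lra.
  have C0 : 0 <= 2 * (m * M * delta + l) + (m * M) ^+ 2 * sigma2.
    rewrite addr_ge0//; last by rewrite mulr_ge0 ?sqr_ge0.
    by rewrite mulr_ge0// addr_ge0 ?(ltW l0)// mulr_ge0// mulr_ge0// ltW.
  rewrite (le_trans (ler_wpM2r C0 vV))//.
  have h3 : 2 * (m * M * delta + l) + (m * M) ^+ 2 * sigma2 <= m * K + 2 * l.
    have -> : (m * M) ^+ 2 * sigma2 = m * (m * (M ^+ 2 * sigma2)) by ring.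
    have h4 : m * (M ^+ 2 * sigma2) <= M ^+ 2 * sigma2 by rewrite ler_piMl// mulr_ge0// sqr_ge0.
    have h5 : m * (m * (M ^+ 2 * sigma2)) <= m * (M ^+ 2 * sigma2) by rewrite ler_wpM2l// ltW.
    by rewrite /K mulrDr; lra.
  rewrite (le_trans (ler_wpM2l (ltW V0) h3))// mulrDr.
  have -> : V * (2 * l) = eps / 2 by rewrite /l; field; rewrite gt_eqF.
  by rewrite [leRHS]splitr lerD2r.
have ecv : (fun T => expR (- (dot (beta T) (Lambda gam T *m beta T) / 2))) @ \oo --> expR (- (v / 2)).
  have : (fun T => - (dot (beta T) (Lambda gam T *m beta T) / 2)) @ \oo --> - (v / 2).
    by apply: cvgN; apply: cvgM => //; exact: cvg_cst.
  by move=> h; apply: continuous_cvg h; exact: continuous_expR.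
split; apply/cvgrPdist_le => eps e0.
  have e2 : 0 < eps / 2 by rewrite divr_gt0.
  move/cvgrPdist_le: ecv => /(_ _ e2) ecv.
  apply: filterS2 ecv (key _ e2) => T h1 [h2 _].
  rewrite distrC in h2.
  have := ler_normD (expR (- (v / 2)) - expR (- (dot (beta T) (Lambda gam T *m beta T) / 2)))
    (expR (- (dot (beta T) (Lambda gam T *m beta T) / 2)) - Ex (fun w => cos (lform (beta T) w))).
  by rewrite addrA subrK; lra.
by apply: filterS (key _ e0) => T [_ h]; rewrite sub0r normrN.
Qed.

End LinearProcess.

(** * Characteristic function of the standard normal law *)

Section GaussianCharacteristicFunction.
Variable R : realType.
Let mu := @lebesgue_measure R.

Definition npdf (x : R) : R := normal_pdf 0 1 x.

Lemma npdfE x : npdf x = normal_peak 1 * expR (- (x ^+ 2 / 2)).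
Proof.
rewrite /npdf normal_pdfE ?oner_neq0// /normal_fun subr0 expr1n mulNr.
by rewrite -(natrM _ 1 2) || rewrite mulr2n.
Qed.

Lemma npdf_ge0 x : 0 <= npdf x.
Proof. exact: normal_pdf_ge0. Qed.

Lemma is_derive_sqr (x : R) : is_derive x 1 (fun z : R => z ^+ 2) (2 * x).
Proof.
have h := is_deriveM (is_derive_id x (1 : R)) (is_derive_id x (1 : R)).
apply: is_derive_eq h _.
by rewrite /GRing.scale/=; ring.
Qed.

Lemma is_derive_comp (f g : R -> R) (x a b : R) : is_derive (g x) 1 f a ->
  is_derive x 1 g b -> is_derive x 1 (fun z => f (g z)) (a * b).
Proof. by move=> hf hg; exact: (is_derive1_comp hf hg). Qed.

Lemma npdf_derive (x : R) : is_derive x 1 npdf (- x * npdf x).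
Proof.
have -> : npdf = (fun y => normal_peak 1 * (expR \o (fun z : R => - (z ^+ 2 / 2))) y).
  by apply/funext => y; rewrite npdfE.
have h1 : is_derive x 1 (fun z : R => - (z ^+ 2 / 2)) (- x).
  have h := is_derive_sqr x; have := is_deriveN (is_deriveM h (is_derive_cst (2^-1 : R) x 1)).
  rewrite scaler0 add0r => h2; apply: is_derive_eq h2 _.
  by rewrite /GRing.scale/=; field.
have h2 := @is_derive_comp _ (fun z : R => - (z ^+ 2 / 2)) x _ _ (is_derive_expR (- (x ^+ 2 / 2))) h1.
have h3 := is_deriveM (is_derive_cst (normal_peak 1 : R) x 1) h2.
apply: is_derive_eq h3 _.
by rewrite scaler0 addr0 /GRing.scale/=; ring.
Qed.

(** An integrable envelope for $|x|$ times the normal density: the slack between $e^{-x^2/2}$ and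
    $e^{-x^2/4}$ absorbs the factor $|x|\le 1+x^2/4\le e^{x^2/4}$. *)
Definition gbound (x : R) : R := normal_peak 1 * expR (- (x ^+ 2 / 4)).

Lemma x_npdf_le x : `|x| * npdf x <= gbound x.
Proof.
rewrite npdfE mulrCA /gbound ler_wpM2l ?normal_peak_ge0//.
have -> : - (x ^+ 2 / 2) = - (x ^+ 2 / 4) + - (x ^+ 2 / 4) by field.
rewrite expRD mulrA ler_piMl ?expR_ge0// expRN ler_pdivrMr ?expR_gt0// mul1r.
apply: le_trans (expR_ge1Dx _); rewrite -(real_normK (num_real x)).
have := sqr_ge0 (`|x| / 2 - 1); rewrite !expr2; lra.
Qed.

Lemma gbound_le x : gbound x <= normal_peak 1.
Proof.
rewrite /gbound ler_piMr ?normal_peak_ge0// -expR0 ler_expR oppr_le0.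
by rewrite divr_ge0 ?sqr_ge0.
Qed.

Lemma gbound_integrable : mu.-integrable setT (EFin \o gbound).
Proof.
have s0 : Num.sqrt 2 != 0 :> R by rewrite gt_eqF// sqrtr_gt0.
have h := @integrableZl _ _ _ mu setT measurableT (normal_peak 1 / normal_peak (Num.sqrt 2)) _
  (integrable_normal_pdf 0 (Num.sqrt 2)).
apply: eq_integrable h => // x _ /=.
rewrite -EFinM; congr EFin; rewrite normal_pdfE// /gbound /normal_fun subr0 sqr_sqrtr//.
rewrite mulrA divfK ?gt_eqF ?normal_peak_gt0// mulNr; congr (_ * expR (- (_ / _))).
by rewrite -mulr_natr -natrM.
Qed.

Lemma npdf_measurable : measurable_fun setT npdf.
Proof. exact: measurable_normal_pdf. Qed.

Lemma npdf_continuous : continuous npdf.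
Proof. by apply: continuous_normal_pdf; rewrite oner_neq0. Qed.

Section Trig.
Variables (u du : R -> R).
Hypothesis u_derive : forall x : R, is_derive x 1 u (du x).
Hypothesis du_derive : forall x : R, is_derive x 1 du (- u x).
Hypothesis u_le1 : forall x, `|u x| <= 1.
Hypothesis du_le1 : forall x, `|du x| <= 1.

Let u_cont : continuous u.
Proof. by move=> x; apply/differentiable_continuous/derivable1_diffP. Qed.

Let du_cont : continuous du.
Proof. by move=> x; apply/differentiable_continuous/derivable1_diffP. Qed.

Let mu_comp (v : R -> R) (t : R) : continuous v -> measurable_fun setT (fun x => v (t * x)).
Proof.
move=> cv; apply: measurableT_comp; last exact: measurable_funM.
exact: continuous_measurable_fun.
Qed.

Lemma integrable_trig_npdf (v : R -> R) (t : R) : continuous v -> (forall x, `|v x| <= 1) ->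
  mu.-integrable setT (EFin \o (fun x => v (t * x) * npdf x)).
Proof.
move=> cv v1; apply: le_integrable (integrable_normal_pdf 0 1) => //.
  apply/measurable_EFinP/measurable_funM; [exact: mu_comp|exact: npdf_measurable].
move=> x _ /=; rewrite lee_fin normrM (ger0_norm (npdf_ge0 x)) ler_piMl ?npdf_ge0//.
Qed.

Lemma integrable_x_trig_npdf (v : R -> R) (t : R) : continuous v -> (forall x, `|v x| <= 1) ->
  mu.-integrable setT (EFin \o (fun x => x * v (t * x) * npdf x)).
Proof.
move=> cv v1; apply: le_integrable gbound_integrable => //.
  apply/measurable_EFinP/measurable_funM; last exact: npdf_measurable.
  by apply: measurable_funM => //; exact: mu_comp.
move=> x _ /=; rewrite lee_fin 2!normrM (ger0_norm (npdf_ge0 x)).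
 apply: (@le_trans _ _ (`|x| * npdf x)); last first.
  by rewrite (le_trans (x_npdf_le x))//; exact: ler_norm.
by rewrite ler_wpM2r ?npdf_ge0// ler_piMr.
Qed.

(** Real and imaginary parts are treated together: [u] is the cosine or the sine, known only through
    $u''=-u$ and the bounds on $u$ and $u'$. *)
Definition Iphi (t : R) : R := \int[mu]_x (u (t * x) * npdf x).

(* Integration by parts against [npdf' = - x npdf] turns [Iphi' t] into [- t Iphi t]. *)
Lemma parts t : \int[mu]_x (x * du (t * x) * npdf x) = - t * Iphi t.
Proof.
(* This is the derivative of [K] below, which vanishes at both infinities; hence its integral is
   zero. *)
pose k x := - t * (u (t * x) * npdf x) - x * du (t * x) * npdf x.
have ik1 : mu.-integrable setT (EFin \o (fun x => - t * (u (t * x) * npdf x))).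
  exact: integrableZl (integrable_trig_npdf t u_cont u_le1).
have ik2 := integrable_x_trig_npdf t du_cont du_le1.
have ik : mu.-integrable setT (EFin \o k) 
  by have := integrableB measurableT ik1 ik2.
have ck : continuous k.
  move=> x; have cx (v : R -> R) : continuous v -> {for x, continuous (fun y => v (t * y))}.
    by move=> cv; apply: continuous_comp; [apply: continuousM; [exact: cst_continuous|exact: cvg_id]|exact: cv].
  apply: cvgB; last first.
    apply: cvgM; last exact: npdf_continuous.
    by apply: cvgM; [exact: cvg_id|exact: cx].
  apply: cvgM; first exact: cst_continuous.
  by apply: cvgM; [exact: cx|exact: npdf_continuous].
suff k0 : \int[mu]_x k x = 0.
  have : \int[mu]_x k x = \int[mu]_x (- t * (u (t * x) * npdf x)) - \int[mu]_x (x * du (t * x) * npdf x).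
    by rewrite -RintegralB.
  rewrite k0 RintegralZl//; last exact: integrable_trig_npdf.
  by move=> /esym/eqP; rewrite subr_eq0 => /eqP <-.
pose K x := du (t * x) * npdf x.
have K_derive (x : R) : is_derive x 1 K (k x).
  have h1 : is_derive x 1 (fun z : R => t * z) t.
    have := is_deriveM (is_derive_cst (t : R) x 1) (is_derive_id x (1 : R)).
    by rewrite scaler0 addr0 /GRing.scale/= mulr1.
  have h2 := @is_derive_comp _ (fun z : R => t * z) x _ _ (du_derive (t * x)) h1.
  apply: is_derive_eq (is_deriveM h2 (npdf_derive x)) _.
  by rewrite /GRing.scale/= /k; ring.
have FTC (n : nat) : (\int[mu]_(x in `[(- n.+1%:R)%R, n.+1%:R%R]) (k x)%:E = (K n.+1%:R)%:E - (K (- n.+1%:R))%:E)%E.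
  have Kc : continuous K by move=> x; apply/differentiable_continuous/derivable1_diffP.
  apply: continuous_FTC2.
  - by rewrite gtrN ?ltr0Sn.
  - exact: continuous_subspaceT.
  - split; [by move=> y _; have := K_derive y; case|exact: cvg_at_right_filter (Kc _)|exact: cvg_at_left_filter (Kc _)].
  - by move=> x _; rewrite derive1E; apply: derive_val.
have K0 : (fun n : nat => K n.+1%:R - K (- n.+1%:R)) @ \oo --> 0.
  apply/cvgrPdist_le => e e0.
  pose C := normal_peak 1 : R.
  exists (Num.truncn (2 * C / e)) => // n /= hn.
  have n0 : 0 < n.+1%:R :> R by rewrite ltr0n.
  have Kb (x : R) : `|x| = n.+1%:R -> `|K x| <= C / n.+1%:R.
    move=> xn; rewrite /K normrM (ger0_norm (npdf_ge0 x)).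
    rewrite (@le_trans _ _ (npdf x))//; first by rewrite ler_piMl ?npdf_ge0.
    rewrite ler_pdivlMr// mulrC -xn (le_trans (x_npdf_le x))//; exact: gbound_le.
  have b1 := Kb n.+1%:R (ger0_norm (ltW n0)).
  have b2 := Kb (- n.+1%:R); rewrite normrN (ger0_norm (ltW n0)) in b2; have {}b2 := b2 erefl.
  rewrite sub0r normrN (le_trans (ler_normB _ _))//.
  apply: le_trans (lerD b1 b2) _; rewrite -mulrDl ler_pdivrMr// mulrC -ler_pdivrMr//.
  have -> : C + C = 2 * C by ring.
  by rewrite ltW// (lt_le_trans (truncnS_gt _))// ler_nat.
have Icv : (fun n : nat => (\int[mu]_(x in `[(- n.+1%:R)%R, n.+1%:R%R]) (k x)%:E)%E) @ \oo --> (\int[mu]_x (k x)%:E)%E.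
  pose kn (n : nat) := (fun x => (k x)%:E) \_ `[- n.+1%:R, n.+1%:R].
  have [|||||_ _] := @dominated_convergence _ _ _ mu setT measurableT kn (EFin \o k) (abse \o (EFin \o k)).

  - move=> n; apply/measurable_restrict => //.
    by apply: measurable_funTS; exact: (measurable_int _ ik).
  - exact: (measurable_int _ ik).
  - apply: nearW => x _; apply: cvg_near_cst; exists (Num.truncn `|x|) => // n /= hn.
    rewrite /kn patchE mem_set//= in_itv/= -ler_norml ltW//.
    by rewrite (lt_le_trans (truncnS_gt _))// ler_nat.
  - exact: integrable_abse.
  - apply: nearW => x n _; rewrite /kn patchE; case: ifP => //= _; rewrite normr0 lee_fin//.
  by under eq_fun do rewrite -integral_mkcond.
have FTC' : (fun n : nat => (\int[mu]_(x in `[(- n.+1%:R)%R, n.+1%:R%R]) (k x)%:E)%E)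
    = (fun n : nat => (K n.+1%:R - K (- n.+1%:R))%:E) by apply/funext => n; rewrite FTC EFinB.
rewrite /Rintegral; rewrite FTC' in Icv.
have K1 : (fun n : nat => (K n.+1%:R - K (- n.+1%:R))%:E) @ \oo --> 0%:E.
  by apply: cvg_EFin => //; exact: nearW.
by rewrite (cvg_unique _ Icv K1).
Qed.

Lemma Iphi_derive (t : R) : is_derive t 1 Iphi (- t * Iphi t).
Proof.
pose f (t x : R) := u (t * x) * npdf x.
have f_derive (s x : R) : is_derive s 1 (f ^~ x) (x * du (s * x) * npdf x).
  have h1 : is_derive s 1 (fun z : R => z * x) x.
    have := is_deriveM (is_derive_id s (1 : R)) (is_derive_cst (x : R) s 1).
    by rewrite scaler0 add0r /GRing.scale/= mulr1.
  have h2 := @is_derive_comp _ (fun z : R => z * x) s _ _ (u_derive (s * x)) h1.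
  apply: is_derive_eq (is_deriveM h2 (is_derive_cst (npdf x : R) s 1)) _.
  by rewrite scaler0 add0r /GRing.scale/=; ring.
have d1E s x : partial1of2 f s x = x * du (s * x) * npdf x.
  by rewrite partial1of2E; apply: derive_val.
have It : `]t - 1, t + 1[%classic t by rewrite /= in_itv/=; lra.
have H1 s : `]t - 1, t + 1[%classic s -> mu.-integrable setT (EFin \o f s).
  by move=> _; exact: integrable_trig_npdf.
have H2 s x : `]t - 1, t + 1[%classic s -> [set: R] x -> derivable (f ^~ x) s 1.
  by move=> _ _; have := f_derive s x.
have H3 x : 0 <= gbound x by rewrite mulr_ge0 ?normal_peak_ge0 ?expR_ge0.
have H4 s x : `]t - 1, t + 1[%classic s -> [set: R] x -> `|partial1of2 f s x| <= gbound x.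
  move=> _ _; rewrite d1E !normrM (ger0_norm (npdf_ge0 x)) (le_trans _ (x_npdf_le x))//.
  by rewrite ler_wpM2r ?npdf_ge0// ler_piMr.
have dF := derivable_under_integral measurableT It H1 H2 H3 gbound_integrable H4.
have eF := differentiation_under_integral measurableT It H1 H2 H3 gbound_integrable H4.
apply: DeriveDef; first exact: dF.
rewrite -derive1E [LHS]eF -parts; congr Rintegral.
by apply/funext => x; rewrite d1E.
Qed.

(** By [Iphi_derive] the product with $e^{t^2/2}$ has derivative zero. *)
Lemma IphiE t : Iphi t = u 0 * expR (- (t ^+ 2 / 2)).
Proof.
pose Hf s := expR (s ^+ 2 / 2) * Iphi s.
have H_derive (s : R) : is_derive s 1 Hf 0.
  have h1 : is_derive s 1 (fun z : R => z ^+ 2 / 2) s.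
    have h := is_derive_sqr s; have h2 := is_deriveM h (is_derive_cst (2^-1 : R) s 1).
    by apply: is_derive_eq h2 _; rewrite scaler0 add0r /GRing.scale/=; field.
  have h2 := @is_derive_comp _ (fun z : R => z ^+ 2 / 2) s _ _ (is_derive_expR (s ^+ 2 / 2)) h1.
  apply: is_derive_eq (is_deriveM h2 (Iphi_derive s)) _.
  by rewrite /GRing.scale/=; ring.
have := is_derive_0_is_cst t 0 H_derive.
have I0 : Iphi 0 = u 0.
  rewrite /Iphi; under eq_Rintegral do rewrite mul0r.
  rewrite RintegralZl//; last exact: integrable_normal_pdf.
  by rewrite /Rintegral integral_normal_pdf mulr1.
rewrite /Hf expr0n/= mul0r expR0 mul1r I0 => h.
by rewrite -h mulrC mulrA -expRD addNr expR0 mul1r.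
Qed.

End Trig.

Lemma integral_normal_prob01 (f : R -> R) : measurable_fun setT f -> (forall x, `|f x| <= 1) ->
  Ex (normal_prob 0 1) f = \int[mu]_x (f x * npdf x).
Proof.
move=> mf f1.
have inf : (normal_prob 0 1).-integrable setT (EFin \o f).
  exact: (@L1_bounded _ _ _ (normal_prob 0 1) f 1 mf f1).
congr fine.
rewrite -(Radon_Nikodym_change_of_variables (normal_prob_dominates 0 1))//=.
apply: ae_eq_integral => //.
- apply: emeasurable_funM; first exact/measurable_EFinP.
  by apply: (measurable_int mu); apply: Radon_Nikodym_integrable; exact: normal_prob_dominates.
- by apply/measurable_EFinP; apply: measurable_funM => //; exact: npdf_measurable.
- under [X in ae_eq _ _ _ X]eq_fun do rewrite EFinM.
  apply: ae_eqe_mul2l => /=.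
  rewrite Radon_NikodymE//=; first exact: normal_prob_dominates.
  move=> abmu; case: cid => /= h [h1 h2 h3].
  apply: integral_ae_eq => //=.
  + by apply/measurable_EFinP; exact: npdf_measurable.
  + by move=> E E01 mE; rewrite -h3.
Qed.

Lemma normal_cos t : Ex (normal_prob 0 1) (fun x : R => cos (t * x)) = expR (- (t ^+ 2 / 2)).
Proof.
rewrite integral_normal_prob01.
- transitivity (Iphi (@cos R) t) => //.
  rewrite (@IphiE cos (fun x => - sin x)) ?cos0 ?mul1r// => x.
  + exact: cos_norm_le1.
  + by rewrite normrN sin_norm_le1.
- by have [] := bdd_meas_cos t.
- by move=> x; exact: cos_norm_le1.
Qed.

Lemma normal_sin t : Ex (normal_prob 0 1) (fun x : R => sin (t * x)) = 0.
Proof.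
rewrite integral_normal_prob01.
- transitivity (Iphi (@sin R) t) => //.
  rewrite (@IphiE sin cos) ?sin0 ?mul0r// => x.
  + exact: sin_norm_le1.
  + exact: cos_norm_le1.
- by have [] := bdd_meas_sin t.
- by move=> x; exact: sin_norm_le1.
Qed.

End GaussianCharacteristicFunction.

(** * Expectations of products on a product space *)

Section ProductExpectation.
Variables (R : realType) (d1 d2 : measure_display).
Variables (T1 : measurableType d1) (T2 : measurableType d2).
Variables (Q1 : probability T1 R) (Q2 : probability T2 R).

Lemma Ex_prod (f : T1 -> R) (g : T2 -> R) C D :
  measurable_fun setT f -> measurable_fun setT g ->
  (forall x, `|f x| <= C) -> (forall y, `|g y| <= D) ->
  Ex (Q1 \x Q2)%E (fun z => f z.1 * g z.2) = Ex Q1 f * Ex Q2 g.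
Proof.
move=> mf mg fC gD.
have iF : L1 (Q1 \x Q2)%E (fun z => f z.1 * g z.2).
  apply: (@L1_bounded _ _ _ _ _ (C * D)) => [|z].
    apply: measurable_funM; first exact: measurableT_comp mf measurable_fst.
    exact: measurableT_comp mg measurable_snd.
  by rewrite normrM ler_pM.
have ig : L1 Q2 g by exact: L1_bounded gD.
have i_f : L1 Q1 f by exact: L1_bounded fC.
have h := integral12_prod_meas1 iF.
have e1 x : fubini_F Q2 (EFin \o (fun z : T1 * T2 => f z.1 * g z.2)) x = (Ex Q2 g * f x)%:E.
  rewrite /fubini_F/= mulrC -(ExZ (f x) ig) -ExE ?unlock//; exact: L1Z.
rewrite {1}/Ex /Rintegral -h (eq_integral (fun x => (Ex Q2 g * f x)%:E)); last by move=> x _; exact: e1.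
have := ExE (L1Z (Ex Q2 g) i_f); rewrite unlock => ->.
by rewrite /= ExZ// mulrC.
Qed.

End ProductExpectation.

(** * Existence of Gaussian vectors with given covariance *)

Section GaussianVector.
Variable R : realType.

Definition is_char d (dd : measure_display) (Om : measurableType dd) (Q : probability Om R)
    (W : Om -> 'cV[R]_d) (q : 'cV[R]_d -> R) :=
  (forall i, measurable_fun setT (fun w => W w i 0)) /\
  forall t, Ex Q (fun w => cos (dot t (W w))) = expR (- (q t / 2)) /\
            Ex Q (fun w => sin (dot t (W w))) = 0.

Lemma measurable_dot d (dd : measure_display) (Om : measurableType dd) (W : Om -> 'cV[R]_d) t :
  (forall i, measurable_fun setT (fun w => W w i 0)) ->
  measurable_fun setT (fun w => dot t (W w)).
Proof.
by move=> mW; apply: measurable_sum => i; apply: measurable_funM.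
Qed.

Lemma measurable_cosdot d (dd : measure_display) (Om : measurableType dd) (W : Om -> 'cV[R]_d) t :
  (forall i, measurable_fun setT (fun w => W w i 0)) ->
  measurable_fun setT (fun w => cos (dot t (W w))) /\
  measurable_fun setT (fun w => sin (dot t (W w))).
Proof.
by move=> mW; split; [apply: measurable_cos|apply: measurable_sin]; exact: measurable_dot.
Qed.

(** Each step multiplies the space by one more normal coordinate. In the addition formulas every
    product containing a sine has mean zero. In dimension 0 any probability space would do. *)
Lemma standard_gaussian d : exists (dd : measure_display) (Om : measurableType dd)
  (Q : probability Om R) (N : Om -> 'cV[R]_d), is_char Q N (@nsq R d).
Proof.
elim: d => [|d [dd [Om [Q [N [mN hN]]]]]].
  exists _, _, (normal_prob (0 : R) 1), (fun=> 0); split => [[]//|t].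
  rewrite /dot big_ord0 cos0 sin0 !Ex_cst /nsq big_ord0 mul0r oppr0 expR0.
  by split.
exists _, _, (normal_prob (0 : R) 1 \x Q)%E,
  (fun z => \col_i if unlift ord0 i is Some j then N z.2 j 0 else z.1); split.
  move=> i; case: (unliftP ord0 i) => [j|] ->.
    under eq_fun do rewrite mxE liftK.
    by apply: measurableT_comp (mN j) _; exact: measurable_snd.
  under eq_fun do rewrite mxE unlift_none.
  exact: measurable_fst.
move=> t; pose t' : 'cV[R]_d := \col_j t (lift ord0 j) 0.
have dE z : dot t (\col_i if unlift ord0 i is Some j then N z.2 j 0 else z.1) =
    t ord0 0 * z.1 + dot t' (N z.2).
  rewrite /dot big_ord_recl mxE unlift_none; congr (_ + _).
  by apply: eq_bigr => j _; rewrite !mxE liftK.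
have qE : nsq t = t ord0 0 ^+ 2 + nsq t'.
  by rewrite /nsq big_ord_recl; congr (_ + _); apply: eq_bigr => j _; rewrite mxE.
set a := t ord0 0 in dE qE *.
have [hc hs] := hN t'; have [mc ms] := measurable_cosdot t' mN.
have mc1 : measurable_fun setT (fun x : R => cos (a * x)).
  by apply: measurable_cos; exact: measurable_funM.
have ms1 : measurable_fun setT (fun x : R => sin (a * x)).
  by apply: measurable_sin; exact: measurable_funM.
pose b1 (x : R) := cos_norm_le1 (a * x); pose b2 (x : R) := sin_norm_le1 (a * x).
pose b3 (w : Om) := cos_norm_le1 (dot t' (N w)); pose b4 (w : Om) := sin_norm_le1 (dot t' (N w)).
have L (f : measurableTypeR R -> R) (g : Om -> R) : measurable_fun setT f -> measurable_fun setT g ->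
  (forall x, `|f x| <= 1) -> (forall x, `|g x| <= 1) ->
  L1 (normal_prob (0 : R) 1 \x Q)%E (fun z => f z.1 * g z.2).
  move=> mf mg f1 g1; apply: (@L1_bounded _ _ _ _ _ 1) => [|z].
    apply: measurable_funM; first exact: measurableT_comp mf measurable_fst.
    exact: measurableT_comp mg measurable_snd.
  by rewrite normrM mulr_ile1.
split.
  have E1 z : cos (dot t (\col_i if unlift ord0 i is Some j then N z.2 j 0 else z.1)) =
     cos (a * z.1) * cos (dot t' (N z.2)) - sin (a * z.1) * sin (dot t' (N z.2)).
    by rewrite dE cosD.
  transitivity (Ex (normal_prob (0 : R) 1 \x Q)%E (fun z =>
      cos (a * z.1) * cos (dot t' (N z.2)) - sin (a * z.1) * sin (dot t' (N z.2)))).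
    by apply: Ex_ext => z; exact: E1.
  rewrite ExB; [|exact: (L _ _ mc1 mc b1 b3)|exact: (L _ _ ms1 ms b2 b4)].
  transitivity (expR (- (a ^+ 2 / 2)) * expR (- (nsq t' / 2)) -
      Ex (normal_prob (0 : R) 1) (fun x : R => sin (a * x)) * 0).
    congr (_ - _).
      by etransitivity; [exact: (@Ex_prod R _ _ _ _ (normal_prob (0 : R) 1) Q (fun x : R => cos (a * x)) _ 1 1 mc1 mc b1 b3)|rewrite hc normal_cos].
    by etransitivity; [exact: (@Ex_prod R _ _ _ _ (normal_prob (0 : R) 1) Q (fun x : R => sin (a * x)) _ 1 1 ms1 ms b2 b4)|rewrite hs].
  rewrite mulr0 subr0.
  by rewrite -expRD qE; congr expR; rewrite mulrDl opprD.
have E1 z : sin (dot t (\col_i if unlift ord0 i is Some j then N z.2 j 0 else z.1)) =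
   sin (a * z.1) * cos (dot t' (N z.2)) + cos (a * z.1) * sin (dot t' (N z.2)).
  by rewrite dE sinD.
transitivity (Ex (normal_prob (0 : R) 1 \x Q)%E (fun z =>
    sin (a * z.1) * cos (dot t' (N z.2)) + cos (a * z.1) * sin (dot t' (N z.2)))).
  by apply: Ex_ext => z; exact: E1.
rewrite ExD; [|exact: (L _ _ ms1 mc b2 b3)|exact: (L _ _ mc1 ms b1 b4)].
transitivity (0 * Ex Q (fun w => cos (dot t' (N w))) +
    Ex (normal_prob (0 : R) 1) (fun x : R => cos (a * x)) * 0); last by rewrite mul0r mulr0 addr0.
congr (_ + _).
  by etransitivity; [exact: (@Ex_prod R _ _ _ _ (normal_prob (0 : R) 1) Q (fun x : R => sin (a * x)) _ 1 1 ms1 mc b2 b3)|rewrite normal_sin].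
by etransitivity; [exact: (@Ex_prod R _ _ _ _ (normal_prob (0 : R) 1) Q (fun x : R => cos (a * x)) _ 1 1 mc1 ms b1 b4)|rewrite hs].
Qed.

Lemma dot_col_mx m n (u u' : 'cV[R]_m) (v v' : 'cV[R]_n) :
  dot (col_mx u v) (col_mx u' v') = dot u u' + dot v v'.
Proof.
rewrite /dot big_split_ord/=; congr (_ + _); apply: eq_bigr => i _.
  by rewrite !col_mxEu.
by rewrite !col_mxEd.
Qed.

(* When the pivot [a] vanishes so does the column [b] below it, and the junk values
   [a^-1 = 0] and [(Num.sqrt a)^-1 = 0] keep the formulas of the case [a > 0] valid. *)
Lemma cholesky n (C : 'M[R]_n) : C^T = C -> (forall t, 0 <= dot t (C *m t)) ->
  exists L : 'M[R]_n, L *m L^T = C.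
Proof.
elim: n C => [|n IH] C symC psdC; first by exists 0; rewrite flatmx0; apply/esym; rewrite flatmx0.
change 'M[R]_(1 + n) in C; change (forall t : 'cV[R]_(1 + n), 0 <= dot t (C *m t)) in psdC; change (exists L : 'M[R]_(1 + n), L *m L^T = C).
pose a := C (lshift n 0) (lshift n 0).
pose b : 'cV[R]_n := dlsubmx C; pose D := drsubmx C.
have CE : C = block_mx a%:M b^T b D.
  rewrite -[LHS](submxK C); congr block_mx.
    by apply/matrixP => i j; rewrite !ord1 !mxE/= ?eqxx ?mulr1n.
  by rewrite /b trmx_dlsub symC.
have DT : D^T = D by rewrite /D trmx_drsub symC.
have form s v : dot (col_mx s%:M v) (C *m col_mx s%:M v) =
    a * s ^+ 2 + 2 * s * dot b v + dot v (D *m v).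
  rewrite CE mul_block_col dot_col_mx !dotDr.
  have -> : b *m s%:M = s *: b by rewrite mul_mx_scalar.
  have d1 (u w : 'cV[R]_1) : dot u w = u 0 0 * w 0 0 by rewrite /dot big_ord_recl big_ord0 addr0.
  rewrite !d1 -scalar_mxM dotE !mxE/= ?eqxx ?mulr1n dotZr (dotC v b); ring.
have a0 : 0 <= a.
  have := psdC (@col_mx R 1 n 1 1%:M 0); rewrite form mulmx0 expr1n mulr1.
  by rewrite /dot !big1 => [|i _|i _]; rewrite ?mxE ?mulr0 ?mul0r ?addr0.
have sa : Num.sqrt a * Num.sqrt a = a by rewrite -expr2 sqr_sqrtr.
have bE : Num.sqrt a *: ((Num.sqrt a)^-1 *: b) = b.
  have [a_eq0|an0] := eqVneq a 0; last first.
    by rewrite scalerA mulfV ?scale1r// gt_eqF// sqrtr_gt0 lt_def an0.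
  suff -> : b = 0 by rewrite !scaler0.
  have e0 : dot (@col_mx R 1 n 1 1%:M 0) (C *m @col_mx R 1 n 1 1%:M 0) = 0.
    rewrite form mulmx0 a_eq0 mul0r add0r.
    by rewrite /dot !big1 => [|i _|i _]; rewrite ?mxE ?mulr0 ?mul0r ?addr0.
  have : C *m @col_mx R 1 n 1 1%:M 0 = 0 by exact: psd_ker.
  rewrite CE mul_block_col => /(congr1 dsubmx).
  by rewrite col_mxKd mulmx0 addr0 mulmx1 linear0.
(* The Schur complement of the pivot. Its form at [v] is the form of [C] at [v] completed by the
   coordinate [- (a^-1 * dot b v)], the minimizing one when [a] is positive. *)
pose D' := D - a^-1 *: (b *m b^T).
have D'T : D'^T = D' by rewrite /D' linearB/= linearZ/= trmx_mul trmxK DT.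
have D'psd v : 0 <= dot v (D' *m v).
  have bbv : dot v (a^-1 *: (b *m b^T) *m v) = a^-1 * dot b v ^+ 2.
    rewrite -scalemxAl dotZr -mulmxA; congr (_ * _).
    have -> : b^T *m v = (dot b v)%:M by apply/matrixP => i j; rewrite !ord1 dotE mxE/= mulr1n.
    by rewrite mul_mx_scalar dotZr dotC expr2.
  have := psdC (col_mx (- (a^-1 * dot b v))%:M v); rewrite form mulmxBl dotDr dotNr bbv.
  have [->|an0] := eqVneq a 0; first by rewrite invr0 !mul0r oppr0 !mulr0 !mul0r !add0r addr0.
  suff -> : a * (- (a^-1 * dot b v)) ^+ 2 + 2 * - (a^-1 * dot b v) * dot b v = - (a^-1 * dot b v ^+ 2).
    by rewrite addrC.
  by field.
have [L hL] := IH D' D'T D'psd.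
exists (block_mx (Num.sqrt a)%:M 0 ((Num.sqrt a)^-1 *: b) L).
rewrite tr_block_mx mulmx_block tr_scalar_mx trmx0 !mulmx0 !mul0mx !addr0 -scalar_mxM sa CE.
congr block_mx.
- by rewrite mul_scalar_mx -linearZ/= bE.
- by rewrite mul_mx_scalar.
- rewrite hL /D' linearZ/= -scalemxAl -scalemxAr scalerA -invfM sa.
  by rewrite addrCA subrr addr0.
Qed.

Lemma gaussian_exists n (C : 'M[R]_n) : C^T = C -> (forall t, 0 <= dot t (C *m t)) ->
  exists (dd : measure_display) (Om : measurableType dd) (Q : probability Om R)
    (W : Om -> 'cV[R]_n), is_char Q W (fun t => dot t (C *m t)).
Proof.
move=> symC psdC; have [L hL] := cholesky symC psdC.
have [dd [Om [Q [N [mN hN]]]]] := standard_gaussian n.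
exists dd, Om, Q, (fun w => L *m N w); split => [i|t].
  under eq_fun do rewrite mxE.
  by apply: measurable_sum => j; apply: measurable_funM.
have dE w : dot t (L *m N w) = dot (L^T *m t) (N w) by rewrite dotC dot_mulmx dotC.
have [hc hs] := hN (L^T *m t).
have qE : nsq (L^T *m t) = dot t (C *m t) by rewrite -dotvv dot_mulmx trmxK mulmxA hL.
split; last by rewrite -hs; apply: Ex_ext => w; rewrite dE.
by rewrite -qE -hc; apply: Ex_ext => w; rewrite dE.
Qed.

End GaussianVector.

(** * Moments of the binomial weights *)

Section Bernstein.
Variable R : realType.
Implicit Types q : R.

(* Bernstein basis polynomial, as the law of N Bernoulli(q) trials by conditioning on the last one. *)
Fixpoint bern (N k : nat) q : R :=
  if N is N'.+1 then q * (if k is k'.+1 then bern N' k' q else 0) + (1 - q) * bern N' k q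
  else (k == 0%N)%:R.

Lemma bern_ge0 N k q : 0 <= q <= 1 -> 0 <= bern N k q.
Proof.
move=> /andP[q0 q1]; elim: N k => [|N IH] [|k] //=.
  by rewrite mulr0 add0r mulr_ge0// subr_ge0.
by rewrite addr_ge0 ?mulr_ge0// subr_ge0.
Qed.

Lemma bern_gt N k q : (N < k)%N -> bern N k q = 0.
Proof.
elim: N k => [|N IH] [|k] //= Nk.
by rewrite !IH// ?mulr0 ?addr0// ltnW.
Qed.

Lemma bern_sumS N q (f : nat -> R) : \sum_(k < N.+2) f k * bern N.+1 k q =
  q * (\sum_(k < N.+1) f k.+1 * bern N k q) + (1 - q) * (\sum_(k < N.+1) f k * bern N k q).
Proof.
under eq_bigr do rewrite /= mulrDr.
rewrite big_split/=; congr (_ + _).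
  rewrite big_ord_recl/= !mulr0 add0r mulr_sumr; apply: eq_bigr => k _.
  by rewrite /bump/= add1n; ring.
rewrite big_ord_recr/= bern_gt// !mulr0 addr0 mulr_sumr; apply: eq_bigr => k _; ring.
Qed.

(** Conditioning on the last trial replaces [k] by [k + 1] in one term, which maps quadratics to
    quadratics; the induction therefore runs over all coefficients at once. *)
Lemma bern_moments N q a b c :
  \sum_(k < N.+1) (a * k%:R ^+ 2 + b * k%:R + c) * bern N k q =
  a * (N%:R * q * (1 - q) + N%:R ^+ 2 * q ^+ 2) + b * (N%:R * q) + c.
Proof.
elim: N a b c => [|N IH] a b c.
  by rewrite big_ord_recl big_ord0 /= mulr1; ring.
rewrite (bern_sumS N q (fun k => a * k%:R ^+ 2 + b * k%:R + c)) IH.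
rewrite (eq_bigr (fun k : 'I_N.+1 => (a * k%:R ^+ 2 + (2 * a + b) * k%:R + (a + b + c)) * bern N k q)).
  2: by move=> k _; rewrite -!natr1; congr (_ * _); ring.
by rewrite IH -natr1; ring.
Qed.

Lemma bern_sum1 N q : \sum_(k < N.+1) bern N k q = 1.
Proof.
have := bern_moments N q 0 0 1; rewrite !mul0r !add0r => <-.
by apply: eq_bigr => k _; rewrite !mul0r !add0r mul1r.
Qed.

Lemma bern_var N q : 0 <= q <= 1 ->
  \sum_(k < N.+2) (k%:R / N.+1%:R - q) ^+ 2 * bern N.+1 k q <= N.+1%:R^-1.
Proof.
move=> /andP[q0 q1]; set n : R := N.+1%:R.
have n0 : n != 0 by rewrite pnatr_eq0.
have := bern_moments N.+1 q (n ^- 2) (- 2 * q / n) (q ^+ 2).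
rewrite (eq_bigr (fun k : 'I_N.+2 => (k%:R / n - q) ^+ 2 * bern N.+1 k q)) => [->|k _]; last first.
  by congr (_ * _); field.
have -> : n ^- 2 * (n * q * (1 - q) + n ^+ 2 * q ^+ 2) + - 2 * q / n * (n * q) + q ^+ 2 =
   n^-1 * (q * (1 - q)) by field.
rewrite ler_piMr ?invr_ge0 ?ler0n// mulr_ile1// ?subr_ge0//.
by rewrite lerBlDr lerDl.
Qed.

End Bernstein.

(** * Trigonometric polynomials and approximation on boxes *)

Section TrigPolynomials.
Variables (R : realType) (d : nat).
Local Notation vec := 'cV[R]_d.

(** The span of the functions whose means are the real and imaginary parts of the characteristic
    function. It is an algebra by the addition formulas. *)
Inductive tp : (vec -> R) -> Prop :=
| tp_cos t : tp (fun v => cos (dot t v))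
| tp_sin t : tp (fun v => sin (dot t v))
| tp_add f g : tp f -> tp g -> tp (fun v => f v + g v)
| tp_scale a f : tp f -> tp (fun v => a * f v).

Lemma tp_ext f g : tp f -> (forall v, f v = g v) -> tp g.
Proof. by move=> tf fg; rewrite -(funext fg). Qed.

Lemma tp_cst a : tp (fun=> a).
Proof.
apply: tp_ext (tp_scale a (tp_cos 0)) _ => v.
by rewrite /dot big1 ?cos0 ?mulr1// => i _; rewrite mxE mul0r.
Qed.

Lemma tp_mul f g : tp f -> tp g -> tp (fun v => f v * g v).
Proof.
move=> tf; elim: tf g => {f} [s|s|f1 f2 _ h1 _ h2|a f _ h] g tg; last 2 first.
- by apply: tp_ext (tp_add (h1 _ tg) (h2 _ tg)) _ => v; rewrite mulrDl.
- by apply: tp_ext (tp_scale a (h _ tg)) _ => v; rewrite mulrA.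
- elim: tg => {g} [t|t|g1 g2 _ h1 _ h2|a g _ h]; last 2 first.
  + by apply: tp_ext (tp_add h1 h2) _ => v; rewrite mulrDr.
  + by apply: tp_ext (tp_scale a h) _ => v; rewrite mulrCA.
  + apply: tp_ext (tp_scale 2^-1 (tp_add (tp_cos (s + t)) (tp_cos (s - t)))) _ => v.
    by rewrite !dotDl dotNl !cosD cosN sinN; field.
  + apply: tp_ext (tp_scale 2^-1 (tp_add (tp_sin (s + t)) (tp_scale (-1) (tp_sin (s - t))))) _ => v.
    by rewrite !dotDl dotNl !sinD cosN sinN; field.
- elim: tg => {g} [t|t|g1 g2 _ h1 _ h2|a g _ h]; last 2 first.
  + by apply: tp_ext (tp_add h1 h2) _ => v; rewrite mulrDr.
  + by apply: tp_ext (tp_scale a h) _ => v; rewrite mulrCA.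
  + apply: tp_ext (tp_scale 2^-1 (tp_add (tp_sin (s + t)) (tp_sin (s - t)))) _ => v.
    by rewrite !dotDl dotNl !sinD cosN sinN; field.
  + apply: tp_ext (tp_scale 2^-1 (tp_add (tp_cos (s - t)) (tp_scale (-1) (tp_cos (s + t))))) _ => v.
    by rewrite !dotDl dotNl !cosD cosN sinN; field.
Qed.

Lemma tp_sum (I : Type) (s : seq I) (F : I -> vec -> R) :
  (forall i, tp (F i)) -> tp (fun v => \sum_(i <- s) F i v).
Proof.
move=> tF; elim: s => [|i s IH].
  by apply: tp_ext (tp_cst 0) _ => v; rewrite big_nil.
by apply: tp_ext (tp_add (tF i) IH) _ => v; rewrite big_cons.
Qed.

Lemma tp_prod (I : Type) (s : seq I) (F : I -> vec -> R) :
  (forall i, tp (F i)) -> tp (fun v => \prod_(i <- s) F i v).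
Proof.
move=> tF; elim: s => [|i s IH].
  by apply: tp_ext (tp_cst 1) _ => v; rewrite big_nil.
by apply: tp_ext (tp_mul (tF i) IH) _ => v; rewrite big_cons.
Qed.

Lemma tp_bern (q : vec -> R) N k : tp q -> tp (fun v => bern N k (q v)).
Proof.
move=> tq; have t1q : tp (fun v => 1 - q v).
  by apply: tp_ext (tp_add (tp_cst 1) (tp_scale (-1) tq)) _ => v; rewrite mulN1r.
elim: N k => [|N IH] k /=; first exact: tp_cst.
apply: tp_add; apply: tp_mul => //.
by case: k => [|k]; [exact: tp_cst|exact: IH].
Qed.

Lemma tp_measurable (dd : measure_display) (Om : measurableType dd) (W : Om -> vec) f :
  (forall i, measurable_fun setT (fun w => W w i 0)) -> tp f ->
  measurable_fun setT (fun w => f (W w)).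
Proof.
move=> mW; elim=> [t|t|f1 f2 _ h1 _ h2|a f1 _ h1].
- exact: (measurable_cosdot t mW).1.
- exact: (measurable_cosdot t mW).2.
- exact: measurable_funD.
- exact: measurable_funM.
Qed.

Lemma tp_bounded f : tp f -> exists C, forall v, `|f v| <= C.
Proof.
elim=> [t|t|f1 f2 _ [C h1] _ [D h2]|a f1 _ [C h1]].
- by exists 1 => v; exact: cos_norm_le1.
- by exists 1 => v; exact: sin_norm_le1.
- by exists (C + D) => v; rewrite (le_trans (ler_normD _ _))// lerD.
- by exists (`|a| * C) => v; rewrite normrM ler_wpM2l.
Qed.

(** Heine-Cantor by contradiction. Only [u] is confined to the box, since [v] will be a grid point
    that may lie outside it. Compactness of boxes is used for row vectors, hence the transposes. *)
Lemma box_ucont (g : vec -> R) (L eps : R) : continuous g -> 0 < eps ->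
  exists2 del : R, 0 < del & forall u v : vec, (forall i, `|u i 0| <= L) ->
    (forall i, `|u i 0 - v i 0| < del) -> `|g u - g v| <= eps.
Proof.
move=> cg e0; apply: contrapT => /forall2NP no.
have {}no n : exists uv : vec * vec, [/\ forall i, `|uv.1 i 0| <= L,
    forall i, `|uv.1 i 0 - uv.2 i 0| < n.+1%:R^-1 & eps < `|g uv.1 - g uv.2|].
  have [/negP|h] := no n.+1%:R^-1; first by rewrite invr_gt0 ltr0Sn.
  apply: contrapT => h2; apply: h => u v uL uv; rewrite leNgt; apply/negP => guv.
  by apply: h2; exists (u, v).
have [f hf] := choice no.
have := @rV_compact R d (fun=> `[- L, L]%classic) (fun=> @segment_compact R (- L) L).
move=> /(_ ((fun n => (f n).1^T) @ \oo) _) [].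
  exists 0%N => // n _ /= i; have [h _ _] := hf n.
  by rewrite mxE in_itv/= -ler_norml.
move=> p [_ clp].
have /(_ p^T) := cg; move=> /cvgr_dist_lt /(_ (eps / 2)) /(_ (divr_gt0 e0 (ltr0Sn _ 1))).
move=> /nbhs_ballP [r /= r0 hr].
(* The index [n] has its first point within [r / 2] of the cluster point and [n.+1^-1] at most
   [r / 2], so both points of the pair fall into the ball of radius [r]. *)
have [||z [[n /= hn zn] [_ /= zr]]] := clp ((fun n => (f n).1^T) @` [set n | (Num.truncn (2 / r) <= n)%N]) (ball p (r / 2)).
- by exists (Num.truncn (2 / r)) => // n /= hn; exists n.
- by apply: nbhsx_ballx; rewrite divr_gt0.
have [_ huv] := hf n; rewrite ltNge => /negP; apply.
have n_r : n.+1%:R^-1 <= r / 2.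
  rewrite -[r / 2]invrK lef_pV2 ?posrE ?invr_gt0 ?divr_gt0// invf_div.
  by rewrite ltW// (lt_le_trans (truncnS_gt _))// ler_nat.
have b1 : ball p^T r (f n).1.
  split => // i j; rewrite ord1 mxE /ball/=.
  have := zr 0 i; rewrite -zn mxE /ball/= => h; apply: lt_le_trans h _; lra.
have b2 : ball p^T r (f n).2.
  split => // i j; rewrite ord1 mxE /ball/=.
  have := zr 0 i; rewrite -zn mxE /ball/= => h.
  have := huv i => h2; rewrite (le_lt_trans (ler_distD ((f n).1 i 0) _ _))//.
  by apply: lt_le_trans (ltrD h (lt_le_trans h2 n_r)) _; lra.
have := hr _ b1; have := hr _ b2 => /= c2 c1.
rewrite (le_trans (ler_distD (g p^T) _ _))// distrC ltW// (lt_le_trans (ltrD c1 c2))//.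
by rewrite -splitr.
Qed.

(** Quantitative injectivity of the sine through $\sin a-\sin b=2\sin\frac{a-b}2\cos\frac{a+b}2$.
    Since $\frac12\le\frac\pi4$, both $|a+b|$ and $|a-b|$ are at most $\frac{3\pi}4$, which is the
    origin of $\cos\frac{3\pi}8$. *)
Lemma sin_separation (a b h : R) : `|a| <= 2^-1 -> `|b| <= pi / 2 -> 0 < h <= 1 -> h <= `|a - b| ->
  cos (3 * pi / 8) * sin (h / 2) <= `|sin a - sin b| / 2.
Proof.
move=> ha hb /andP[h0 h1] hab.
have p2 := pi_ge2 R.
have -> : sin a - sin b = 2 * (sin ((a - b) / 2) * cos ((a + b) / 2)).
  have e1 : sin a = sin ((a + b) / 2 + (a - b) / 2) by congr sin; field.
  have e2 : sin b = sin ((a + b) / 2 - (a - b) / 2) by congr sin; field.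
  by rewrite e1 e2 sinB sinD; ring.
rewrite normrM (ger0_norm (ler0n R 2)) [2 * _]mulrC mulfK ?pnatr_eq0// normrM mulrC.
have c1 : `|a + b| <= 3 * pi / 4 by rewrite (le_trans (ler_normD _ _))//; lra.
have c2 : `|a - b| <= 3 * pi / 4 by rewrite (le_trans (ler_normB _ _))//; lra.
have s0 : 0 <= sin (h / 2) by apply: sin_ge0_pi; apply/andP; split; lra.
have k0 : 0 <= cos (3 * pi / 8) :> R by apply: cos_ge0_pihalf; apply/andP; split; lra.
have sabs (x : R) : `|sin `|x| | = `|sin x|.
  by have [|] := leP 0 x => h'; rewrite ?(ger0_norm h')// (ltr0_norm h') sinN normrN.
have cabs (x : R) : cos `|x| = cos x.
  by have [|] := leP 0 x => h'; rewrite ?(ger0_norm h')// (ltr0_norm h') cosN.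
have h2 (x : R) : `|x / 2| = `|x| / 2 by rewrite normrM [X in _ * X]ger0_norm ?invr_ge0.
apply: ler_pM => //.
  rewrite -sabs h2; apply: le_trans (ler_norm _).
  rewrite leNgt ltr_sin ?in_itv/=; [by rewrite -leNgt ler_pM2r| |]; apply/andP; split; lra.
rewrite -(cabs ((a + b) / 2)) h2; apply: le_trans (ler_norm _).
have n0 : 0 <= `|a + b| by [].
rewrite leNgt ltr_cos ?in_itv/=; [by rewrite -leNgt; lra| |]; apply/andP; split; lra.
Qed.

(* Bernstein polynomials in [(1 + sin (v_i / (2 L))) / 2]: a trigonometric polynomial that stays
   below [sup |g|] on the whole space while approximating [g] on a box. *)
Lemma trig_approx (g : vec -> R) (M L eps : R) : continuous g -> (forall v, `|g v| <= M) ->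
  0 < L -> 0 < eps -> exists2 f, tp f & (forall v, `|f v| <= M) /\
    forall v : vec, (forall i, `|v i 0| <= L) -> `|g v - f v| <= eps.
Proof.
move=> cg gM L0 e0.
have p2 := pi_ge2 R; have M0 : 0 <= M by rewrite (le_trans _ (gM 0)).
pose a (v : vec) i := v i 0 / (2 * L).
pose q i (v : vec) := (1 + sin (a v i)) / 2.
have q01 i v : 0 <= q i v <= 1.
  have := sin_norm_le1 (a v i); rewrite ler_norml => /andP[h1 h2].
  by apply/andP; split; rewrite /q; lra.
have tq i : tp (q i).
  pose t : vec := \col_j (if j == i then (2 * L)^-1 else 0).
  apply: tp_ext (tp_scale 2^-1 (tp_add (tp_cst 1) (tp_sin t))) _ => v.
  rewrite /q mulrC; congr ((1 + sin _) / _).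
  rewrite /dot (bigD1 i)//= big1 ?addr0 => [|j ji]; first by rewrite mxE eqxx mulrC.
  by rewrite mxE (negPf ji) mul0r.
have [del del0 hdel] := box_ucont L cg (divr_gt0 e0 (ltr0Sn R 1)).
pose h := Num.min (del / (2 * L)) 1.
have h0 : 0 < h by rewrite lt_min ltr01 divr_gt0// mulr_gt0.
have h1 : h <= 1 by rewrite ge_min lexx orbT.
pose kap := cos (3 * pi / 8) * sin (h / 2) : R.
have kap0 : 0 < kap.
  apply: mulr_gt0; [apply: cos_gt0_pihalf|apply: sin_gt0_pi]; apply/andP; split; lra.
(* A grid point that is far from [v] in some coordinate has a squared deviation of at least
   [kap ^+ 2] there, so [K] times the squared deviations covers the trivial bound [2 * M]. *)
pose K := 2 * M / kap ^+ 2; have K0 : 0 <= K by rewrite divr_ge0 ?sqr_ge0// mulr_ge0.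
pose N := Num.truncn (2 * K * d%:R / eps).
have hN : K * (d%:R * N.+1%:R^-1) <= eps / 2.
  have := truncnS_gt (2 * K * d%:R / eps); rewrite -/N ltr_pdivrMr// => hN.
  by rewrite mulrA ler_pdivrMr ?ltr0Sn//; lra.
pose n : R := N.+1%:R;pose idx := {ffun 'I_d -> 'I_N.+2}.
pose b (k : idx) i := asin (2 * (k i)%:R / n - 1).
(* The point at which each [q i] takes the value [k i / n]. *)
pose y (k : idx) : vec := \col_i (2 * L * b k i).
pose w (k : idx) v := \prod_i bern N.+1 (k i) (q i v).
have arg (k : idx) i : -1 <= 2 * (k i)%:R / n - 1 <= 1.
  have k1 : (k i)%:R / n <= 1 by rewrite ler_pdivrMr// mul1r /n ler_nat -ltnS; exact: ltn_ord.
  have k2 : 0 <= (k i)%:R / n by rewrite divr_ge0// ltW.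
  by rewrite -mulrA; move: k1 k2; set z := _ / n => k1 k2; apply/andP; split; lra.
have w0 k v : 0 <= w k v by apply: prodr_ge0 => i _; exact: bern_ge0.
have w1 v : \sum_k w k v = 1.
  rewrite -(bigA_distr_bigA (fun i (j : 'I_N.+2) => bern N.+1 j (q i v))) big1// => i _.
  exact: bern_sum1.
have wvar i v : \sum_(k : idx) ((k i)%:R / n - q i v) ^+ 2 * w k v <= n^-1.
  pose F j (m : 'I_N.+2) := (if j == i then (m%:R / n - q i v) ^+ 2 else 1) * bern N.+1 m (q j v).
  rewrite (eq_bigr (fun k : idx => \prod_j F j (k j))); last first.
    move=> k _; rewrite /F big_split/= (bigD1 i)//= eqxx big1 ?mulr1// => j ji.
    by rewrite (negPf ji).
  rewrite -(bigA_distr_bigA F) (bigD1 i)//= [X in _ * X]big1 ?mulr1.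
    rewrite (eq_bigr (fun m : 'I_N.+2 => (m%:R / n - q i v) ^+ 2 * bern N.+1 m (q i v))).
      exact: bern_var.
    by move=> m _; rewrite /F eqxx.
  move=> j ji; rewrite -[RHS](bern_sum1 N.+1 (q j v)); apply: eq_bigr => m _.
  by rewrite /F (negPf ji) mul1r.
have key (v : vec) (k : idx) : (forall i, `|v i 0| <= L) ->
    `|g v - g (y k)| <= eps / 2 + K * \sum_i ((k i)%:R / n - q i v) ^+ 2.
  move=> vL.
  have S0 : 0 <= K * \sum_i ((k i)%:R / n - q i v) ^+ 2.
    by rewrite mulr_ge0// sumr_ge0// => i _; exact: sqr_ge0.
  have [near|/existsNP[i /negP]] := pselect (forall i, `|v i 0 - y k i 0| < del).
    by rewrite (le_trans (hdel _ _ vL near))// lerDl.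
  rewrite -leNgt => far.
  have b_le : `|b k i| <= pi / 2 by rewrite ler_norml asin_geNpi2 ?asin_lepi2.
  have a_le : `|a v i| <= 2^-1.
    rewrite /a normrM [X in _ * X]ger0_norm ?invr_ge0 ?mulr_ge0 ?(ltW L0)//.
    by rewrite ler_pdivrMr ?mulr_gt0// mulrA mulVf ?mul1r ?pnatr_eq0.
  have sep : h <= `|a v i - b k i|.
    rewrite ge_min; apply/orP; left.
    have -> : a v i - b k i = (v i 0 - y k i 0) / (2 * L).
      by rewrite /a /y mxE; field; rewrite gt_eqF.
    rewrite normrM [X in _ <= _ * X]ger0_norm ?invr_ge0 ?mulr_ge0 ?(ltW L0)//.
    by rewrite ler_pM2r// invr_gt0 mulr_gt0.
  have := sin_separation a_le b_le (introT andP (conj h0 h1)) sep; rewrite -/kap => sq.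
  have qE : `|(k i)%:R / n - q i v| = `|sin (a v i) - sin (b k i)| / 2.
    rewrite /b asinK; last by rewrite in_itv/=.
    have -> : (k i)%:R / n - q i v = - ((sin (a v i) - (2 * (k i)%:R / n - 1)) / 2).
      by rewrite /q; field; rewrite gt_eqF.
    by rewrite normrN normrM (ger0_norm (x := 2^-1)) ?invr_ge0.
  have big : kap ^+ 2 <= \sum_i ((k i)%:R / n - q i v) ^+ 2.
    rewrite (bigD1 i)//= ler_wpDr ?sumr_ge0// => [j _|]; first exact: sqr_ge0.
    by rewrite -[leRHS]real_normK ?num_real// qE lerXn2r// nnegrE// ltW.
  apply: (@le_trans _ _ (2 * M)).
    by rewrite (le_trans (ler_normB _ _))//; have := gM v; have := gM (y k); lra.
  apply: (@le_trans _ _ (K * kap ^+ 2)); first by rewrite /K divfK// sqrf_eq0 gt_eqF.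
  by apply: le_trans (ler_wpM2l K0 big) _; rewrite lerDr ltW// divr_gt0.
exists (fun v => \sum_k g (y k) * w k v).
  by apply: tp_sum => k; apply: tp_scale; apply: tp_prod => i; exact: tp_bern.
split=> v => [|vL].
  rewrite (le_trans (ler_norm_sum _ _ _))// -[leRHS]mulr1 -(w1 v) mulr_sumr.
  by apply: ler_sum => k _; rewrite normrM (ger0_norm (w0 _ _)) ler_wpM2r.
have -> : g v = \sum_k g v * w k v by rewrite -mulr_sumr w1 mulr1.
rewrite -sumrB; apply: le_trans (ler_norm_sum _ _ _) _.
apply: (@le_trans _ _ (\sum_(k : idx) (eps / 2 + K * \sum_i ((k i)%:R / n - q i v) ^+ 2) * w k v)).
  apply: ler_sum => k _; rewrite -mulrBl normrM (ger0_norm (w0 _ _)) ler_wpM2r//.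
  exact: key.
rewrite (eq_bigr (fun k : idx => eps / 2 * w k v + K * \sum_i ((k i)%:R / n - q i v) ^+ 2 * w k v)); last first.
  by move=> k _; rewrite mulrDl -(mulrA K) mulr_suml.
rewrite big_split/= -mulr_sumr w1 mulr1 -mulr_sumr exchange_big/= [leRHS]splitr lerD2l.
apply: le_trans hN; rewrite ler_wpM2l//.
have -> : d%:R * N.+1%:R^-1 = \sum_(i < d) n^-1 by rewrite sumr_const card_ord mulr_natl.
by apply: ler_sum => i _; exact: wvar.
Qed.

End TrigPolynomials.

(** * From characteristic functions to convergence in law *)

Section WeakConvergence.
Variables (R : realType) (d : nat).
Variables (dd : measure_display) (Om : measurableType dd) (P : probability Om R).
Variables (dd' : measure_display) (Om' : measurableType dd') (Q : probability Om' R).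
Variables (Wn : nat -> Om -> 'cV[R]_d) (W : Om' -> 'cV[R]_d).
Hypothesis mWn : forall n i, measurable_fun setT (fun w => Wn n w i 0).
Hypothesis mW : forall i, measurable_fun setT (fun w => W w i 0).

Lemma tp_cvg f :
  (forall t, (fun n => Ex P (fun w => cos (dot t (Wn n w)))) @ \oo --> Ex Q (fun w => cos (dot t (W w)))) ->
  (forall t, (fun n => Ex P (fun w => sin (dot t (Wn n w)))) @ \oo --> Ex Q (fun w => sin (dot t (W w)))) ->
  tp f -> (fun n => Ex P (fun w => f (Wn n w))) @ \oo --> Ex Q (fun w => f (W w)).
Proof.
move=> hc hs; have L f' n : tp f' -> L1 P (fun w => f' (Wn n w)).
  move=> tf; have [C hC] := tp_bounded tf.
  by apply: (@L1_bounded _ _ _ _ _ C) => //; exact: tp_measurable.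
have L' f' : tp f' -> L1 Q (fun w => f' (W w)).
  move=> tf; have [C hC] := tp_bounded tf.
  by apply: (@L1_bounded _ _ _ _ _ C) => //; exact: tp_measurable.
elim=> [t|t|f1 f2 t1 h1 t2 h2|a f1 t1 h1]; [exact: hc|exact: hs| |].
  rewrite ExD; [|exact: L'|exact: L'].
  rewrite (_ : (fun n => _) = (fun n => Ex P (fun w => f1 (Wn n w)) + Ex P (fun w => f2 (Wn n w)))).
    exact: cvgD.
  by apply/funext => n; rewrite ExD//; exact: L.
rewrite ExZ; last exact: L'.
rewrite (_ : (fun n => _) = (fun n => a * Ex P (fun w => f1 (Wn n w)))); last first.
  by apply/funext => n; rewrite ExZ//; exact: L.
by apply: cvgM => //; exact: cvg_cst.
Qed.

Lemma trig_approx_seq (g : 'cV[R]_d -> R) M : continuous g -> (forall v, `|g v| <= M) ->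
  exists f_ : nat -> 'cV[R]_d -> R, forall n, [/\ tp (f_ n), forall v, `|f_ n v| <= M &
    forall v : 'cV[R]_d, (forall i, `|v i 0| <= n.+1%:R) -> `|g v - f_ n v| <= n.+1%:R^-1].
Proof.
move=> cg gM; suff h n : exists f, [/\ tp f, forall v, `|f v| <= M &
    forall v : 'cV[R]_d, (forall i, `|v i 0| <= n.+1%:R) -> `|g v - f v| <= n.+1%:R^-1].
  by have [f hf] := choice h; exists f.
have [||f tf [fM fa]] := @trig_approx R d g M n.+1%:R n.+1%:R^-1 cg gM.
- by rewrite ltr0Sn.
- by rewrite invr_gt0 ltr0Sn.
- by exists f.
Qed.

Lemma trig_approx_cvg (g : 'cV[R]_d -> R) (f_ : nat -> 'cV[R]_d -> R) v :
  (forall n (v : 'cV[R]_d), (forall i, `|v i 0| <= n.+1%:R) -> `|g v - f_ n v| <= n.+1%:R^-1) ->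
  (fun n => f_ n v) @ \oo --> g v.
Proof.
move=> fa; apply/cvgrPdist_le => e e0.
exists (Num.truncn (nrm v + e^-1)) => // n /= hn.
have nv : nrm v + e^-1 < n.+1%:R by rewrite (lt_le_trans (truncnS_gt _))// ler_nat.
have ei : 0 < e^-1 by rewrite invr_gt0.
rewrite (le_trans (fa _ _ _))//.
  by move=> i; rewrite (le_trans (nrm_entry v i))//; lra.
rewrite invf_ple ?posrE ?ltr0Sn//; have := nrm_ge0 v; lra.
Qed.

(** The approximating trigonometric polynomial is fixed before [n] grows. Its error under the limit
    law vanishes by bounded convergence; under the converging laws it is controlled by the second
    moments, uniformly for large [n]. *)
Lemma weak_cvg (B : R) :
  (forall t, (fun n => Ex P (fun w => cos (dot t (Wn n w)))) @ \oo --> Ex Q (fun w => cos (dot t (W w)))) ->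
  (forall t, (fun n => Ex P (fun w => sin (dot t (Wn n w)))) @ \oo --> Ex Q (fun w => sin (dot t (W w)))) ->
  (\forall n \near \oo, L1 P (fun w => nsq (Wn n w)) /\ Ex P (fun w => nsq (Wn n w)) <= B) ->
  forall g : 'cV[R]_d -> R, continuous g -> (exists M : R, forall v, `|g v| <= M) ->
  (fun n => ('E_P[g \o Wn n])%E) @ \oo --> ('E_Q[g \o W])%E.
Proof.
move=> hc hs hB g cg [M gM].
have [f_ hf] := trig_approx_seq cg gM.
have fcvg v : (fun n => f_ n v) @ \oo --> g v.
  by apply: trig_approx_cvg => n u; have [_ _] := hf n; apply.
have mg (d1 : measure_display) (O1 : measurableType d1) (X : O1 -> 'cV[R]_d) :
    (forall i, measurable_fun setT (fun w => X w i 0)) -> measurable_fun setT (fun w => g (X w)).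
  move=> mX; apply: (@measurable_fun_cvg _ _ _ _ (fun n w => f_ n (X w))) => //.
    by move=> n; apply: tp_measurable => //; have [] := hf n.
have Lg n : L1 P (fun w => g (Wn n w)) by apply: (@L1_bounded _ _ _ _ _ M) => //; exact: mg.
have Lg' : L1 Q (fun w => g (W w)) by apply: (@L1_bounded _ _ _ _ _ M) => //; exact: mg.
have Lf k n : L1 P (fun w => f_ k (Wn n w)).
  by have [tf fM _] := hf k; apply: (@L1_bounded _ _ _ _ _ M) => //; exact: tp_measurable.
rewrite (ExE Lg').
rewrite (_ : (fun n => _) = (fun n => (Ex P (fun w => g (Wn n w)))%:E)); last first.
  by apply/funext => n; rewrite (ExE (Lg n)).
apply: cvg_EFin; first exact: nearW.
have M0 : 0 <= M by rewrite (le_trans _ (gM 0)).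
have lim1 : (fun k => Ex Q (fun w => f_ k (W w))) @ \oo --> Ex Q (fun w => g (W w)).
  apply: (@Ex_bounded_cvg _ _ _ _ _ _ M).
  - by move=> k; apply: tp_measurable => //; have [] := hf k.
  - exact: mg.
  - by apply: nearW => w; exact: fcvg.
  - by move=> k w; have [_ h _] := hf k.
apply/cvgrPdist_le => e e0.
have lim2 : (fun k : nat => k.+1%:R^-1 * (1 + 2 * M * B) : R) @ \oo --> 0.
  rewrite -[X in _ --> X](mul0r (1 + 2 * M * B)); apply: cvgM; [exact: cvg_harmonic|exact: cvg_cst].
have e3 : 0 < e / 3 by rewrite divr_gt0.
have [k [k1 k2]] : exists k, `|Ex Q (fun w => g (W w)) - Ex Q (fun w => f_ k (W w))| <= e / 3 /\
    `|k.+1%:R^-1 * (1 + 2 * M * B)| <= e / 3.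
  have /cvgrPdist_le /(_ _ e3) h1 := lim1; have /cvgrPdist_le /(_ _ e3) h2 := lim2.
  have [k _ hk] := filterI h1 h2.
  by exists k; have [h3] := hk k (leqnn k); rewrite sub0r normrN.
have [tk fM fa] := hf k.
have /cvgrPdist_le /(_ _ e3) := tp_cvg hc hs tk.
apply: filterS2 hB => n [Ln Bn] dn.
set n1 : R := k.+1%:R in k2 fa; have n10 : 1 <= n1 by rewrite ler1n.
(* A Chebyshev bound in pointwise form: outside the box [nsq] is at least [n1], since the norm
   exceeds [n1] and [n1] is at least 1, so the trivial bound [2 * M] is dominated. *)
have pw w : `|g (Wn n w) - f_ k (Wn n w)| <= n1^-1 + 2 * M * n1^-1 * nsq (Wn n w).
  have s0 : 0 <= 2 * M * n1^-1 * nsq (Wn n w).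
    by rewrite !mulr_ge0 ?nsq_ge0// invr_ge0; lra.
  have [inb|/existsNP[i /negP]] := pselect (forall i, `|Wn n w i 0| <= n1).
    by rewrite (le_trans (fa _ inb))// lerDl.
  rewrite -ltNge => out.
  have : n1 <= nsq (Wn n w).
    rewrite -nrm_sqr expr2; have h := lt_le_trans out (nrm_entry (Wn n w) i).
    rewrite (le_trans (ltW h))// ler_peMl ?nrm_ge0//; lra.
  move=> h; have h2 : 2 * M <= 2 * M * n1^-1 * nsq (Wn n w).
    by rewrite -mulrA ler_peMr// ?mulr_ge0// mulrC ler_pdivlMr ?mul1r//; lra.
  have i0 : 0 <= n1^-1 by rewrite invr_ge0; lra.
  rewrite (le_trans (ler_normB _ _))//; have g1 := gM (Wn n w); have f1 := fM (Wn n w).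
  apply: le_trans (lerD g1 f1) _; apply: le_trans (_ : 2 * M <= _); first by rewrite mulr2n mulrDl mul1r.
  by rewrite (le_trans h2)// lerDr.
have Lr : L1 P (fun w => n1^-1 + 2 * M * n1^-1 * nsq (Wn n w)).
  by apply: L1D; [exact: L1_cst|exact: L1Z].
have d2 : `|Ex P (fun w => f_ k (Wn n w)) - Ex P (fun w => g (Wn n w))| <= e / 3.
  rewrite distrC -ExB//.
  have := @Ex_norm_le _ _ _ P _ _ (measurable_funB (L1_meas (Lg n)) (L1_meas (Lf k n))) Lr pw.
  have -> : Ex P (fun w => n1^-1 + 2 * M * n1^-1 * nsq (Wn n w)) =
      n1^-1 + 2 * M * n1^-1 * Ex P (fun w => nsq (Wn n w)).
    by rewrite ExD ?Ex_cst ?ExZ//; [exact: L1_cst|exact: L1Z].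
  move=> h; apply: le_trans h _; apply: le_trans k2; apply: le_trans (ler_norm _).
  rewrite mulrDr mulr1 lerD2l mulrA (mulrC n1^-1) ler_wpM2l//.
  by rewrite !mulr_ge0// invr_ge0; lra.
have -> : Ex Q (fun w => g (W w)) - Ex P (fun w => g (Wn n w)) =
  (Ex Q (fun w => g (W w)) - Ex Q (fun w => f_ k (W w))) +
  (Ex Q (fun w => f_ k (W w)) - Ex P (fun w => f_ k (Wn n w))) +
  (Ex P (fun w => f_ k (Wn n w)) - Ex P (fun w => g (Wn n w))) by ring.
apply: le_trans (ler_normD _ _) _; apply: le_trans (lerD (ler_normD _ _) (lexx _)) _.
lra.
Qed.

End WeakConvergence.

(** * Algebra of the estimator and bounded combinations of small vectors *)

Section LeastSquares.
Variable R : realType.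

Lemma weighted_summable (e : nat -> R) :
  (exists M : R, forall n, \sum_(1 <= i < n) i%:R * `|e i| <= M) ->
  exists M : R, forall n, \sum_(k < n) `|e k| <= M.
Proof.
move=> [M HM]; exists (`|e 0%N| + M); case=> [|n].
  by rewrite big_ord0 addr_ge0//; have := HM 0%N; rewrite big_geq.
rewrite big_ord_recl lerD2l; apply: le_trans (HM n.+1).
rewrite big_add1 big_mkord ler_sum// => k _.
by rewrite ler_peMl// ler1n.
Qed.

Lemma small_bscale (a : nat -> R) B (z : forall T, 'cV[R]_T) :
  (\forall T \near \oo, `|a T| <= B) -> small z -> small (fun T => a T *: z T).
Proof.
move=> aB zs; have [C C0 zC] := small_bound zs; case: zs => _ zs; split.
  exists (`|B| * C); apply: filterS2 aB zC => T h1 h2.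
  by rewrite nrmZ ler_pM ?nrm_ge0// (le_trans h1)// ler_norm.
move=> e e0; have B1 : 0 < `|B| + 1 by rewrite ltr_wpDl.
apply: filterS2 aB (zs _ (divr_gt0 e0 B1)) => T h1 h2 i; rewrite mxE normrM.
apply: le_trans (ler_pM (normr_ge0 _) (normr_ge0 _) (le_trans h1 (ler_norm _)) (h2 i)) _.
by rewrite mulrA ler_pdivrMr// mulrC ler_pM2l// lerDl.
Qed.

Lemma small_zero : small (fun T => 0 : 'cV[R]_T).
Proof.
split; first by exists 0; apply: nearW => T; rewrite nrm0.
by move=> e e0; apply: nearW => T i; rewrite mxE normr0 ltW.
Qed.

Lemma small_sum (I : Type) (r : seq I) (z : I -> forall T, 'cV[R]_T) :
  (forall i, small (z i)) -> small (fun T => \sum_(i <- r) z i T).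
Proof.
move=> zs; elim: r => [|i r IH].
  by apply: small_ext small_zero => T; rewrite big_nil.
by apply: small_ext (small_add (zs i) IH) => T; rewrite big_cons.
Qed.

Lemma cvg_bounded (a : nat -> R) l : a @ \oo --> l -> \forall T \near \oo, `|a T| <= `|l| + 1.
Proof.
move=> /cvgrPdist_le/(_ _ ltr01); apply: filterS => T h.
have -> : a T = l - (l - a T) by ring.
by rewrite (le_trans (ler_normB _ _))// lerD2l.
Qed.

(** With [X = Z *m S] the Gram matrix is [S *m M *m S], so the outer factors [S] cancel and the
    scaled error depends on [Z] alone. *)
Lemma gls_error T d (X : 'M[R]_(T, d)) (S : 'M[R]_d) (K : 'M[R]_T) (u : 'cV[R]_T) beta :
  S^T = S -> S \in unitmx ->
  (X *m invmx S)^T *m K *m (X *m invmx S) \in unitmx ->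
  S *m (invmx (X^T *m K *m X) *m X^T *m K *m (X *m beta + u) - beta) =
  invmx ((X *m invmx S)^T *m K *m (X *m invmx S)) *m (X *m invmx S)^T *m K *m u.
Proof.
move=> St Su; set Z := X *m invmx S; set M := _^T *m K *m _ => Mu.
have XE : X = Z *m S by rewrite /Z mulmxKV.
have XT : X^T = S *m Z^T by rewrite XE trmx_mul St.
set Y := X^T *m K *m X.
have YE : Y = S *m M *m S by rewrite /Y XT XE /M !mulmxA.
have Yu : Y \in unitmx by rewrite YE !unitmx_mul Su Mu.
have SYS : S *m invmx Y *m S = invmx M.
  have h : S *m invmx Y *m S *m M = 1%:M.
    have -> : S *m invmx Y *m S *m M = S *m invmx Y *m (S *m M *m S) *m invmx S.
      by rewrite !mulmxA mulmxK.
    by rewrite -YE mulmxKV// mulmxV.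
  by rewrite -[LHS](mulmxK Mu) h mul1mx.
rewrite [_ *m (X *m beta + u)]mulmxDr.
have -> : invmx Y *m X^T *m K *m (X *m beta) = beta.
  by rewrite -!mulmxA (mulmxA X^T) (mulmxA (X^T *m K)) -/Y mulKmx.
rewrite addrAC subrr add0r -SYS XT !mulmxA.
by [].
Qed.

Lemma measurable_mulmx (dd : measure_display) (Om : measurableType dd) m n (A : 'M[R]_(m, n))
    (X : Om -> 'cV[R]_n) : (forall i, measurable_fun setT (fun w => X w i 0)) ->
  forall i, measurable_fun setT (fun w => (A *m X w) i 0).
Proof.
move=> mX i; under eq_fun do rewrite mxE.
by apply: measurable_sum => j; exact: measurable_funM.
Qed.

End LeastSquares.

(** * Spectral density as a multiple of the symbol *)

Section SpectralDensity.
Variables (R : realType) (e : nat -> R).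

Lemma spec_dens_even w : spec_dens (fun i : int => e (absz i)) w = ((2 * pi)^-1 * lam e w)%:C.
Proof. by rewrite /spec_dens fourier_even -rmorphM. Qed.

(** A continuous positive function attains a positive minimum on the compact interval; multiplying
    by $2\pi$ passes from density to symbol. *)
Lemma lam_lower :
  (forall w, - pi <= w <= pi -> 0 < complex.Re (spec_dens (fun i : int => e (absz i)) w)) ->
  {within `[- pi, pi], continuous (fun w => complex.Re (spec_dens (fun i : int => e (absz i)) w))} ->
  exists2 c : R, 0 < c & forall w, - pi <= w <= pi -> c <= lam e w.
Proof.
move=> pos cont; have pp : - pi <= pi :> R by have := pi_ge0 R; lra.
have [w0 w0I h] := EVT_min pp cont.
have pi2 : 0 < 2 * pi :> R by rewrite mulr_gt0 ?pi_gt0.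
exists (2 * pi * complex.Re (spec_dens (fun i : int => e (absz i)) w0)).
  by rewrite mulr_gt0// pos// -in_itv.
move=> w wI; have wI' : w \in `[- pi, pi]%R by rewrite in_itv.
have hw : complex.Re (spec_dens (fun i : int => e (absz i)) w0) <=
  complex.Re (spec_dens (fun i : int => e (absz i)) w) := h w wI'.
apply: le_trans (ler_wpM2l (ltW pi2) hw) _.
by rewrite spec_dens_even mulVKf ?gt_eqF.
Qed.

End SpectralDensity.

(** * Limit law of the scaled estimation error *)

Lemma trmx_form (R : comPzRingType) m n (Z : 'M[R]_(m, n)) (K : 'M[R]_m) :
  (Z^T *m K *m Z)^T = Z^T *m K^T *m Z.
Proof. by rewrite !trmx_mul trmxK mulmxA. Qed.

(** The vector inside [K T] combines the columns of [ZT] with convergent, hence bounded,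
    coefficients. *)
Lemma gls_weights_small (R : realType) (d : nat) (x : nat -> 'I_d -> R) (K : forall T, 'M[R]_T) phi
    (G : nat -> 'M[R]_d) L (t : 'cV[R]_d) :
  (forall i, s2 x i @ \oo --> +oo) -> (forall i, (fun T => x T i ^+ 2 / s2 x i T) @ \oo --> 0) ->
  has_symbol K phi -> mcvg G L -> small (fun T => K T *m (ZT x T *m (G T *m t))).
Proof.
move=> G1 G2 HK GL; apply: (has_symbol_small HK).
have Gt := mcvg_mul GL (@mcvg_cst _ _ _ t).
have zs i : small (fun T => (G T *m t) i 0 *: zcol x i T).
  exact: small_bscale (cvg_bounded (Gt i 0)) (zcol_small G1 G2 i).
apply: small_ext (small_sum (index_enum 'I_d) zs) => T.
apply/matrixP => s j; rewrite ord1 !mxE summxE; apply: eq_bigr => i _.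
by rewrite [RHS]mxE mulrC [zcol _ _ _ _ _]mxE.
Qed.

Lemma is_char_normal_law (R : realType) (n : nat) (dd : measure_display) (Om : measurableType dd)
    (Q : probability Om R) (W : Om -> 'cV[R]_n) (C : 'M[R]_n) :
  is_char Q W (fun t => dot t (C *m t)) -> has_normal_law Q W C.
Proof.
move=> [mW hW]; split => // t; have [hc hs] := hW t; have [mc ms] := measurable_cosdot t mW.
have cE : (fun w => cos ((t^T *m W w) ord0 ord0)) = (fun w => cos (dot t (W w))).
  by apply/funext => w; rewrite dotE.
have sE : (fun w => sin ((t^T *m W w) ord0 ord0)) = (fun w => sin (dot t (W w))).
  by apply/funext => w; rewrite dotE.
rewrite cE sE -mulmxA dotE mulNr; split; rewrite ExE ?hc ?hs//.
  by apply: (@L1_bounded _ _ _ _ _ 1) => // w; exact: cos_norm_le1.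
by apply: (@L1_bounded _ _ _ _ _ 1) => // w; exact: sin_norm_le1.
Qed.

Theorem theorem1 (R : realType) (d : nat) (x : nat -> 'I_d -> R)
  (* Grenander conditions *)
  (G1 : forall i, s2 x i @ \oo --> +oo)
  (G2 : forall i, (fun T => x T i ^+ 2 / s2 x i T) @ \oo --> 0)
  (G3 : forall i j k, cvgn (cross x i j k))
  (G4 : Rmx x 0 \in unitmx)
  (* spectral distribution function H of the regressors *)
  (H : R -> 'M[R[i]]_d)
  (H_herm : forall w, - pi <= w <= pi -> conjT (H w) = H w)
  (H_psd : forall w1 w2, - pi <= w1 -> w1 <= w2 -> w2 <= pi ->
      forall z : 'cV[R[i]]_d, 0 <= (conjT z *m (H w2 - H w1) *m z) ord0 ord0)
  (H_R : forall k : int, is_RSmx (fun w => expi (k%:~R * w)) H (cmx (Rmx x k)))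
  (beta : 'cV[R]_d)
  (* errors: (M1), (M2) *)
  (dd : measure_display) (Om : measurableType dd) (P : probability Om R)
  (E : int -> {RV P >-> R}) (sigma2 : R) (theta : int -> R) (U : int -> Om -> R)
  (E_indep : mutually_independent P (fun t => (E t : Om -> R)))
  (E_L2 : forall t, (E t : Om -> R) \in Lfun P 2%:E)
  (E_mean : forall t, ('E_P[E t] = 0)%E)
  (E_var : forall t, ('V_P[E t] = sigma2%:E)%E)
  (theta_sum : abs_summable_Z theta)
  (theta_nz : forall w, - pi <= w <= pi -> fourier_Z theta w != 0)
  (U_meas : forall t, measurable_fun setT (U t))
  (U_def : forall t, {ae P, forall w,
      zsum (fun i => theta i * E (t - i) w) @ \oo --> U t w})
  (M2 : (fun delta : R => ereal_sup (range (fun t : int =>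
      (\int[distribution P (E t)]_(e in [set e : R | (delta < `|e|)%R]) (e ^+ 2)%:E)%E)))
      @ +oo --> 0%E)
  (* the working process V: (M3), (M4) *)
  (eta : nat -> R)
  (dV : measure_display) (OmV : measurableType dV) (PV : probability OmV R)
  (V : int -> OmV -> R)
  (V_L2 : forall t, V t \in Lfun PV 2%:E)
  (V_mean : forall t, ('E_PV[V t] = 'E_PV[V 0%R])%E)
  (V_cov : forall t i : int, covariance PV (V t) (V (t + i)) = (eta (absz i))%:E)
  (M3_real : forall w, - pi <= w <= pi ->
      complex.Im (spec_dens (fun i : int => eta (absz i)) w) = 0)
  (M3_pos : forall w, - pi <= w <= pi ->
      0 < complex.Re (spec_dens (fun i : int => eta (absz i)) w))
  (M3_cont : {within `[- pi, pi],
      continuous (fun w => complex.Re (spec_dens (fun i : int => eta (absz i)) w))})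
  (M3_even : forall w, - pi <= w <= pi ->
      spec_dens (fun i : int => eta (absz i)) (- w) = spec_dens (fun i : int => eta (absz i)) w)
  (M4 : exists M : R, forall n, \sum_(1 <= i < n) i%:R * `|eta i| <= M) :
  let fv := spec_dens (fun i : int => eta (absz i)) in
  let fu := spec_dens (fun h : int => fine (covariance P (U 0%R) (U h))) in
  let Sigma (T : nat) : 'M[R]_T :=
    \matrix_(s < T, t < T) fine ('E_P[U (Posz s.+1) \* U (Posz t.+1)])%E in
  let y (T : nat) (w : Om) : 'cV[R]_T :=
    XT x T *m beta + \col_(t < T) U (Posz t.+1) w in
  let btilde (T : nat) (w : Om) : 'cV[R]_d :=
    invmx ((XT x T)^T *m invmx (Lambda eta T) *m XT x T) *m (XT x T)^T
      *m invmx (Lambda eta T) *m y T w in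
  let G (T : nat) : 'M[R]_d :=
    invmx ((ZT x T)^T *m invmx (Lambda eta T) *m ZT x T) in
  let A (T : nat) : 'M[R]_d :=
    G T *m ((ZT x T)^T *m invmx (Lambda eta T) *m Sigma T *m invmx (Lambda eta T)
      *m ZT x T) *m G T in
  exists Cv : 'M[R]_d,
    (forall i j, (fun T => A T i j) @ \oo --> Cv i j) /\
    cvg_law_normal P (fun T w => ST x T *m (btilde T w - beta)) Cv /\
    exists M1 M2 : 'M[R[i]]_d,
      [/\ is_RSmx (fun w => (fv w)^-1) H M1,
          is_RSmx (fun w => fu w / fv w ^+ 2) H M2 &
          cmx Cv = (2 * pi)%:C *: (invmx M1 *m M2 *m invmx M1)].
Proof.
move=> fv fu Sigma y btilde G A.
have eta_sum := weighted_summable M4.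
have [c c0 lam_c] := lam_lower M3_pos M3_cont.
pose g := gam P U.
have g_sum : exists M : R, forall n, \sum_(k < n) `|g k| <= M.
  exact: (gam_sum E_indep E_L2 E_mean E_var theta_sum U_meas U_def).
have UUE s t : Ex P (fun w => U s w * U t w) = g `|s - t|%N.
  exact: (Ex_UUE E_indep E_L2 E_mean E_var theta_sum U_meas U_def).
have UU s t : L1 P (fun w => U s w * U t w).
  by have [] := Ex_UU E_L2 E_mean E_var theta_sum U_meas U_def s t.
have EU t : Ex P (U t) = 0 /\ L1 P (U t).
  by have [] := Ex_U E_L2 E_mean E_var theta_sum U_meas U_def t.
have SigmaE T : Sigma T = Lambda g T.
  apply/matrixP => s t; rewrite !mxE.
  transitivity (Ex P (fun w => U s.+1%:Z w * U t.+1%:Z w)).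
    by rewrite (ExE (UU _ _)).
  rewrite UUE; congr g; case: (leqP s t); lia.
have fuE w : fu w = ((2 * pi)^-1 * lam g w)%:C.
  rewrite -spec_dens_even /fu; congr (spec_dens _ w); apply/funext => h.
  have E0 t : fine 'E_P[U t]%E = 0 by have [h0 i0] := EU t; rewrite (ExE i0) h0.
  rewrite covariance.unlock !E0.
  transitivity (Ex P (fun w => U 0 w * U h w)); last by rewrite UUE sub0r abszN.
  rewrite -[RHS]/(fine (Ex P _)%:E) -(ExE (UU _ _)); congr (fine _); congr ('E_P[_])%E.
  by apply/funext => v; rewrite -[LHS]/((U 0 v - 0) * (U h v - 0)) !subr0.
have fvE w : fv w = ((2 * pi)^-1 * lam eta w)%:C by exact: spec_dens_even.
pose K T := invmx (Lambda eta T).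
have K_sym T : (K T)^T = K T by exact: Lambda_inv_sym.
have K_symbol : has_symbol K (fun w => (lam eta w)^-1) := Lambda_inv_symbol eta_sum c0 lam_c.
have K_opbd : opbd K c^-1 := Lambda_inv_opbd eta_sum c0 lam_c.
have K_lower := Lambda_inv_lower eta_sum c0 lam_c.
(* The kernel of the middle matrix of the covariance, as $\mathbf{\Sigma}_T$ is the Toeplitz matrix
   of [g]; its symbol is [lam g] over the square of [lam eta]. *)
pose K2 T := K T *m (Lambda g T *m K T).
have K2_symbol : has_symbol K2 (fun w => (lam eta w)^-1 * (lam g w * (lam eta w)^-1)).
  have [C C0 gC] := Lambda_opbd g_sum; have [F F0 gF] := lam_bound g_sum.
  have ci0 : 0 < c^-1 by rewrite invr_gt0.
  apply: (has_symbol_mul ci0 ci0 K_opbd _ K_symbol) => [w wI|].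
    have l0 := lt_le_trans c0 (lam_c w wI).
    by rewrite ger0_norm ?invr_ge0 ?(ltW l0)// lef_pV2// lam_c.
  by apply: (has_symbol_mul C0 F0 gC _ (Lambda_symbol g_sum) K_symbol) => w _; exact: gF.
have [L1' [ZKZ RS1]] := design_symbol_limit G1 G2 G3 H_herm H_psd H_R K_symbol.
have [L2' [ZK2Z RS2]] := design_symbol_limit G1 G2 G3 H_herm H_psd H_R K2_symbol.
have L1u : L1' \in unitmx := gram_limit_unit G1 G3 G4 ZKZ K_sym K_lower.
have GL : mcvg G (invmx L1') := mcvg_inv ZKZ L1u.
pose Cv := invmx L1' *m L2' *m invmx L1'.
have AE T : A T = G T *m ((ZT x T)^T *m K2 T *m ZT x T) *m G T.
  by rewrite /A SigmaE /K2 /K !mulmxA.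
have A_cvg : mcvg A Cv.
  have := mcvg_mul (mcvg_mul GL ZK2Z) GL; congr mcvg.
  by apply/funext => T; rewrite AE.
have G_sym T : (G T)^T = G T.
  by rewrite /G trmx_inv trmx_form K_sym.
(* The weights with which the projection of the scaled error on [t] becomes a linear form in the
   errors; the variance of that form is the quadratic form of [A T] at [t]. *)
pose b (t : 'cV[R]_d) T := K T *m (ZT x T *m (G T *m t)).
have b_small t : small (b t) by exact: gls_weights_small K_symbol GL.
have b_form t T : dot (b t T) (Lambda g T *m b t T) = dot t (A T *m t).
  rewrite /b AE /K2 dot_mulmx K_sym dot_mulmx dot_mulmx G_sym.
  by congr dot; rewrite !mulmxA.
have A_form t : (fun T => dot (b t T) (Lambda g T *m b t T)) @ \oo --> dot t (Cv *m t).
  by under eq_fun do rewrite b_form; exact: mcvg_form.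
have form_sqr t T : L1 P (fun w => lform U (b t T) w ^+ 2) /\
    Ex P (fun w => lform U (b t T) w ^+ 2) = dot t (A T *m t).
  rewrite -b_form.
  exact: (lform_sqr E_indep E_L2 E_mean E_var theta_sum U_meas U_def).
have Cv_psd t : 0 <= dot t (Cv *m t).
  have h : (fun T => dot t (A T *m t)) @ \oo --> dot t (Cv *m t) by exact: mcvg_form.
  apply: (cvgr_to_ge h); apply: nearW => T.
  by have [_ <-] := form_sqr t T; apply: Ex_ge0 => w; exact: sqr_ge0.
have Cv_sym : Cv^T = Cv.
  have A_sym T : (A T)^T = A T.
    have K2_sym : (K2 T)^T = K2 T by rewrite /K2 !trmx_mul !K_sym Lambda_sym mulmxA.
    by rewrite AE (trmx_mul (G T *m _)) (trmx_mul (G T)) trmx_form K2_sym !G_sym mulmxA.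
  apply/matrixP => i j; rewrite mxE; have h := A_cvg j i.
  have e : (fun T => A T j i) = (fun T => A T i j).
    by apply/funext => T; have /matrixP/(_ i j) := A_sym T; rewrite mxE.
  by rewrite e in h; exact: cvg_unique h (A_cvg i j).
pose W T w := ST x T *m (btilde T w - beta).
have W_meas T i : measurable_fun setT (fun w => W T w i 0).
  apply: measurable_mulmx => {}i.
  under eq_fun do rewrite mxE; apply: measurable_funD; last exact: measurable_cst.
  apply: measurable_mulmx => {}i.
  under eq_fun do rewrite mxE; apply: measurable_funD; first exact: measurable_cst.
  by under eq_fun do rewrite mxE; exact: U_meas.
(* Only for large [T], when both the scaling and the normalized Gram matrix are invertible. *)
have W_form : \forall T \near \oo, forall t w, dot t (W T w) = lform U (b t T) w.
  apply: filterS2 (sT_pos_near G1) (mcvg_unit ZKZ L1u) => T sp Mu t w.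
  have STT : (ST x T)^T = ST x T by exact: tr_diag_mx.
  rewrite /W /btilde /y (gls_error _ _ STT (ST_unit sp) Mu) -/(ZT x T) -/(G T).
  transitivity (dot (b t T) (\col_(s < T) U s.+1%:Z w)); last first.
    by apply: eq_bigr => s _; rewrite [(\col__ _) _ _]mxE.
  rewrite /b dot_mulmx K_sym dot_mulmx dot_mulmx G_sym.
  by congr dot; rewrite !mulmxA.
exists Cv; split; [exact: A_cvg|split].
  have [d1 [Om1 [Q [N N_char]]]] := gaussian_exists Cv_sym Cv_psd.
  exists d1, Om1, Q, N; split; first exact: is_char_normal_law.
  have [mN hN] := N_char.
  have clt t := clt_lform E_indep E_L2 E_mean E_var theta_sum U_meas U_def M2 (b_small t) (A_form t).
  (* The coordinates have second moments [A T i i], which converge to [Cv i i]; this gives the bound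
     required for tightness. *)
  apply: (@weak_cvg _ _ _ _ P _ _ Q W N W_meas mN (\sum_i (`|Cv i i| + 1))).
  - move=> t; have [hc _] := clt t; have [-> _] := hN t.
    apply: cvg_trans hc; apply: near_eq_cvg; apply: filterS W_form => T hT.
    by apply: Ex_ext => w; rewrite hT.
  - move=> t; have [_ hs] := clt t; have [_ ->] := hN t.
    apply: cvg_trans hs; apply: near_eq_cvg; apply: filterS W_form => T hT.
    by apply: Ex_ext => w; rewrite hT.
  pose e i : 'cV[R]_d := delta_mx i 0.
  have dot_e i v : dot (e i) v = v i 0.
    rewrite /dot (bigD1 i)//= big1 ?addr0 => [|j ji]; first by rewrite mxE !eqxx mul1r.
    by rewrite mxE (negPf ji) mul0r.
  have bound : \forall T \near \oo, forall i, A T i i <= `|Cv i i| + 1.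
    apply: filter_forall => i; apply: filterS (cvg_bounded (A_cvg i i)) => T.
    by apply: le_trans; exact: ler_norm.
  apply: filterS2 W_form bound => T hT bT.
  have nE w : nsq (W T w) = \sum_i lform U (b (e i) T) w ^+ 2.
    by apply: eq_bigr => i _; rewrite -hT dot_e.
  have -> : (fun w => nsq (W T w)) = (fun w => \sum_i lform U (b (e i) T) w ^+ 2).
    by apply/funext.
  have Li i : L1 P (fun w => lform U (b (e i) T) w ^+ 2) by have [] := form_sqr (e i) T.
  split; first exact: L1_sum.
  rewrite Ex_sum// ler_sum// => i _; have [_ ->] := form_sqr (e i) T.
  by rewrite dot_e -colE mxE.
(* A density is its symbol divided by $2\pi$, so both $1/f_v$ and $f_u/f_v^2$ exceed the
   corresponding quotients of symbols by one factor $2\pi$. The sandwich then carries [k^-1], which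
   the prefactor $2\pi$ cancels. *)
pose k : R[i] := (2 * pi)%:C.
have pi2 : 2 * pi != 0 :> R by rewrite mulf_neq0 ?pnatr_eq0// gt_eqF ?pi_gt0.
have k0 : k != 0 by rewrite /k -(rmorph0 (real_complex R)) (inj_eq (@complexI R)).
exists (k *: cmx L1'), (k *: cmx L2'); split.
- move=> i j; rewrite mxE.
  have -> : (fun w => (fv w)^-1) = (fun w => k * ((lam eta w)^-1)%:C).
    by apply/funext => w; rewrite fvE -fmorphV invfM invrK rmorphM.
  by apply: is_RS_scale; exact: RS1.
- move=> i j; rewrite mxE.
  have -> : (fun w => fu w / fv w ^+ 2) =
      (fun w => k * ((lam eta w)^-1 * (lam g w * (lam eta w)^-1))%:C).
    apply/funext => w; rewrite fvE fuE -rmorphXn -fmorphV -!rmorphM; congr (_ %:C).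
    (* The integrands are compared at every real [w], while [lam_c] covers only $[-\pi,\pi]$; at a
       zero of [lam eta] both sides are 0 by the convention for inverses. *)
    have [->|l0] := eqVneq (lam eta w) 0; first by rewrite mulr0 expr0n/= invr0 !mulr0.
    have : pi != 0 :> R by rewrite gt_eqF ?pi_gt0.
    by move: (@pi R) => p p0; field; rewrite l0.
  by apply: is_RS_scale; exact: RS2.
rewrite /cmx /Cv !map_mxM map_invmx -!/(cmx _).
have L1cu : cmx L1' \in unitmx by rewrite map_unitmx.
have -> : invmx (k *: cmx L1') = k^-1 *: invmx (cmx L1').
  by rewrite invmxZ ?unitfE// unitmxZ ?unitfE.
rewrite -/k -!(scalemxAl, scalemxAr) !scalerA -[LHS]scale1r; congr (_ *: _).
by move: k k0 => k k0; field; rewrite k0.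
Qed.
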